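(* Let $n+1=2r+2\ge 2$ be even and let $\mathbb V_{n+1}$ be the nonsplit nondegenerate $F/F_0$-hermitian space of dimension $n+1$. Let $L^{\#}\subset\mathbb V_{n+1}$ be a hermitian $O_F$-lattice (of full rank) which has an orthogonal decomposition of hermitian lattices $L^{\#}=L\perp I_1^{-1}$. Then $$\partial\mathrm{Den}(L)=\tfrac12\,\partial\mathrm{Den}(L^{\#}).$$
   Context: $p$ is an odd prime, $F_0/\mathbb Q_p$ a finite extension with residue field $\mathbb F_q$, $F/F_0$ a ramified quadratic extension with Galois involution $a\mapsto\bar a$, $\pi\in F$ a uniformizer with $\bar\pi=-\pi$, $\pi_0=\pi^2$. Hermitian forms are linear in the first variable. A hermitian $O_F$-lattice is a finite free $O_F$-module $L$ with a form $h:L\times L\to F$ making $L\otimes_{O_F}F$ a nondegenerate $F/F_0$-hermitian space; it is integral if $h(L,L)\subset\pi^{-1}O_F$. $H$ is the rank 2 hermitian lattice with moment matrix $\begin{pmatrix}0&\pi^{-1}\\-\pi^{-1}&0\end{pmatrix}$, $H^s$ is the orthogonal direct sum of $s$ copies of $H$, and for $\epsilon\in O_{F_0}^\times$, $I_1^\epsilon$ is the rank 1 hermitian lattice with a generator of norm $\epsilon$. The symbol $\perp$ denotes orthogonal direct sum. Put $M_n=H^{n/2}$ if $n$ is even and $M_n=H^{(n-1)/2}\perp I_1^1$ if $n$ is odd. A hermitian space of dimension $n$ (or a lattice of rank $n$ spanning it) is split if isometric to $M_n\otimes F$, nonsplit otherwise. For integral hermitian lattices $(M,h_M)$ of rank $m'$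 and $(L,h_L)$ of rank $n$, $$\mathrm{Den}(M,L)=\lim_{d\to\infty}\frac{|\mathrm{Herm}_{L,M}(O_{F_0}/\pi_0^d)|}{q^{d\,n(2m'-n)}},$$ where $\mathrm{Herm}_{L,M}(O_{F_0}/\pi_0^d)$ is the set of $O_F$-linear maps $\phi:L/\pi^{2d}L\to M/\pi^{2d}M$ with $\bar h_M(\phi(x),\phi(y))=\bar h_L(x,y)$ for all $x,y$, $\bar h$ being the induced pairing with values in $\pi^{-1}O_F/\pi^{2d-1}O_F$. If $L$ is not integral, $\mathrm{Den}(M,L)=0$ for integral $M$. There is a unique polynomial $\mathrm{Den}(M,L,X)\in\mathbb Q[X]$ with $\mathrm{Den}(M,L,q^{-2k})=\mathrm{Den}(M\perp H^k,L)$ for all integers $k\ge0$. For a nonsplit hermitian lattice $L$ of rank $n$, $$\mathrm{Den}'(L)=-2\,\frac{\mathrm d}{\mathrm dX}\Big|_{X=1}\mathrm{Den}(M_n,L,X),\qquad \partial\mathrm{Den}(L)=\frac{\mathrm{Den}'(L)}{\mathrm{Den}(M_n,M_n)}.$$ (In the statement, $L$ has rank $n=2r+1$ and is automatically nonsplit.) *)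

(* Defs.v *)
From HB Require Import structures.
From mathcomp Require Import all_boot all_order all_algebra fieldext.
From mathcomp Require Import generic_quotient ring_quotient.
From mathcomp Require Import finmap.
From mathcomp Require Import all_classical all_reals all_analysis.
Import numFieldNormedType.Exports.

Set Implicit Arguments.
Unset Strict Implicit.
Unset Printing Implicit Defensive.

Import Order.TTheory GRing.Theory Num.Theory.
Local Open Scope ring_scope.

(* The value at 0, morally +oo, is unconstrained: it is always excluded. *)
Record valuation (K : fieldType) := Valuation {
  vfun :> K -> int;
  vfunM : forall x y, x != 0 -> y != 0 -> vfun (x * y) = vfun x + vfun y;
  vfunD : forall x y, x != 0 -> y != 0 -> x + y != 0 ->
    Num.min (vfun x) (vfun y) <= vfun (x + y);
  vfun_surj : exists2 x, x != 0 & vfun x = 1 }.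

(* [vge v m] is the m-th power of the maximal ideal of v (fractional ideal). *)
Definition vge (K : fieldType) (v : valuation K) (m : int) : {pred K} :=
  fun x => (x == 0) || (m <= v x).

Definition vring (K : fieldType) (v : valuation K) : {pred K} := vge v 0.

Section ValuationRing.
Variables (K : fieldType) (v : valuation K).

Lemma vfun1 : v 1 = 0.
Proof.
have := vfunM v (oner_neq0 K) (oner_neq0 K).
by rewrite mulr1 -[LHS]addr0 => /addrI.
Qed.

Lemma vfunN1 : v (-1) = 0.
Proof.
have N1 : (-1 : K) != 0 by rewrite oppr_eq0 oner_neq0.
have := vfunM v N1 N1; rewrite mulrNN mulr1 vfun1 => /eqP.
by rewrite eq_sym -mulr2n mulrn_eq0 /= => /eqP.
Qed.

Lemma vring_subring : subring_closed (vring v).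
Proof.
have N1 : (-1 : K) != 0 by rewrite oppr_eq0 oner_neq0.
split; rewrite /vring /vge.
- by rewrite unfold_in vfun1 lexx orbT.
- move=> x y; rewrite !unfold_in => hx hy.
  have [->|x0] := eqVneq x 0.
    have [->|y0] := eqVneq y 0; first by rewrite subr0 eqxx.
    rewrite sub0r -mulN1r vfunM // vfunN1 add0r.
    by move: hy; rewrite (negPf y0) /= => ->; rewrite orbT.
  have [->|y0] := eqVneq y 0; first by rewrite subr0.
  have [//|xy0] := eqVneq (x - y) 0; apply/orP; right.
  have yN0 : - y != 0 by rewrite oppr_eq0.
  apply: le_trans (vfunD v x0 yN0 xy0).
  move: hx hy; rewrite (negPf x0) (negPf y0) /= => hx hy.
  by rewrite le_min hx -mulN1r vfunM // vfunN1 add0r.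
- move=> x y; rewrite !unfold_in => hx hy.
  have [->|x0] := eqVneq x 0; first by rewrite mul0r eqxx.
  have [->|y0] := eqVneq y 0; first by rewrite mulr0 eqxx.
  move: hx hy; rewrite (negPf x0) (negPf y0) /= => hx hy.
  by rewrite vfunM // addr_ge0 // orbT.
Qed.

HB.instance Definition _ := GRing.isSubringClosed.Build K (vring v)
  vring_subring.

Record vint := VInt { vval : K; vvalP : vval \in vring v }.

HB.instance Definition _ := [isSub for vval].
HB.instance Definition _ := [Choice of vint by <:].
HB.instance Definition _ := [SubChoice_isSubComNzRing of vint by <:].

End ValuationRing.

(* (K, v) is the completion of Q for the p-adic valuation. *)
Record is_Qp (p : nat) (K : fieldType) (v : valuation K) : Prop := IsQp {
  Qp_char0 : [pchar K] =i pred0;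
  Qp_val : forall n : nat, (0 < n)%N -> v n%:R = logn p n;
  Qp_dense : forall (x : K) (m : int), exists r : rat, x - ratr r \in vge v m;
  Qp_complete : forall u : nat -> K,
    (forall m : int, exists N : nat, forall i j : nat,
        (N <= i)%N -> (N <= j)%N -> u i - u j \in vge v m) ->
    exists l : K, forall m : int, exists N : nat, forall i : nat,
        (N <= i)%N -> u i - l \in vge v m }.

Definition has_ramification_index (K : fieldType) (L : fieldExtType K)
    (v : valuation K) (w : valuation L) (e : nat) : Prop :=
  forall x : K, x != 0 -> w x%:A = v x *+ e.

(* Finite extensions carry their (unique) normalized extension of the p-adic
   valuation, and F_0 its residue field, given by a surjection from the
   valuation ring whose kernel is the maximal ideal. *)
Record ramQuadExt (p : nat) := RamQuadExt {
  Qp : fieldType;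
  vQp : valuation Qp;
  QpP : is_Qp p vQp;
  F0 : fieldExtType Qp;
  v0 : valuation F0;
  v0_ext : exists2 e : nat, (0 < e)%N & has_ramification_index vQp v0 e;
  resField : finFieldType;
  resMap : {rmorphism vint v0 -> resField};
  resMap_surj : forall y, exists x, resMap x = y;
  resMap_ker : forall x, (resMap x == 0) = (vval x \in vge v0 1);
  F : fieldExtType F0;
  F_quadratic : \dim {:F} = 2;
  vF : valuation F;
  F_ramified : has_ramification_index v0 vF 2;
  conjF : involutive_rmorphism F;
  conjF_fix : forall a : F0, conjF a%:A = a%:A;
  conjF_nontriv : exists x, conjF x != x;
  piF : F;
  piF_neq0 : piF != 0;
  piF_uniformizer : vF piF = 1;
  piF_conj : conjF piF = - piF }.

Definition OF p (E : ramQuadExt p) := vint (vF E).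
HB.instance Definition _ p (E : ramQuadExt p) :=
  GRing.ComNzRing.on (OF E).

Definition resq p (E : ramQuadExt p) : nat := #|resField E|.

Lemma pi_int p (E : ramQuadExt p) : piF E \in vring (vF E).
Proof. by rewrite unfold_in /vge piF_uniformizer orbT. Qed.

Definition piO p (E : ramQuadExt p) : OF E := VInt (pi_int E).

Record hermSpace p (E : ramQuadExt p) := HermSpace {
  hs_sort :> vectType (F E);
  hs_form : {hermitian_sym hs_sort for conjF E};
  hs_nondeg : nondegenerate hs_form }.

Definition free_basis (A : nzRingType) (L : lmodType A) n (b : n.-tuple L) :=
  forall x : L, exists! c : 'rV[A]_n, x = \sum_i c 0 i *: tnth b i.

(* (V, i) is the extension of scalars of (L, h) from O_F to F, where L is free
   of rank n: i is O_F-linear and isometric, and it maps an O_F-basis of L to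
   an F-basis of V. *)
Definition is_extension p (E : ramQuadExt p) n (L : lmodType (OF E))
    (h : L -> L -> F E) (V : hermSpace E) (i : L -> V) : Prop :=
  [/\ forall a x y, i (a *: x + y) = vval a *: i x + i y,
      forall x y, hs_form V (i x) (i y) = h x y &
      exists2 b : n.-tuple L, free_basis b & basis_of fullv (map_tuple i b)].

Record hermLattice p (E : ramQuadExt p) := HermLattice {
  hl_sort :> lmodType (OF E);
  hl_form : hl_sort -> hl_sort -> F E;
  rk : nat;
  hl_ext : exists (V : hermSpace E) (i : hl_sort -> V),
    is_extension rk hl_form i }.

(* L is a lattice of full rank in V, i.e. V is isometric to L tensor F. *)
Definition lattice_in p (E : ramQuadExt p) (L : hermLattice E)
    (V : hermSpace E) : Prop :=
  exists i : L -> V, is_extension (rk L) (@hl_form p E L) i.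

Definition isometric p (E : ramQuadExt p) (L M : hermLattice E) : Prop :=
  exists f : {linear L -> M},
    bijective f /\ forall x y, hl_form (f x) (f y) = hl_form x y.

Definition integral_lattice p (E : ramQuadExt p) (L : hermLattice E) : Prop :=
  forall x y : L, hl_form x y \in vge (vF E) (-1).

Section Constructions.
Variables (p : nat) (E : ramQuadExt p).

(* The lattice O_F^n of row vectors with moment matrix G. *)
Section Gram.
Variables (n : nat) (G : hermitian_matrix n false (conjF E)).
Hypothesis Gunit : (G : 'M[F E]_n) \in unitmx.

Lemma gram_nondeg : nondegenerate
  (form_of_matrix (conjF E) G : {hermitian_sym 'rV[F E]_n for conjF E}).
Proof.
apply/eqP/vspaceP => x; rewrite memv0; apply/idP/eqP => [|->]; last exact: mem0v.
move=> /mem_orthovP h; suff : x *m G = 0.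
  by move=> xG; rewrite -[x](mulmxK Gunit) xG mul0mx.
apply/rowP => j; rewrite [RHS]mxE -(h (delta_mx 0 j) (memvf _)).
by rewrite /= /form_of_matrix trmx_delta map_delta_mx -colE trace_mx11 [RHS]mxE.
Qed.

Definition gram_space : hermSpace E := HermSpace gram_nondeg.

Definition gram_emb (x : 'rV[OF E]_n) : gram_space := map_mx (@vval _ _) x.

Lemma gram_ext : is_extension n
  (fun x y : 'rV[OF E]_n => hs_form gram_space (gram_emb x) (gram_emb y)) gram_emb.
Proof.
split=> //.
  by move=> a x y; apply/rowP => j; rewrite !mxE.
exists [tuple delta_mx 0 i | i < n].
  move=> x; exists x; split.
    by rewrite [LHS]row_sum_delta; apply: eq_bigr => i _; rewrite tnth_mktuple.
  move=> c ->; rewrite [RHS]row_sum_delta.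
  by apply: eq_bigr => i _; rewrite tnth_mktuple.
rewrite basisEdim size_tuple dimvf /dim /= mul1n leqnn andbT.
apply/subvP => /= x _; rewrite [x]row_sum_delta.
apply: rpred_sum => i _; apply: rpredZ; apply: memv_span.
apply/mapP; exists (delta_mx 0 i); first by apply/mapP; exists i; rewrite ?mem_enum.
by apply/rowP => j; rewrite !mxE; case: (_ && _).
Qed.

Definition gram_lattice : hermLattice E :=
  HermLattice (ex_intro _ gram_space (ex_intro _ gram_emb gram_ext)).

End Gram.

Section Oplus.

Lemma sum_pair0r (U W : zmodType) (I : finType) (f : I -> U) :
  (\sum_i f i, 0 : W) = \sum_i (f i, 0 : W).
Proof.
apply: (big_morph (fun x : U => (x, 0 : W)) (op1 := +%R) (op2 := +%R)) => // x y.
by congr pair; rewrite /= addr0.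
Qed.

Lemma sum_pair0l (U W : zmodType) (I : finType) (f : I -> W) :
  (0 : U, \sum_i f i) = \sum_i (0 : U, f i).
Proof.
apply: (big_morph (fun y : W => (0 : U, y)) (op1 := +%R) (op2 := +%R)) => // x y.
by congr pair; rewrite /= addr0.
Qed.

Section Space.
Variables V W : hermSpace E.

Definition oplus_sform (x y : V * W) : F E :=
  hs_form V x.1 y.1 + hs_form W x.2 y.2.

Lemma oplus_sbilinear : bilinear_for
  (GRing.Scale.Law.clone _ _ ( *%R ) _)
  (GRing.Scale.Law.clone _ _ (conjF E \; *%R ) _) oplus_sform.
Proof.
split=> [u'|u] a x y; rewrite /oplus_sform /=.
  by rewrite !linearPl /= mulrDr addrACA.
by rewrite !linearPr /= mulrDr addrACA.
Qed.

HB.instance Definition _ := bilinear_isBilinear.Build _ _ _ _ _ _ oplus_sform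
  oplus_sbilinear.

Lemma oplus_sherm x y : oplus_sform x y = (-1) ^+ false * conjF E (oplus_sform y x).
Proof.
by rewrite /oplus_sform rmorphD mulrDr -!hermC.
Qed.

HB.instance Definition _ := @isHermitianSesquilinear.Build _ _ _ _ oplus_sform
  oplus_sherm.

Lemma oplus_snondeg :
  nondegenerate (oplus_sform : {hermitian_sym (V * W)%type for conjF E}).
Proof.
apply/eqP/vspaceP => x; rewrite memv0; apply/idP/eqP => [|->]; last exact: mem0v.
move=> /mem_orthovP h.
have hV : x.1 \in orthov (hs_form V) fullv.
  apply/mem_orthovP => y _; rewrite -(h (y, 0) (memvf _)).
  by rewrite /= /oplus_sform /= linear0r addr0.
have hW : x.2 \in orthov (hs_form W) fullv.
  apply/mem_orthovP => y _; rewrite -(h (0, y) (memvf _)).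
  by rewrite /= /oplus_sform /= linear0r add0r.
move: hV hW; rewrite (eqP (hs_nondeg V)) (eqP (hs_nondeg W)) !memv0.
by case: x {h} => x1 x2 /= /eqP -> /eqP ->.
Qed.

Definition oplus_space : hermSpace E :=
  HermSpace oplus_snondeg.
End Space.

Variables L M : hermLattice E.

Definition oplus_form (x y : L * M) : F E :=
  hl_form x.1 y.1 + hl_form x.2 y.2.

Lemma oplus_ext : exists (V : hermSpace E) (i : (L * M)%type -> V),
  is_extension (rk L + rk M) oplus_form i.
Proof.
have [V [i [ilin iform [b bL ib]]]] := hl_ext L.
have [W [j [jlin jform [c cM jc]]]] := hl_ext M.
have i0 : i 0 = 0.
  by have := ilin 1 0 0; rewrite scale1r addr0 scale1r -[LHS]addr0 => /addrI.
have j0 : j 0 = 0.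
  by have := jlin 1 0 0; rewrite scale1r addr0 scale1r -[LHS]addr0 => /addrI.
exists (oplus_space V W), (fun x => (i x.1, j x.2)); split.
- by move=> a x y; rewrite /= ilin jlin.
- by move=> x y; rewrite /= /oplus_sform /= iform jform.
pose bc := cat_tuple (map_tuple (fun x => (x, 0 : M)) b)
                     (map_tuple (fun y => (0 : L, y)) c).
have sum_bc (d : 'rV[OF E]_(rk L + rk M)) :
    \sum_k d 0 k *: tnth bc k =
    (\sum_k (lsubmx d) 0 k *: tnth b k, \sum_k (rsubmx d) 0 k *: tnth c k).
  have sumC (c' : 'I_(rk L) -> OF E) (c'' : 'I_(rk M) -> OF E) :
      \sum_k (c' k *: tnth b k, 0 : M) + \sum_k (0 : L, c'' k *: tnth c k)
      = (\sum_k c' k *: tnth b k, \sum_k c'' k *: tnth c k).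
    rewrite -sum_pair0r -sum_pair0l.
    by congr pair => /=; rewrite ?addr0 ?add0r.
  rewrite -sumC big_split_ord /=; congr (_ + _); apply: eq_bigr => k _.
    rewrite tnth_lshift tnth_map mxE.
    by congr pair; rewrite /= scaler0.
  rewrite tnth_rshift tnth_map mxE.
  by congr pair; rewrite /= scaler0.
exists bc.
  move=> [x y].
  have [d [dx du]] := bL x; have [e [ey eu]] := cM y.
  exists (row_mx d e); split.
    by rewrite sum_bc row_mxKl row_mxKr -dx -ey.
  move=> f; rewrite sum_bc => -[/du -> /eu ->]; exact: hsubmxK.
rewrite basisEdim size_tuple.
apply/andP; split; last first.
  move/size_basis: ib; move/size_basis: jc.
  by rewrite !dimvf /dim /= => <- <-.
set X := map_tuple _ bc.
have inl x : (x, 0) \in <<X>>%VS.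
  have : x \in <<map_tuple i b>>%VS by rewrite (span_basis ib) memvf.
  move=> /coord_span ->.
  rewrite sum_pair0r.
  apply: rpred_sum => k _.
  have -> : forall a, (a *: (map_tuple i b)`_k, 0 : W)
      = a *: ((map_tuple i b)`_k, 0 : W).
    by move=> a; congr pair; rewrite /= scaler0.
  apply: rpredZ; apply: memv_span; apply/mapP.
  exists (tnth b k, 0); last by rewrite /= j0 -tnth_nth tnth_map.
  rewrite mem_cat; apply/orP; left; apply/mapP.
  by exists (tnth b k) => //; apply: mem_tnth.
have inr y : (0, y) \in <<X>>%VS.
  have : y \in <<map_tuple j c>>%VS by rewrite (span_basis jc) memvf.
  move=> /coord_span ->.
  rewrite sum_pair0l.
  apply: rpred_sum => k _.
  have -> : forall a, (0 : V, a *: (map_tuple j c)`_k)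
      = a *: (0 : V, (map_tuple j c)`_k).
    by move=> a; congr pair; rewrite /= scaler0.
  apply: rpredZ; apply: memv_span; apply/mapP.
  exists (0, tnth c k); last by rewrite /= i0 -tnth_nth tnth_map.
  rewrite mem_cat; apply/orP; right; apply/mapP.
  by exists (tnth c k) => //; apply: mem_tnth.
apply/subvP => /= -[x y] _.
have -> : (x, y) = (x, 0) + (0, y).
  by congr pair; rewrite /= ?addr0 ?add0r.
by rewrite rpredD.
Qed.

Definition oplus : hermLattice E := HermLattice oplus_ext.
End Oplus.

Lemma unitary1_herm (eps : F0 E) :
  (eps%:A)%:M \is hermitianmx 1 false (conjF E).
Proof.
apply/is_hermitianmxP; rewrite expr0 scale1r.
by apply/matrixP => i j; rewrite !ord1 !mxE /= mulr1n conjF_fix.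
Qed.

Lemma unitary1_unit (eps : F0 E) : eps != 0 ->
  (HermitianMx (unitary1_herm eps) : 'M[F E]_1) \in unitmx.
Proof.
by move=> e0; rewrite unitmxE /= det_scalar1 unitfE scaler_eq0 oner_eq0 orbF.
Qed.

Definition I1 (eps : F0 E) (eps_unit : eps != 0 /\ v0 E eps = 0) :
    hermLattice E :=
  gram_lattice (unitary1_unit eps_unit.1).

Definition unit1 : (1 : F0 E) != 0 /\ v0 E 1 = 0 :=
  conj (oner_neq0 _) (vfun1 _).

Definition H_mx : 'M[F E]_2 :=
  \matrix_(i, j) if i == j then 0 else if i == 0 then (piF E)^-1 else - (piF E)^-1.

Lemma H_herm : H_mx \is hermitianmx 2 false (conjF E).
Proof.
apply/is_hermitianmxP; rewrite expr0 scale1r.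
apply/matrixP => i j; rewrite !mxE [j == i]eq_sym.
case: eqVneq => [_|ij]; first by rewrite rmorph0.
have cpi : conjF E (piF E)^-1 = - (piF E)^-1 by rewrite fmorphV /= (piF_conj E) invrN.
case: (eqVneq j 0) => [j0|j0]; case: (eqVneq i 0) => [i0|i0].
- by rewrite i0 j0 eqxx in ij.
- by rewrite cpi.
- by rewrite rmorphN /= cpi opprK.
- by move: ij i0 j0; case: i => [[|[|//]] ?]; case: j => [[|[|//]] ?].
Qed.

Lemma H_unit : (HermitianMx H_herm : 'M[F E]_2) \in unitmx.
Proof.
rewrite unitmxE /= (expand_det_row _ 0) !big_ord_recl big_ord0 /cofactor !det_mx11.
rewrite !mxE /= mul0r add0r addr0 unitfE !mulf_eq0 !negb_or.
by rewrite /bump /= ?addn0 ?add0n ?expr1 !oppr_eq0 invr_eq0 piF_neq0 oner_neq0.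
Qed.

Definition latticeH : hermLattice E := gram_lattice H_unit.

Lemma zero_herm : (0 : 'M[F E]_0) \is hermitianmx 0 false (conjF E).
Proof. by apply/is_hermitianmxP/matrixP => -[]. Qed.

Lemma zero_unit : (HermitianMx zero_herm : 'M[F E]_0) \in unitmx.
Proof. by rewrite unitmxE det_mx00 unitr1. Qed.

Definition lattice0 : hermLattice E := gram_lattice zero_unit.

Definition Hpow (s : nat) : hermLattice E := iter s (oplus latticeH) lattice0.

Definition latticeM (n : nat) : hermLattice E :=
  if odd n then oplus (Hpow n./2) (I1 unit1) else Hpow n./2.

Definition split_space (V : hermSpace E) : Prop :=
  lattice_in (latticeM (\dim {:V})) V.

End Constructions.

Lemma unitN1 p (E : ramQuadExt p) : (-1 : F0 E) != 0 /\ v0 E (-1) = 0.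
Proof. by split; [rewrite oppr_eq0 oner_neq0 | exact: vfunN1]. Qed.

Section QuotientModule.
Variables (A : comNzRingType) (a : A) (L : lmodType A).

Definition scaled : {pred L} := fun x => `[< exists y, x = a *: y >].

Lemma scaled_zmod : zmod_closed scaled.
Proof.
split=> [|x y]; first by apply/asboolP; exists 0; rewrite scaler0.
move=> /asboolP[x' ->] /asboolP[y' ->].
by apply/asboolP; exists (x' - y'); rewrite scalerBr.
Qed.

HB.instance Definition _ := GRing.isZmodClosed.Build L scaled scaled_zmod.

Definition lquot := Quotient.quot scaled.
HB.instance Definition _ := GRing.Zmodule.on lquot.
HB.instance Definition _ := EqQuotient.on lquot.

Definition to_quot (x : L) : lquot := \pi_(Quotient.quot scaled)%qT x.

Lemma to_quotP x y : reflect (exists z, x - y = a *: z) (to_quot x == to_quot y).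
Proof.
rewrite /to_quot -[_ == _]Quotient.idealrBE.
exact: asboolP.
Qed.

Lemma to_quotD x y : to_quot (x + y) = to_quot x + to_quot y.
Proof. by rewrite /to_quot raddfD. Qed.

Definition qscale (c : A) (x : lquot) : lquot := to_quot (c *: repr x).

Lemma qscaleE c x : qscale c (to_quot x) = to_quot (c *: x).
Proof.
apply/eqP/to_quotP.
have /to_quotP[z hz] : to_quot (repr (to_quot x)) == to_quot x.
  by apply/eqP; exact: reprK.
by exists (c *: z); rewrite -scalerBr hz !scalerA mulrC.
Qed.

Lemma to_quot_surj (x : lquot) : x = to_quot (repr x).
Proof. by rewrite /to_quot reprK. Qed.

Fact qscaleA b c x : qscale b (qscale c x) = qscale (b * c) x.
Proof. by rewrite (to_quot_surj x) !qscaleE scalerA. Qed.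
Fact qscale1 : left_id 1 qscale.
Proof. by move=> x; rewrite (to_quot_surj x) !qscaleE scale1r. Qed.
Fact qscaleDr : right_distributive qscale +%R.
Proof.
move=> c x y; rewrite (to_quot_surj x) (to_quot_surj y).
by rewrite -to_quotD !qscaleE scalerDr to_quotD.
Qed.
Fact qscaleDl x : {morph qscale^~ x : b c / b + c}.
Proof. by move=> b c; rewrite (to_quot_surj x) !qscaleE scalerDl to_quotD. Qed.

HB.instance Definition _ := GRing.Zmodule_isLmodule.Build A lquot
  qscaleA qscale1 qscaleDr qscaleDl.

End QuotientModule.

Section Density.
Variables (R : realType) (p : nat) (E : ramQuadExt p).

(* Congruence of the forms in pi^-1 O_F / pi^(2d-1) O_F is tested on all
   lifts; for integral lattices it does not depend on the lifts. *)
Definition Herm (L M : hermLattice E) (d : nat) :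
    set (lquot (piO E ^+ d.*2) L -> lquot (piO E ^+ d.*2) M) :=
  [set phi | linear phi /\
    forall (x y : L) (x' y' : M),
      phi (to_quot _ x) = to_quot _ x' -> phi (to_quot _ y) = to_quot _ y' ->
      hl_form x' y' - hl_form x y \in vge (vF E) (d.*2%:Z - 1)]%classic.
Arguments Herm : clear implicits.

(* Herm L M d is finite, so fset_set enumerates it. *)
Definition Den (M L : hermLattice E) : R :=
  if `[< integral_lattice L >] then
    limn (fun d : nat => (#|` fset_set (Herm L M d)|%fset)%:R /
      (resq E)%:R ^ (d%:Z * (rk L)%:Z * (2 * (rk M)%:Z - (rk L)%:Z)) : R)
  else 0.

Definition is_DenX (M L : hermLattice E) (P : {poly rat}) : Prop :=
  forall k : nat,
    ratr P.[((resq E)%:R ^- k.*2)] = Den (oplus M (Hpow E k)) L.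

(* As q > 1, is_DenX M L has at most one solution; xget selects it. *)
Definition DenX (M L : hermLattice E) : {poly rat} := xget 0 (is_DenX M L).

Definition Den' (L : hermLattice E) : R :=
  - 2 * ratr (DenX (latticeM E (rk L)) L)^`().[1].

Definition dDen (L : hermLattice E) : R :=
  Den' L / Den (latticeM E (rk L)) (latticeM E (rk L)).

End Density.

(* Main.v *)
Require Import Defs.
From HB Require Import structures.
From mathcomp Require Import all_boot all_order all_fingroup all_algebra all_field all_character.
From mathcomp Require Import fieldext generic_quotient ring_quotient ring lra zify finmap.
From mathcomp Require Import all_classical all_reals all_analysis.
Import numFieldNormedType.Exports.
Set Implicit Arguments.
Unset Strict Implicit.
Unset Printing Implicit Defensive.
Import Order.TTheory GRing.Theory Num.Theory.
Local Open Scope ring_scope.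

(** The theorem is a comparison of two density polynomials, for
    M' = M_{2r+2} = H^{r+1} and M = M_{2r+1} = H^r \perp I_1^1:

      Den(M', L#, X) = (1 - q^{-2(r+1)} X) Den(M, L, X).             (1)

    As V is nonsplit, Den(M', L#, 1) = 0 (2).  The first factor of (1) does not
    vanish at X = 1, so Den(M, L, 1) = 0 as well, and the derivatives at 1
    satisfy Den'(L#) = (1 - q^{-2(r+1)}) Den'(L).  The normalising densities
    are Den(M, M) = 2 \prod_{i <= r} (1 - q^{-2i}) and
    Den(M', M') = \prod_{i <= r+1} (1 - q^{-2i})                      (3),
    and the quotients differ by the factor 2.

    Counting.  Multiplication by pi turns an integral hermitian form into a
    skew-hermitian one with entries in O_F: H becomes the hyperbolic plane with
    matrix (0 1; -1 0), while I_1^1 and I_1^{-1} become (pi) and (-pi).  Over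
    the finite ring O_F / pi^{2d+2} the densities count the matrices X with
    X G X^* = S ([has_gram_card_Herm]).

    Proof of (1).  Split X into its first row x, which has norm -pi, and the
    rest.  In a hyperbolic space every vector of norm -pi is primitive, and
    Eichler transformations move a primitive vector to e + b f in one hyperbolic
    plane ([trans_prim]); its orthogonal complement is (pi) \perp H^{k-1}, which
    is M \perp H^{k-r-1}.  This gives [nreps_vector].  The number of vectors x
    follows from an equidistribution: the norms of primitive vectors take every
    skew value equally often ([equidistributed_Hsum]).

    Proof of (3).  In the same way hyperbolic pairs can be split off
    ([nreps_hyperbolic]); the block (pi) contributes the elements of norm 1, which
    the Cayley transform counts ([card_norm1]) and which give the factor 2.

    The limit.  Every skew matrix that is congruent to S modulo a high power of
    pi is g S g^* for an invertible g, so that the normalised counts are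
    eventually constant, from a level that depends on L alone ([nreps_step],
    [Den_stable]).

    Polynomiality.  Expand the count along the additive characters of the square
    matrices.  Each further hyperbolic plane multiplies the term of a character
    chi by the sum of the values of chi at A B^* - B A^* , which is the square
    of a power of q: a maximal isotropic submodule over the real elements is its
    own orthogonal ([gauss_sum]).  Hence the count is polynomial in q^{-2k} ([nreps_poly]).

    Proof of (2).  If the density of L# in H^{r+1} did not vanish, then there would
    be isometries modulo every power of pi.  F is complete, and a self-adjoint
    square root obtained by Newton iteration corrects a good approximation to
    an isometry over F ([approx_congruence]), so V would be split. *)

(** * Skew-hermitian forms and isometries over a ring with involution *)
Definition adj (R : comNzRingType) (s : R -> R) m n (A : 'M[R]_(m, n)) : 'M[R]_(n, m) :=
  (map_mx s A)^T.

(** Vectors of the orthogonal sum of a hyperbolic plane with basis (e, f) and of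
    another module, as rows: the columns [A] and [B] are the coordinates along
    e and f. *)
Definition tri (R : comNzRingType) n m (A B : 'cV[R]_n) (W : 'M[R]_(n, m)) :
  'M[R]_(n, 1 + 1 + m) := row_mx (row_mx A B) W.

(** The moment matrix of H multiplied by pi. *)
Definition Jmx (R : comNzRingType) : 'M[R]_(1 + 1) := block_mx 0 1%:M (- 1%:M) 0.

Definition Hsum (R : comNzRingType) m (G : 'M[R]_m) : 'M[R]_(1 + 1 + m) :=
  block_mx (Jmx R) 0 0 G.

Section Adj.
Variables (R : comNzRingType) (s : {rmorphism R -> R}).
Hypothesis sK : involutive s.
Local Notation "A ^*" := (adj s A) : ring_scope.

Lemma adjD m n (A B : 'M[R]_(m, n)) : (A + B)^* = A^* + B^*.
Proof. by rewrite /adj map_mxD raddfD. Qed.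
Lemma adjN m n (A : 'M[R]_(m, n)) : (- A)^* = - A^*.
Proof. by rewrite /adj map_mxN raddfN. Qed.
Lemma adjB m n (A B : 'M[R]_(m, n)) : (A - B)^* = A^* - B^*.
Proof. by rewrite adjD adjN. Qed.
Lemma adj0 m n : (0 : 'M[R]_(m, n))^* = 0.
Proof. by rewrite /adj map_mx0 trmx0. Qed.
Lemma adj1 n : (1%:M : 'M[R]_n)^* = 1%:M.
Proof. by rewrite /adj map_mx1 trmx1. Qed.
Lemma adjM m n k (A : 'M[R]_(m, n)) (B : 'M[R]_(n, k)) : (A *m B)^* = B^* *m A^*.
Proof. by rewrite /adj map_mxM trmx_mul. Qed.
Lemma adjK m n (A : 'M[R]_(m, n)) : (A^*)^* = A.
Proof. by apply/matrixP => i j; rewrite !mxE sK. Qed.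
Lemma adjZ m n a (A : 'M[R]_(m, n)) : (a *: A)^* = s a *: A^*.
Proof. by apply/matrixP => i j; rewrite !mxE rmorphM. Qed.
Lemma adj_scalar n a : (a%:M : 'M[R]_n)^* = (s a)%:M.
Proof. by rewrite /adj map_scalar_mx tr_scalar_mx. Qed.
Lemma adj_row m n1 n2 (A : 'M[R]_(m, n1)) (B : 'M[R]_(m, n2)) :
  (row_mx A B)^* = col_mx A^* B^*.
Proof. by rewrite /adj map_row_mx tr_row_mx. Qed.
Lemma adj_col m n1 n2 (A : 'M[R]_(n1, m)) (B : 'M[R]_(n2, m)) :
  (col_mx A B)^* = row_mx A^* B^*.
Proof. by rewrite /adj map_col_mx tr_col_mx. Qed.
Lemma adj_block m1 m2 n1 n2 (A : 'M[R]_(m1, n1)) (B : 'M[R]_(m1, n2))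
  (C : 'M[R]_(m2, n1)) (D : 'M[R]_(m2, n2)) :
  (block_mx A B C D)^* = block_mx A^* C^* B^* D^*.
Proof. by rewrite /adj map_block_mx tr_block_mx. Qed.

Lemma triP n m (X : 'M[R]_(n, 1 + 1 + m)) :
  X = tri (lsubmx (lsubmx X)) (rsubmx (lsubmx X)) (rsubmx X).
Proof. by rewrite /tri !hsubmxK. Qed.

Lemma form_tri n n' m (G : 'M[R]_m) (A B : 'cV[R]_n) (W : 'M[R]_(n, m))
    (A' B' : 'cV[R]_n') (W' : 'M[R]_(n', m)) :
  tri A B W *m Hsum G *m (tri A' B' W')^* =
  A *m B'^* - B *m A'^* + W *m G *m W'^*.
Proof.
rewrite /tri /Hsum /Jmx !adj_row !mul_row_block !mulmx0 !add0r !addr0.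
rewrite mulmx1 mulmxN mulmx1 !mul_row_col mulNmx.
by rewrite [- _ + _]addrC.
Qed.

Lemma adj_Hsum m (G : 'M[R]_m) : G^* = - G -> (Hsum G)^* = - Hsum G.
Proof.
move=> skG; rewrite /Hsum /Jmx !adj_block skG !adj0 adjN adj1.
by rewrite !opp_block_mx !oppr0 opprK.
Qed.

Lemma mul_tri n m k (A B : 'cV[R]_n) (W : 'M[R]_(n, m)) (e f : 'rV[R]_k) (V : 'M[R]_(m, k)) :
  tri A B W *m col_mx (col_mx e f) V = A *m e + B *m f + W *m V.
Proof. by rewrite /tri !mul_row_col. Qed.

Lemma mx_tri n' n m (A : 'M[R]_(n', n)) (a b : 'cV[R]_n) (w : 'M[R]_(n, m)) :
  A *m tri a b w = tri (A *m a) (A *m b) (A *m w).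
Proof. by rewrite /tri !mul_mx_row. Qed.

Lemma triD n m (A B : 'cV[R]_n) (W : 'M[R]_(n, m)) A' B' W' :
  tri A B W + tri A' B' W' = tri (A + A') (B + B') (W + W').
Proof. by rewrite /tri !add_row_mx. Qed.

Definition isom m (G P : 'M[R]_m) := P *m G *m P^* = G /\ exists P', P *m P' = 1%:M.

Lemma isomM m (G P P' : 'M[R]_m) : isom G P -> isom G P' -> isom G (P *m P').
Proof.
move=> [h [Q hQ]] [h' [Q' hQ']]; split.
  by rewrite adjM !mulmxA -(mulmxA P) -(mulmxA P) h'.
by exists (Q' *m Q); rewrite mulmxA -(mulmxA P) hQ' mulmx1.
Qed.

Lemma isom_form m (G P : 'M[R]_m) n n' (X : 'M[R]_(n, m)) (Y : 'M[R]_(n', m)) :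
  isom G P -> (X *m P) *m G *m (Y *m P)^* = X *m G *m Y^*.
Proof. by move=> [h _]; rewrite adjM !mulmxA -(mulmxA X) -(mulmxA X) h. Qed.

Lemma isomP m (G P P' : 'M[R]_m) :
  (forall n (X : 'M[R]_(n, m)), (X *m P) *m G *m (X *m P)^* = X *m G *m X^*) ->
  P *m P' = 1%:M -> isom G P.
Proof.
move=> h PP'; split; last by exists P'.
by have := h m 1%:M; rewrite !mul1mx adj1 mulmx1.
Qed.

Variable h2 : R.
Hypothesis h2P : h2 + h2 = 1.

Lemma s_h2 : s h2 = h2.
Proof.
have e : s h2 + s h2 = 1 by rewrite -rmorphD h2P rmorph1.
by rewrite -[LHS]mulr1 -h2P mulrDr -mulrDl e mul1r.
Qed.

Lemma halfD m n (A : 'M[R]_(m, n)) : h2 *: A + h2 *: A = A.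
Proof. by rewrite -scalerDl h2P scale1r. Qed.

Section Moves.
Variables (m : nat) (G : 'M[R]_m).
Hypothesis skG : G^* = - G.

(** The Eichler transformation of [w]: e is mapped to e + (w, w)/2 f + w, f is
    fixed, and y in the second summand is mapped to y + (y, w) f. *)
Definition eichler_mx (w : 'rV[R]_m) : 'M[R]_(1 + 1 + m) :=
  col_mx (col_mx (tri 1%:M (h2 *: (w *m G *m w^*)) w) (tri 0 1%:M 0))
         (tri 0 (G *m w^*) 1%:M).

Lemma eichlerE w n (A B : 'cV[R]_n) W :
  tri A B W *m eichler_mx w =
  tri A (A *m (h2 *: (w *m G *m w^*)) + B + W *m (G *m w^*)) (A *m w + W).
Proof.
rewrite /eichler_mx mul_tri !mx_tri !mulmx1 !mulmx0 !triD.
by rewrite !addr0.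
Qed.

Lemma skew_form n (w : 'M[R]_(n, m)) : (w *m G *m w^*)^* = - (w *m G *m w^*).
Proof. by rewrite !adjM adjK skG mulNmx mulmxN mulmxA. Qed.

Lemma eichlerK w : eichler_mx w *m eichler_mx (- w) = 1%:M.
Proof.
rewrite -[LHS]mul1mx [1%:M]triP mulmxA !eichlerE; congr tri.
  rewrite adjN !mulmxN !mulNmx opprK mulmxDl !mulmxA.
  set A := lsubmx _; set B := rsubmx (lsubmx 1%:M); set W := rsubmx _.
  rewrite -!scalemxAr !mulmxA.
  set x1 := A *m _ *m _ *m _; set x2 := W *m _ *m _.
  have -> : - (x1 + x2) = - (h2 *: x1 + h2 *: x1) - x2 by rewrite halfD opprD.
  by apply/matrixP => i j; rewrite !mxE; ring.
by rewrite mulmxN addKr.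
Qed.

Lemma isom_eichler w : isom (Hsum G) (eichler_mx w).
Proof.
apply: (@isomP _ _ _ (eichler_mx (- w))) => [n X|]; last exact: eichlerK.
rewrite [X]triP eichlerE !form_tri !adjD (adjM _ (h2 *: _)) adjZ skew_form !adjM adjK skG s_h2.
set A := lsubmx _; set B := rsubmx (lsubmx X); set W := rsubmx X.
rewrite ?(mulmxDl, mulmxDr) ?(mulmxN, mulNmx, scalerN) -?scalemxAr -?scalemxAl -?scalemxAr ?(mulmxN, mulNmx) ?mulmxA.
set x1 := A *m w *m G *m w^* *m A^*.
set x2 := A *m B^*; set x4 := B *m _.
set x5 := W *m G *m w^* *m A^*.
set x6 := W *m G *m W^*; set x7 := A *m w *m _ *m _.
rewrite -[X in _ + _ + (X + _ + _) = _]halfD.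
by apply/matrixP => i j; rewrite !mxE; ring.
Qed.

Definition swap_mx : 'M[R]_(1 + 1 + m) :=
  col_mx (col_mx (tri 0 (- 1%:M) 0) (tri 1%:M 0 0)) (tri 0 0 1%:M).

Lemma swapE n (A B : 'cV[R]_n) (W : 'M[R]_(n, m)) :
  tri A B W *m swap_mx = tri B (- A) W.
Proof. by rewrite mul_tri !mx_tri !triD mulmxN !mulmx0 !mulmx1 !addr0 !add0r. Qed.

Lemma isom_swap : isom (Hsum G) swap_mx.
Proof.
apply: (@isomP _ _ _ (swap_mx *m swap_mx *m swap_mx)) => [n X|].
  rewrite [X]triP swapE !form_tri adjN mulmxN mulNmx opprK.
  by rewrite [- _ + _]addrC.
by rewrite -[LHS]mul1mx [1%:M]triP !mulmxA !swapE !opprK -triP.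
Qed.

Definition shift_mx (a : R) : 'M[R]_(1 + 1 + m) :=
  col_mx (col_mx (tri 1%:M a%:M 0) (tri 0 1%:M 0)) (tri 0 0 1%:M).

Lemma shiftE a n (A B : 'cV[R]_n) (W : 'M[R]_(n, m)) :
  tri A B W *m shift_mx a = tri A (a *: A + B) W.
Proof.
by rewrite mul_tri !mx_tri !triD !mulmx1 mul_mx_scalar !mulmx0 !addr0 !add0r.
Qed.

Lemma isom_shift a : s a = a -> isom (Hsum G) (shift_mx a).
Proof.
move=> sa; apply: (@isomP _ _ _ (shift_mx (- a))) => [n X|].
  rewrite [X]triP shiftE !form_tri adjD adjZ sa mulmxDr mulmxDl -scalemxAr -scalemxAl.
  set x := a *: _; set y := _ *m _^*; set z := _ *m (lsubmx _)^*.
  by apply/matrixP => i j; rewrite !mxE; ring.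
by rewrite -[LHS]mul1mx [1%:M]triP !mulmxA !shiftE scaleNr addKr -triP.
Qed.

Definition dil_mx (u v : R) : 'M[R]_(1 + 1 + m) :=
  col_mx (col_mx (tri u%:M 0 0) (tri 0 v%:M 0)) (tri 0 0 1%:M).

Lemma dilE u v n (A B : 'cV[R]_n) (W : 'M[R]_(n, m)) :
  tri A B W *m dil_mx u v = tri (u *: A) (v *: B) W.
Proof.
by rewrite mul_tri !mx_tri !triD mulmx1 !mul_mx_scalar !mulmx0 !addr0 !add0r.
Qed.

Lemma isom_dil u v : u * s v = 1 -> isom (Hsum G) (dil_mx u v).
Proof.
move=> uv; have vu : v * s u = 1 by rewrite -(rmorph1 s) -uv rmorphM sK mulrC.
apply: (@isomP _ _ _ (dil_mx (s v) (s u))) => [n X|].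
  rewrite [X]triP dilE !form_tri !adjZ -!scalemxAr -!scalemxAl !scalerA.
  by rewrite [s v * u]mulrC uv [s u * _]mulrC vu !scale1r.
rewrite -[LHS]mul1mx [1%:M]triP !mulmxA !dilE !scalerA.
by rewrite [s v * u]mulrC uv [s u * _]mulrC vu !scale1r -triP.
Qed.

End Moves.
End Adj.

(** * Orbits of primitive vectors *)
Section Orbits.
Variables (R : finComNzRingType) (s : {rmorphism R -> R}).
Local Notation "A ^*" := (adj s A) : ring_scope.
Definition unitb (x : R) := [exists y, x * y == 1].
Hypothesis sK : involutive s.
Variable h2 : R.
Hypothesis h2P : h2 + h2 = 1.
Hypothesis locR : forall x y, unitb (x + y) -> unitb x || unitb y.

Lemma unitbP x : reflect (exists y, x * y = 1) (unitb x).
Proof. by apply: (iffP existsP) => -[y /eqP h]; exists y => //; apply/eqP. Qed.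

Lemma unitbMl x y : unitb (x * y) -> unitb x.
Proof. by move=> /unitbP[z h]; apply/unitbP; exists (y * z); rewrite mulrA. Qed.
Lemma unitbMr x y : unitb (x * y) -> unitb y.
Proof. by rewrite mulrC; apply: unitbMl. Qed.
Lemma unitbN x : unitb (- x) = unitb x.
Proof.
apply/unitbP/unitbP => -[y h]; exists (- y); first by rewrite mulrN -mulNr.
by rewrite mulrNN.
Qed.
Definition prim m (G : 'M[R]_m) (x : 'rV[R]_m) :=
  [exists z : 'rV[R]_m, unitb ((x *m G *m z^*) 0 0)].

Section Trans.
Variables (m : nat) (G : 'M[R]_m).
Hypothesis skG : G^* = - G.

Lemma scal11 (a b : R) : (a%:M : 'M[R]_1) *m b%:M = (a * b)%:M.
Proof. by rewrite -scalar_mxM. Qed.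

Lemma form_tri11 a b w c d z :
  tri a%:M b%:M w *m Hsum G *m (tri c%:M d%:M z)^* =
  (a * s d - b * s c)%:M + w *m G *m z^*.
Proof. by rewrite form_tri !adj_scalar !scal11 raddfB. Qed.

Lemma row_triP (x : 'rV[R]_(1 + 1 + m)) : exists a b w, x = tri a%:M b%:M w.
Proof.
rewrite [x]triP; set A := lsubmx _; set B := rsubmx (lsubmx x).
by exists (A 0 0), (B 0 0), (rsubmx x); rewrite -!mx11_scalar.
Qed.

Lemma prim_tri a b w :
  prim (Hsum G) (tri a%:M b%:M w) = [|| unitb a, unitb b | prim G w].
Proof.
apply/existsP/or3P => [[z]|].
  have [c [d [y ->]]] := row_triP z.
  rewrite form_tri11 !mxE /= mulr1n => /locR /orP[|wy].
    move=> /locR /orP[/unitbMl ->|]; first by constructor.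
    by rewrite unitbN => /unitbMl ->; constructor 2.
  by constructor 3; apply/existsP; exists y; rewrite !mxE.
case=> [ua|ub|/existsP[y wy]].
- exists (tri 0%:M 1%:M 0).
  rewrite form_tri11 adj0 mulmx0 addr0 mxE mulr1n !rmorph0 !rmorph1.
  by rewrite mulr0 subr0 mulr1.
- exists (tri 1%:M 0%:M 0).
  rewrite form_tri11 adj0 mulmx0 addr0 mxE mulr1n !rmorph0 !rmorph1.
  by rewrite mulr0 sub0r mulr1 unitbN.
exists (tri 0%:M 0%:M y).
by rewrite form_tri11 !rmorph0 !mulr0 subr0 raddf0 add0r.
Qed.

(** The isometry is the identity, the exchange of e and f, or an Eichler
    transformation conjugated by that exchange, according to the coordinate that
    makes the vector primitive. *)
Lemma prim_unit_coord (x : 'rV[R]_(1 + 1 + m)) : prim (Hsum G) x ->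
  exists P a b w, [/\ isom s (Hsum G) P, x *m P = tri a%:M b%:M w & unitb a].
Proof.
have [a [b [w ->]]] := row_triP x; rewrite prim_tri.
have [ua _|Nua] := boolP (unitb a).
  exists 1%:M, a, b, w; split=> //; last by rewrite mulmx1.
  by split; [rewrite mul1mx adj1 mulmx1|exists 1%:M; rewrite mulmx1].
have [ub _|Nub /=] := boolP (unitb b).
  exists (swap_mx R m), b, (- a), w; split=> //; first exact: isom_swap.
  by rewrite swapE raddfN.
move=> /existsP[z wz]; pose S := swap_mx R m.
pose a' := b * (h2 * (z *m G *m z^*) 0 0) - a + (w *m G *m z^*) 0 0.
exists (S *m eichler_mx s h2 G z *m S), a', (- b), (b *: z + w); split.
- by do 2?[apply: isomM; last exact: isom_swap|exact: isom_eichler]; apply: isomM;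
    [exact: isom_swap|exact: isom_eichler].
- rewrite !mulmxA swapE eichlerE swapE /a' !raddfD /= !raddfN /= !mul_scalar_mx; congr tri.
  + rewrite mulmxA [X in _ + X = _]mx11_scalar -scal11 mul_scalar_mx; congr (b *: _ + _ + _).
    by rewrite [LHS]mx11_scalar mxE.
- move: wz; rewrite -[X in unitb X -> _](addrK (b * (h2 * (z *m G *m z^*) 0 0) - a)).
  rewrite [X in X - _]addrC -/a' => /locR/orP[//|]; rewrite unitbN.
  move=> /locR/orP[/unitbMl ub|]; first by rewrite ub in Nub.
  by rewrite unitbN (negPf Nua).
Qed.

(** Witt's theorem for primitive vectors: their norm determines their orbit.
    After a unit has been put in the first coordinate, an Eichler transformation
    removes the component in the second summand, a dilation makes the first
    coordinate 1, and a shift e -> e + c f with c real reduces the second one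
    to its skew part, which the norm determines. *)
Lemma trans_prim (x : 'rV[R]_(1 + 1 + m)) : prim (Hsum G) x ->
  exists2 P, isom s (Hsum G) P &
    x *m P = tri 1%:M (- h2 *: (x *m Hsum G *m x^*)) 0.
Proof.
move=> /prim_unit_coord[P [a [b [w [isoP xP /unitbP[u au]]]]]].
have vu : u * s (s a) = 1 by rewrite sK mulrC.
pose D := dil_mx m u (s a); pose E := eichler_mx s h2 G (- u *: w).
have isoD : isom s (Hsum G) D by apply: isom_dil.
have isoE : isom s (Hsum G) E by apply: isom_eichler.
have [b' e] : exists b' : R, x *m (P *m E *m D) = tri 1%:M b'%:M 0.
  rewrite !mulmxA xP eichlerE dilE; set B := _ + _ + _.
  exists (s a * B 0 0); congr tri.
  - by rewrite scale_scalar_mx mulrC au.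
  - by rewrite -scale_scalar_mx -mx11_scalar.
  - by rewrite mul_scalar_mx scalerA mulrN au scaleN1r addNr.
pose c := - h2 * (b' + s b').
have sc : s c = c by rewrite rmorphM rmorphN (s_h2 s h2P) rmorphD sK addrC.
exists (P *m E *m D *m shift_mx m c).
  by do !(apply: isomM => //); apply: isom_shift.
rewrite mulmxA e shiftE; congr tri.
rewrite -(isom_form x x (isomM (isomM isoP isoE) isoD)) e form_tri11.
rewrite mul0mx mul0mx addr0 (rmorph1 s) mul1r !mulr1 !scale_scalar_mx -raddfD /=.
congr (_%:M). rewrite /c mulr1 -[X in _ + X]mul1r -h2P; ring.
Qed.

End Trans.
End Orbits.

(** * Splitting off a vector or a hyperbolic pair *)
Lemma card_bij (A B : finType) (P : pred A) (Q : pred B) (f : A -> B) (g : B -> A) :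
  (forall x, P x -> Q (f x) /\ g (f x) = x) ->
  (forall y, Q y -> P (g y) /\ f (g y) = y) ->
  #|[set x | P x]| = #|[set y | Q y]|.
Proof.
move=> fP gP; rewrite -(card_in_imset (f := f) (D := [set x | P x])).
  apply: eq_card => y; apply/imsetP/idP.
    by move=> [x]; rewrite inE => /fP[qx _] ->; rewrite inE.
  by rewrite inE => /gP[pg e]; exists (g y); rewrite ?inE.
move=> x y; rewrite !inE => /fP[_ ex] /fP[_ ey] e.
by rewrite -ex -ey e.
Qed.

Lemma card_fibers (A B C : finType) (f : A * B -> C) (g : C -> A * B)
    (P : pred C) (Q : pred A) (k : nat) :
  cancel f g -> cancel g f ->
  (forall a b, P (f (a, b)) -> Q a) ->
  (forall a, Q a -> #|[set b | P (f (a, b))]| = k) ->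
  #|[set c | P c]| = (#|[set a | Q a]| * k)%N.
Proof.
move=> fK gK PQ Pk.
rewrite (@card_bij _ _ P (fun ab => P (f ab)) g f); last first.
- by move=> y py; rewrite fK.
- by move=> x px; rewrite gK.
rewrite -sum1_card (eq_bigl (fun ab : A * B => Q ab.1 && P (f (ab.1, ab.2)))); last first.
  move=> [a b]; rewrite inE /=; apply/idP/andP => [h|[]//]; split=> //; exact: PQ h.
rewrite -(pair_big_dep Q (fun a b => P (f (a, b))) (fun _ _ => 1%N)) /=.
rewrite -sum_nat_const [RHS](eq_bigl Q); last by move=> a; rewrite inE.
by apply: eq_bigr => a /Pk <-; rewrite -sum1_card; apply: eq_bigl => b; rewrite inE.
Qed.

Definition nreps (R : finComNzRingType) (s : R -> R) m n (G : 'M[R]_m) (S : 'M[R]_n) :=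
  #|[set X : 'M[R]_(n, m) | X *m G *m adj s X == S]|.

Section Reduction.
Variables (R : finComNzRingType) (s : {rmorphism R -> R}).
Local Notation "A ^*" := (adj s A) : ring_scope.
Hypothesis sK : involutive s.
Variable h2 : R.
Hypothesis h2P : h2 + h2 = 1.
Hypothesis locR : forall x y : R, unitb (x + y) -> unitb x || unitb y.
Variables (m : nat) (G : 'M[R]_m).
Hypothesis skG : G^* = - G.

Let skH : (Hsum G)^* = - Hsum G := adj_Hsum skG.

Lemma gram_sum n1 n2 k (K : 'M[R]_k) (x : 'M[R]_(n1, k)) (y : 'M[R]_(n2, k)) :
  K^* = - K -> forall A D,
  (col_mx x y *m K *m (col_mx x y)^* == block_mx A 0 0 D) =
  [&& x *m K *m x^* == A, y *m K *m x^* == 0 & y *m K *m y^* == D].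
Proof.
move=> skK A D; rewrite adj_col mul_col_mx mul_col_row.
apply/eqP/and3P => [/eq_block_mx[-> _ -> ->]//|[/eqP-> /eqP e /eqP->]].
have -> : x *m K *m y^* = - (y *m K *m x^*)^*.
  by rewrite !adjM (adjK sK) skK mulNmx mulmxN opprK mulmxA.
by rewrite e adj0 oppr0.
Qed.

Lemma card_isom n k (K P : 'M[R]_k) (Q : pred 'M[R]_(n, k)) :
  isom s K P -> #|[set y : 'M[R]_(n, k) | Q (y *m P)]| = #|[set y | Q y]|.
Proof.
move=> [_ [P' PP']]; have P'P := mulmx1C PP'.
apply: (@card_bij _ _ _ _ (mulmx^~ P) (mulmx^~ P')) => y q.
  by rewrite -mulmxA PP' mulmx1.
by rewrite -mulmxA P'P mulmx1.
Qed.

(** The complement of a vector of norm u in the orthogonal sum of a hyperbolic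
    plane and G is always the sum of (-u) and G, because all these vectors form
    one orbit. *)
Lemma nreps_vector (u : R) n (S : 'M[R]_n) :
  (forall x : 'rV[R]_(1 + 1 + m), x *m Hsum G *m x^* = u%:M -> prim s (Hsum G) x) ->
  nreps s (Hsum G) (block_mx (u%:M : 'M[R]_1) 0 0 S) =
  (nreps s (Hsum G) (u%:M : 'M[R]_1) * nreps s (block_mx ((- u)%:M : 'M[R]_1) 0 0 G) S)%N.
Proof.
move=> pr; rewrite /nreps.
apply: (@card_fibers 'M[R]_(1, _) 'M[R]_(n, _) _
  (fun xy => col_mx xy.1 xy.2) (fun X => (usubmx X, dsubmx X))).
- by move=> [x y] /=; rewrite col_mxKu col_mxKd.
- by move=> X; rewrite vsubmxK.
- by move=> x y /=; rewrite gram_sum // => /and3P[].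
move=> x /eqP xu /=.
have [P isoP xP] := trans_prim sK h2P locR skG (pr x xu).
have su : s u = - u.
  move: (congr1 (@adj _ s 1 1) xu); rewrite !adjM (adjK sK) skH adj_scalar mulNmx mulmxN mulmxA xu.
  by move=> /matrixP/(_ 0 0); rewrite !mxE !mulr1n.
set b := - h2 * u.
have sb : s b = - b by rewrite rmorphM rmorphN (s_h2 s h2P) su mulrN.
have bb : b + b = - u by rewrite -mulrDl -opprD h2P mulN1r.
move: xP; rewrite xu scale_scalar_mx -/b => xP.
(* The isometry moves x to e + b f; its complement is spanned by e - b f, of norm
   -u as 2b = -u, and by the second summand. *)
transitivity #|[set y : 'M[R]_(n, 1 + 1 + m) |
   (y *m Hsum G *m (tri 1%:M b%:M 0)^* == 0) && (y *m Hsum G *m y^* == S)]|.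
  rewrite -[RHS](card_isom _ isoP); apply: eq_card => y; rewrite !inE gram_sum // xu eqxx /=.
  by rewrite -xP !(isom_form _ _ isoP).
apply: (@card_bij _ _ _ _ (fun y : 'M[R]_(n, 1 + 1 + m) => row_mx (lsubmx (lsubmx y)) (rsubmx y))
  (fun y => tri (lsubmx y) (s b *: lsubmx y) (rsubmx y))) => y.
  rewrite [y]triP; move: (lsubmx (lsubmx y)) (rsubmx (lsubmx y)) (rsubmx y) => A B W.
  rewrite !form_tri !adj_scalar adj0 mulmx0 addr0 /= /tri !(row_mxKl, row_mxKr).
  rewrite (rmorph1 s) mulmx1 mul_mx_scalar subr_eq0 => /andP[/eqP <- /eqP <-]; split=> //.
  rewrite mul_row_block !mulmx0 addr0 add0r adj_row mul_row_col adjZ sK.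
  rewrite -scalemxAr -scalemxAl mul_mx_scalar -scalemxAl -scalerBl.
  by rewrite sb opprK bb.
rewrite -[y]hsubmxK; move: (lsubmx y) (rsubmx y) => A W.
rewrite !form_tri !adj_scalar adj0 mulmx0 addr0 /= /tri !(row_mxKl, row_mxKr).
rewrite (rmorph1 s) mulmx1 mul_mx_scalar subrr eqxx /=.
rewrite mul_row_block !mulmx0 addr0 add0r adj_row mul_row_col adjZ sK.
rewrite -scalemxAr -scalemxAl mul_mx_scalar -scalemxAl -scalerBl.
by rewrite sb opprK bb.
Qed.

(** The first vector of a hyperbolic pair is primitive and moves to e.  An Eichler
    transformation and a shift that fix e then move the second one to f. *)
Lemma hyp_pair (a : 'M[R]_(1 + 1, 1 + 1 + m)) : a *m Hsum G *m a^* = Jmx R ->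
  exists2 P, isom s (Hsum G) P & a *m P = col_mx (tri 1%:M 0 0) (tri 0 1%:M 0).
Proof.
rewrite -[a]vsubmxK; move: (usubmx a) (dsubmx a) => x z.
rewrite adj_col mul_col_mx mul_col_row => /eq_block_mx[xx xz _ zz].
have prx : prim s (Hsum G) x.
  apply/existsP; exists z; rewrite xz mxE; apply/unitbP; exists 1; exact: mulr1.
have [P isoP xP] := trans_prim sK h2P locR skG prx.
rewrite xx scaler0 in xP.
move: xz zz; rewrite -(isom_form x z isoP) -(isom_form z z isoP) xP.
have [a' [b [w zP]]] := row_triP (z *m P); rewrite zP.
rewrite -[in tri 1%:M 0](raddf0 (@scalar_mx R 1)) !form_tri11 !mul0mx addr0.
rewrite mul0r subr0 mul1r => /(congr1 (@adj _ s 1 1)); rewrite adj_scalar adj1 sK => /matrixP/(_ 0 0).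
rewrite !mxE !mulr1n => b1; rewrite b1 (rmorph1 s) mulr1 mul1r => zz.
pose S := swap_mx R m.
have isoS : isom s (Hsum G) S by apply: isom_swap.
pose E := S *m eichler_mx s h2 G (- w) *m S *m S *m S.
have isoE : isom s (Hsum G) E.
  by do 3!(apply: isomM => //); apply: isomM => //; apply: isom_eichler.
have xE : tri 1%:M 0 0 *m E = tri 1%:M 0 0 :> 'rV[R]_(1 + 1 + m).
  by rewrite !mulmxA swapE eichlerE !swapE !mul0mx !opprK !(add0r, addr0) ?oppr0 ?opprK.
have [c zE] : exists c : R, tri a'%:M 1%:M w *m E = tri c%:M 1%:M 0.
  rewrite !mulmxA swapE eichlerE !swapE !opprK !mul1mx addNr.
  set B := _ + _ + _; exists (- B 0 0).
  by rewrite raddfN /= -mx11_scalar.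
have sc : s c = c.
  have : tri c%:M 1%:M 0 *m Hsum G *m (tri c%:M 1%:M (0 : 'M[R]_(1, m)))^* = 0.
    by rewrite -zE (isom_form _ _ isoE) -[LHS]/(_ *m _ *m _) form_tri11 (rmorph1 s) mulr1 mul1r.
  rewrite form_tri11 !mul0mx addr0 (rmorph1 s) mulr1 mul1r => /matrixP/(_ 0 0).
  by rewrite !mxE mulr1n => /eqP; rewrite subr_eq0 => /eqP <-.
pose F := S *m shift_mx m c *m S *m S *m S.
have isoF : isom s (Hsum G) F.
  by do 3!(apply: isomM => //); apply: isomM => //; apply: isom_shift.
exists (P *m E *m F); first by apply: isomM => //; apply: isomM.
rewrite mul_col_mx !(mulmxA _ (P *m E)) !(mulmxA _ P) xP zP xE b1 zE !mulmxA; congr col_mx.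
  rewrite swapE shiftE !swapE. by rewrite scaler0 !(add0r, addr0, opprK, oppr0) (raddf0 (@scalar_mx R 1)).
rewrite swapE shiftE !swapE !opprK scale_scalar_mx mulr1.
by rewrite subrr oppr0.
Qed.

Lemma nreps_hyperbolic n (S : 'M[R]_n) :
  nreps s (Hsum G) (Hsum S) = (nreps s (Hsum G) (Jmx R) * nreps s G S)%N.
Proof.
rewrite /nreps.
apply: (@card_fibers 'M[R]_(1 + 1, _) 'M[R]_(n, _) _
  (fun xy => col_mx xy.1 xy.2) (fun X => (usubmx X, dsubmx X))).
- by move=> [x y] /=; rewrite col_mxKu col_mxKd.
- by move=> X; rewrite vsubmxK.
- by move=> x y /=; rewrite gram_sum // => /and3P[].
move=> a /eqP aJ /=.
have [P isoP aP] := hyp_pair aJ.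
transitivity #|[set y : 'M[R]_(n, 1 + 1 + m) |
   (y *m Hsum G *m (col_mx (tri 1%:M 0 0) (tri 0 1%:M 0))^* == 0) && (y *m Hsum G *m y^* == S)]|.
  rewrite -[RHS](card_isom _ isoP); apply: eq_card => y; rewrite !inE gram_sum // aJ eqxx /=.
  by rewrite -aP !(isom_form _ _ isoP).
apply: (@card_bij _ _ _ _ (fun y : 'M[R]_(n, 1 + 1 + m) => rsubmx y)
  (fun y => tri 0 0 y)) => y.
  rewrite [y]triP; move: (lsubmx (lsubmx y)) (rsubmx (lsubmx y)) (rsubmx y) => A B W.
  rewrite adj_col mul_mx_row !form_tri !adj0 !adj1 !mulmx0 !mulmx1 !addr0 subr0 sub0r.
  rewrite -[X in _ == X]row_mx0 => /andP[/eqP /eq_row_mx[/eqP]]; rewrite oppr_eq0 => /eqP -> ->.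
  by rewrite !mul0mx subr0 add0r /tri row_mxKr.
rewrite adj_col mul_mx_row !form_tri !adj0 !adj1 !mulmx0 !mulmx1 !addr0 subr0 sub0r.
by rewrite oppr0 add0r row_mx0 eqxx /tri row_mxKr.
Qed.

End Reduction.

Fixpoint hdim s m : nat := if s is s'.+1 then (1 + 1 + hdim s' m)%N else m.

Fixpoint Hs (R : comNzRingType) s m (G : 'M[R]_m) : 'M[R]_(hdim s m) :=
  match s return 'M[R]_(hdim s m) with
  | s'.+1 => Hsum (Hs s' G)
  | 0 => G
  end.

Lemma adj_Hs (R : comNzRingType) (s : {rmorphism R -> R}) k m (G : 'M[R]_m) :
  adj s G = - G -> adj s (Hs k G) = - Hs k G.
Proof. by move=> skG; elim: k => //= k IH; apply: adj_Hsum. Qed.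

Lemma hdimE s m : hdim s m = (s.*2 + m)%N.
Proof. by elim: s => //= s ->; rewrite doubleS. Qed.

(** * Equidistribution of norms of primitive vectors *)

(** [s_res] says that the involution is trivial on the residue field; it expresses
    the ramification. *)
Section Counts.
Variables (R : finComNzRingType) (s : {rmorphism R -> R}).
Local Notation "A ^*" := (adj s A) : ring_scope.
Hypothesis sK : involutive s.
Variable h2 : R.
Hypothesis h2P : h2 + h2 = 1.
Hypothesis locR : forall x y : R, unitb (x + y) -> unitb x || unitb y.
Hypothesis s_res : forall x, ~~ unitb (s x - x).

Definition cplus := #|[set x : R | s x == x]|.
Definition cminus := #|[set x : R | s x == - x]|.
Definition cnonunit := #|[set x : R | ~~ unitb x]|.

Lemma unitb0 : unitb (0 : R) = false.
Proof. by apply/unitbP => -[y /eqP]; rewrite mul0r eq_sym oner_eq0. Qed.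

Lemma half_sum (x : R) : h2 * x + h2 * x = x.
Proof. by rewrite -mulrDl h2P mul1r. Qed.

Lemma skew_half (c : R) : s c = - c -> s (h2 * c) = - (h2 * c).
Proof. by move=> sc; rewrite rmorphM (s_h2 s h2P) sc mulrN. Qed.

Lemma unitb_skew c : s c = - c -> ~~ unitb c.
Proof.
move=> sc; have := s_res (- (h2 * c)).
by rewrite rmorphN /= skew_half // !opprK half_sum.
Qed.

Lemma nonunitD (x y : R) : ~~ unitb x -> ~~ unitb y -> ~~ unitb (x + y).
Proof. by move=> ux uy; apply/negP => /locR; rewrite (negPf ux) (negPf uy). Qed.

(** The solutions form a translate of the real elements by half of [c]. *)
Lemma card_trace c : s c = - c -> #|[set y : R | y - s y == c]| = cplus.
Proof.
move=> sc; have shc := skew_half sc.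
apply: (@card_bij _ _ _ _ (fun y => y - h2 * c) (fun r => r + h2 * c)) => y /eqP h.
  rewrite subrK; split=> //; rewrite rmorphB /= shc opprK -h.
  by rewrite mulrBr -[X in s y + (X - _) == _](addrK (h2 * y)) half_sum -[X in X + _ == _](half_sum); apply/eqP; ring.
rewrite addrK; split=> //; rewrite rmorphD /= shc h -[X in _ == X]half_sum.
by apply/eqP; ring.
Qed.

Lemma card_trace_nonunit c : s c = - c ->
  #|[set y : R | ~~ unitb y && (y - s y == c)]| =
  #|[set y : R | ~~ unitb y && (s y == y)]|.
Proof.
move=> sc; have shc := skew_half sc; have Nu := unitb_skew shc.
have NuN : ~~ unitb (- (h2 * c)) by rewrite unitbN.
apply: (@card_bij _ _ _ _ (fun y => y - h2 * c) (fun r => r + h2 * c)) => y /andP[uy /eqP h].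
  rewrite subrK nonunitD //; split=> //=; rewrite rmorphB /= shc opprK -h.
  by rewrite mulrBr -[X in s y + (X - _) == _](addrK (h2 * y)) half_sum -[X in X + _ == _](half_sum); apply/eqP; ring.
rewrite addrK nonunitD //; split=> //=; rewrite rmorphD /= shc h -[X in _ == X]half_sum.
by apply/eqP; ring.
Qed.

Lemma skew_form00 m (G : 'M[R]_m) (w : 'rV[R]_m) : G^* = - G ->
  s ((w *m G *m w^*) 0 0) = - (w *m G *m w^*) 0 0.
Proof.
move=> skG; have := skew_form sK skG w; move: (w *m G *m w^*) => A.
by move=> /matrixP/(_ 0 0); rewrite !mxE.
Qed.

Lemma sum_const_set (A : finType) (P : pred A) k :
  (\sum_(x | P x) k = #|[set x | P x]| * k)%N.
Proof. by rewrite sum_nat_const; congr (_ * _)%N; apply: eq_card => x; rewrite inE. Qed.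

Lemma card_nat (A : finType) (P : pred A) : #|[set x | P x]| = (\sum_x P x)%N.
Proof. by rewrite -sum1dep_card big_mkcond. Qed.

Lemma card_split : #|R| = (cminus * cplus)%N.
Proof.
rewrite -sum1_card (partition_big (fun y => y - s y) (fun c => s c == - c)) /=; last first.
  by move=> y _; rewrite rmorphB /= sK opprB.
rewrite (eq_bigr (fun _ => cplus)) ?sum_const_set // => c /eqP sc.
by rewrite sum1dep_card card_trace.
Qed.

Definition cplus_nonunit := #|[set y : R | ~~ unitb y && (s y == y)]|.

Lemma cnonunit_split : cnonunit = (cminus * cplus_nonunit)%N.
Proof.
rewrite /cnonunit -sum1dep_card (partition_big (fun y => y - s y) (fun c => s c == - c)) /=; last first.
  by move=> y _; rewrite rmorphB /= sK opprB.
rewrite (eq_bigr (fun _ => cplus_nonunit)) ?sum_const_set // => c /eqP sc.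
by rewrite sum1dep_card card_trace_nonunit.
Qed.

Lemma card_lin_unit u c : unitb u -> s c = - c ->
  #|[set b | u * s b - b * s u == c]| = cplus.
Proof.
move=> /unitbP[v uv] sc; rewrite -(card_trace sc).
have suv : s u * s v = 1 by rewrite -rmorphM uv rmorph1.
apply: (@card_bij _ _ _ _ (fun b => u * s b) (fun y => s (v * y))) => y.
  by rewrite [v * _]mulrA [v * u]mulrC uv mul1r sK rmorphM sK [s u * y]mulrC => ->.
by rewrite -rmorphM [v * y * u]mulrC sK !mulrA uv mul1r.
Qed.

Lemma card_lin_nonunit u c : unitb u -> s c = - c ->
  #|[set a | ~~ unitb a && (a * s u - u * s a == c)]| = cplus_nonunit.
Proof.
move=> /unitbP[v uv] sc; rewrite /cplus_nonunit -(card_trace_nonunit sc).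
have suv : s u * s v = 1 by rewrite -rmorphM uv rmorph1.
apply: (@card_bij _ _ _ _ (fun a => a * s u) (fun y => y * s v)) => y /andP[uy].
  rewrite !rmorphM sK [u * _]mulrC -mulrA suv mulr1 => ->; split=> //; rewrite andbT.
  by apply: contra uy => /unitbMl.
rewrite -mulrA [s v * _]mulrC suv mulr1 rmorphM sK mulrCA uv mulr1 => ->.
by split=> //; rewrite andbT; apply: contra uy => /unitbMl.
Qed.

Definition nprim m (G : 'M[R]_m) := #|[set x : 'rV[R]_m | prim s G x]|.
Definition nprimc m (G : 'M[R]_m) c :=
  #|[set x : 'rV[R]_m | prim s G x && (x *m G *m x^* == c%:M)]|.
Definition nnonprim m (G : 'M[R]_m) := #|[set x : 'rV[R]_m | ~~ prim s G x]|.

Definition equidistributed m (G : 'M[R]_m) :=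
  forall c, s c = - c -> (nprimc G c * cminus = nprim G)%N.

Lemma sum_tri m (F : 'rV[R]_(1 + 1 + m) -> nat) :
  (\sum_x F x = \sum_w \sum_a \sum_b F (tri a%:M b%:M w))%N.
Proof.
rewrite (reindex (fun t : 'rV[R]_m * R * R => tri t.1.2%:M t.2%:M t.1.1)) /=.
  by rewrite -(pair_bigA _ (fun t b => F (tri t.2%:M b%:M t.1))) /=
       -(pair_bigA _ (fun w a => (\sum_b F (tri a%:M b%:M w))%N)).
exists (fun x => (rsubmx x, lsubmx (lsubmx x) 0 0, rsubmx (lsubmx x) 0 0)).
  move=> [[w a] b] _ /=; rewrite /tri row_mxKr row_mxKl row_mxKl row_mxKr.
  by rewrite !mxE !mulr1n.
by move=> x _ /=; rewrite -!mx11_scalar -triP.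
Qed.

Lemma eq_scalar11 (A : 'M[R]_1) c : (A == c%:M) = (A 0 0 == c).
Proof.
apply/eqP/eqP => [->|<-]; first by rewrite mxE mulr1n.
by rewrite -mx11_scalar.
Qed.

(** For fixed remaining coordinates, the equation a s(b) - b s(a) + (w, w) = c is
    linear in b when a is a unit, and linear in a when b is a unit; as the
    solution sets have a size that does not depend on c, each of these cases is
    equidistributed.  When a and b are nonunits, the vector is primitive exactly
    when w is. *)
Lemma equidistributed_Hsum m (G : 'M[R]_m) : G^* = - G ->
  equidistributed G -> equidistributed (Hsum G).
Proof.
move=> skG eG c sc.
pose q (w : 'rV[R]_m) := (w *m G *m w^*) 0 0.
have sq w : s (q w) = - q w.
  exact: skew_form00.
pose f a b w := a * s b - b * s a + q w == c.
pose u1 (a b : R) := unitb a : nat.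
pose u2 (a b : R) := ~~ unitb a && unitb b : nat.
pose u3 (a b : R) := ~~ unitb a && ~~ unitb b : nat.
have dec (a b : R) w (e : bool) : ((unitb a || unitb b || prim s G w) && e =
    u1 a b * e + u2 a b * e + u3 a b * (prim s G w && e) :> nat)%N.
  by rewrite /u1 /u2 /u3; case: (unitb a); case: (unitb b); case: (prim s G w); case: e.
have -> : nprimc (Hsum G) c = (\sum_w \sum_a \sum_b (u1 a b * f a b w + u2 a b * f a b w +
    u3 a b * (prim s G w && f a b w)))%N.
  rewrite /nprimc card_nat sum_tri; apply: eq_bigr => w _; apply: eq_bigr => a _.
  apply: eq_bigr => b _; rewrite -dec prim_tri // orbA form_tri11 eq_scalar11 mxE [X in X + _]mxE mulr1n.
  by rewrite -/(q w).
have -> : nprim (Hsum G) = (\sum_w \sum_a \sum_b (u1 a b + u2 a b +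
    u3 a b * (prim s G w)))%N.
  rewrite /nprim card_nat sum_tri; apply: eq_bigr => w _; apply: eq_bigr => a _.
  apply: eq_bigr => b _; have := dec a b w true; rewrite !muln1 !andbT => <-.
  by rewrite prim_tri // orbA.
have split3 (F1 F2 F3 : R -> R -> 'rV[R]_m -> nat) :
    (\sum_w \sum_a \sum_b (F1 a b w + F2 a b w + F3 a b w) =
     \sum_w \sum_a \sum_b F1 a b w + \sum_w \sum_b \sum_a F2 a b w +
     \sum_a \sum_b \sum_w F3 a b w)%N.
  rewrite (eq_bigr (fun w => \sum_a \sum_b F1 a b w + \sum_b \sum_a F2 a b w +
      \sum_a \sum_b F3 a b w)%N).
    rewrite !big_split /=; congr (_ + _)%N; rewrite exchange_big; apply: eq_bigr => a _.
    by rewrite exchange_big.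
  move=> w _; rewrite [X in (_ + X + _)%N]exchange_big -!big_split /=.
  by apply: eq_bigr => a _; rewrite -!big_split.
rewrite (split3 (fun a b w => u1 a b * f a b w)%N (fun a b w => u2 a b * f a b w)%N
  (fun a b w => u3 a b * (prim s G w && f a b w))%N).
rewrite (split3 (fun a b w => u1 a b) (fun a b w => u2 a b)
  (fun a b w => u3 a b * prim s G w)%N).
have sd x y : s (x * s y - y * s x) = - (x * s y - y * s x).
  by rewrite rmorphB !rmorphM /= !sK opprB ![s _ * _]mulrC.
rewrite !mulnDl; congr (_ + _ + _)%N.
- rewrite big_distrl; apply: eq_bigr => w _ /=; rewrite big_distrl; apply: eq_bigr => a _ /=.
  rewrite /u1 /f; case: (boolP (unitb a)) => ua; last by rewrite !big1 // => b _; rewrite mul0n.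
  rewrite sum_nat_const muln1 card_split mulnC; congr (_ * _)%N.
  rewrite -(card_lin_unit (c := c - q w) ua); last by rewrite rmorphB /= sc sq opprB opprK addrC.
  by rewrite card_nat; apply: eq_bigr => b _; rewrite mul1n [in RHS]eq_sym [in RHS]subr_eq [in RHS]eq_sym.
- rewrite big_distrl; apply: eq_bigr => w _ /=; rewrite big_distrl; apply: eq_bigr => b _ /=.
  rewrite /u2 /f; case: (boolP (unitb b)) => ub; last first.
    by rewrite !big1 // => a _; rewrite andbF // mul0n.
  rewrite (eq_bigr (fun a => ~~ unitb a && (a * s b - b * s a == c - q w) : nat)); last first.
    move=> a _; rewrite andbT.
    by rewrite [in RHS]eq_sym [in RHS]subr_eq [in RHS]eq_sym; case: (unitb a); rewrite ?andbF ?andbT ?mul0n ?mul1n.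
  rewrite -card_nat card_lin_nonunit //; last by rewrite rmorphB /= sc sq opprB opprK addrC.
  by rewrite mulnC -cnonunit_split /cnonunit card_nat; apply: eq_bigr => a _; rewrite andbT.
rewrite big_distrl; apply: eq_bigr => a _ /=; rewrite big_distrl; apply: eq_bigr => b _ /=.
rewrite -!big_distrr /= -mulnA; congr (_ * _)%N; rewrite -!card_nat.
rewrite -/(nprim G) -(eG (c - (a * s b - b * s a))); last first.
  by rewrite rmorphB /= sc sd -opprD.
congr (_ * _)%N; apply: eq_card => w; rewrite !inE eq_scalar11 /f; congr (_ && _).
by rewrite [RHS]eq_sym [RHS]subr_eq [RHS]eq_sym addrC.
Qed.

Lemma nnonprim_Hsum m (G : 'M[R]_m) : G^* = - G ->
  nnonprim (Hsum G) = (cnonunit ^ 2 * nnonprim G)%N.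
Proof.
move=> skG; rewrite /nnonprim card_nat sum_tri.
rewrite (eq_bigr (fun w => cnonunit ^ 2 * ~~ prim s G w)%N).
  by rewrite -big_distrr /= -card_nat.
move=> w _; rewrite /cnonunit card_nat -mulnn big_distrl big_distrl /=; apply: eq_bigr => a _.
rewrite big_distrr /= big_distrl; apply: eq_bigr => b _ /=.
by rewrite prim_tri // !negb_or -!mulnb mulnA.
Qed.

Lemma nprim_nonprim m (G : 'M[R]_m) : (nprim G + nnonprim G = #|R| ^ m)%N.
Proof.
rewrite /nprim /nnonprim -[in RHS](mul1n m) -card_mx -cardsT.
rewrite -(cardsID [set x | prim s G x] [set: 'rV[R]_m]) finset.setTI finset.setTD.
by congr (_ + _)%N; apply: eq_card => x; rewrite !inE.
Qed.

Lemma equidistributed_Hs k m (G : 'M[R]_m) : G^* = - G ->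
  equidistributed G -> equidistributed (Hs k G).
Proof.
move=> skG eG; elim: k => //= k IH; apply: equidistributed_Hsum => //.
exact: adj_Hs.
Qed.

Lemma nnonprim_Hs k m (G : 'M[R]_m) : G^* = - G ->
  nnonprim (Hs k G) = (cnonunit ^ k.*2 * nnonprim G)%N.
Proof.
move=> skG; elim: k => [|k IH] /=; first by rewrite mul1n.
by rewrite nnonprim_Hsum ?adj_Hs // IH mulnA -expnD doubleS.
Qed.

Lemma noprim_equidistributed m (G : 'M[R]_m) :
  (forall x, ~~ prim s G x) -> equidistributed G.
Proof.
move=> np c _; rewrite /nprimc /nprim.
rewrite !eq_card0 ?mul0n // => x; rewrite !inE; apply/negbTE; first exact: np.
by rewrite negb_and np.
Qed.

Lemma nnonprim_all m (G : 'M[R]_m) :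
  (forall x, ~~ prim s G x) -> nnonprim G = (#|R| ^ m)%N.
Proof.
move=> np; rewrite -(nprim_nonprim G) /nprim eq_card0 // => x; rewrite !inE.
exact/negbTE/np.
Qed.

(** Given the first vector, moved to e, the second one is a e + f + w with any w,
    and its norm vanishes for the a in a translate of the real elements. *)
Lemma nreps_J m (G : 'M[R]_m) : G^* = - G ->
  nreps s (Hsum G) (Jmx R) = (nprimc (Hsum G) 0 * (cplus * #|R| ^ m))%N.
Proof.
move=> skG; have skH := adj_Hsum skG.
rewrite /nreps /nprimc.
apply: (@card_fibers 'M[R]_(1, _) 'M[R]_(1, _) _
  (fun xy => col_mx xy.1 xy.2) (fun X => (usubmx X, dsubmx X))).
- by move=> [x y] /=; rewrite col_mxKu col_mxKd.
- by move=> X; rewrite vsubmxK.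
- move=> x z /=; rewrite adj_col mul_col_mx mul_col_row => /eqP /eq_block_mx[xx xz _ _].
  rewrite xx raddf0 eqxx andbT; apply/existsP; exists z; rewrite xz mxE.
  apply/unitbP; exists 1; exact: mulr1.
move=> x /andP[px /eqP xx] /=; rewrite raddf0 in xx.
have [P isoP xP] := trans_prim sK h2P locR skG px.
rewrite xx scaler0 in xP.
transitivity #|[set z : 'rV[R]_(1 + 1 + m) |
   (tri 1%:M 0 0 *m Hsum G *m z^* == 1%:M) && (z *m Hsum G *m z^* == 0)]|.
  rewrite -[RHS](card_isom _ isoP); apply: eq_card => z; rewrite !inE -xP.
  rewrite !(isom_form _ _ isoP) adj_col mul_col_mx mul_col_row xx.
  apply/eqP/andP => [/eq_block_mx[_ -> _ ->]//|[/eqP xz /eqP ->]].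
  rewrite xz; congr block_mx.
  have -> : z *m Hsum G *m x^* = - (x *m Hsum G *m z^*)^*.
    by rewrite !adjM (adjK sK) skH mulNmx mulmxN opprK mulmxA.
  by rewrite xz adj1.
transitivity #|[set ra : R * 'rV[R]_m | (s ra.1 == ra.1) && true]|; last first.
  rewrite -[(#|R| ^ m)%N](congr1 (expn _) (mul1n m)) -card_mx -cardsT -cardsX.
  by apply: eq_card => -[r w]; rewrite !inE.
pose q (w : 'rV[R]_m) := (w *m G *m w^*) 0 0.
have sq w : s (q w) = - q w.
  exact: skew_form00.
have shq w : s (h2 * q w) = - (h2 * q w) by apply: skew_half.
have key a b w :
    (tri 1%:M 0 0 *m Hsum G *m (tri a%:M b%:M w)^* == 1%:M) &&
    (tri a%:M b%:M w *m Hsum G *m (tri a%:M b%:M w)^* == 0) =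
    (b == 1) && (s (a + h2 * q w) == a + h2 * q w).
  rewrite -[in tri 1%:M 0](raddf0 (@scalar_mx R 1)) !form_tri11 !mul0mx addr0.
  rewrite mul0r subr0 mul1r eq_scalar11 mxE mulr1n.
  have -> : (s b == 1) = (b == 1) by rewrite -[X in s b == X](rmorph1 s) (inj_eq (inv_inj sK)).
  apply: andb_id2l => /eqP ->.
  rewrite -(raddf0 (@scalar_mx R 1)) eq_scalar11 mxE [X in X + _]mxE mulr1n rmorph1 mulr1 mul1r.
  rewrite -/(q w) rmorphD /= shq.
  have -> : a - s a + q w = (a + h2 * q w) - (s a - h2 * q w).
    by rewrite -[X in _ + X = _]half_sum; ring.
  by rewrite subr_eq0 eq_sym.
apply: (@card_bij _ _ _ _
  (fun z : 'rV[R]_(1 + 1 + m) => (lsubmx (lsubmx z) 0 0 + h2 * q (rsubmx z), rsubmx z))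
  (fun rw => tri (rw.1 - h2 * q rw.2)%:M 1%:M rw.2)) => [z|[r w]] /=.
  have [a [b [w ->]]] := row_triP z; rewrite key /tri row_mxKr row_mxKl row_mxKl.
  by rewrite mxE mulr1n addrK => /andP[/eqP -> ->].
rewrite key eqxx subrK andbT => ->; split=> //.
by rewrite /tri row_mxKr row_mxKl row_mxKl mxE mulr1n subrK.
Qed.

End Counts.

(** * Counts over a local ring with a skew uniformizer *)
Section Ramified.
Variables (R : finComNzRingType) (s : {rmorphism R -> R}).
Local Notation "A ^*" := (adj s A) : ring_scope.
Hypothesis sK : involutive s.
Variable h2 : R.
Hypothesis h2P : h2 + h2 = 1.
Hypothesis locR : forall x y : R, unitb (x + y) -> unitb x || unitb y.
Hypothesis s_res : forall x, ~~ unitb (s x - x).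

Lemma unitbM (x y : R) : unitb x -> unitb y -> unitb (x * y).
Proof.
move=> /unitbP[u xu] /unitbP[v yv]; apply/unitbP; exists (u * v).
by rewrite mulrACA xu yv mulr1.
Qed.

Lemma unitb1 : unitb (1 : R).
Proof. by apply/unitbP; exists 1; rewrite mulr1. Qed.

Lemma unitb2 : unitb (2 : R).
Proof. by apply/unitbP; exists h2; rewrite mulrDl mul1r. Qed.

Lemma unitb_cancel (u x y : R) : unitb u -> x * u = y * u -> x = y.
Proof. by move=> /unitbP[v uv] h; rewrite -[x]mulr1 -[y]mulr1 -uv !mulrA h. Qed.

Definition binv (x : R) := odflt 0 [pick y | x * y == 1].

Lemma mul_binv (x : R) : unitb x -> x * binv x = 1.
Proof.
move=> /unitbP[y xy]; rewrite /binv; case: pickP => [z /eqP //|/(_ y)].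
by rewrite xy eqxx.
Qed.

Lemma unit1D (x : R) : ~~ unitb x -> unitb (1 + x).
Proof.
move=> ux; have := unitb1; rewrite -[X in unitb X](addrK x) => /locR.
by rewrite unitbN (negPf ux) orbF.
Qed.

(** The Cayley transform a -> (a - 1)/(a + 1) identifies these elements with the
    skew ones, which are all nonunits. *)
Lemma card_norm1_near1 : #|[set a : R | (a * s a == 1) && ~~ unitb (a - 1)]| = cminus s.
Proof.
apply: (@card_bij _ _ _ _ (fun a => (a - 1) * binv (a + 1))
  (fun t => (1 + t) * binv (1 - t))) => [a /andP[/eqP Na ua]|t /eqP st].
  have u1 : unitb (a + 1).
    have := unitb2; have -> : 2 = (a + 1) + (- (a - 1)) by ring.
    by move=> /locR; rewrite unitbN (negPf ua) orbF.
  set t := _ * _.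
  have ta : t * (a + 1) = a - 1 by rewrite /t -mulrA [_ * (a + 1)]mulrC mul_binv ?mulr1.
  have st : s t = - t.
    apply: (unitb_cancel u1); rewrite mulNr ta opprB.
    have : a * s (t * (a + 1)) = a * s (a - 1) by rewrite ta.
    rewrite rmorphM rmorphD rmorphB /= rmorph1 mulrCA mulrDr mulrBr Na mulr1.
    by rewrite [1 + a]addrC => ->.
  split; first by apply/eqP.
  have ut : ~~ unitb t by exact: (unitb_skew h2P s_res st).
  have u1t : unitb (1 - t) by apply: unit1D; rewrite unitbN.
  apply: (unitb_cancel u1t); rewrite -mulrA [_ * (1 - t)]mulrC mul_binv // mulr1.
  apply: (unitb_cancel u1).
  have -> : a * (1 - t) * (a + 1) = a * (a + 1) - a * (t * (a + 1)) by ring.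
  rewrite ta [_ * (a + 1)]mulrDl mul1r ta.
  by ring.
have ut : ~~ unitb t by exact: (unitb_skew h2P s_res st).
have u1t : unitb (1 - t) by apply: unit1D; rewrite unitbN.
have u1t' : unitb (1 + t) by apply: unit1D.
set b := (1 + t) * binv (1 - t).
have bt : b * (1 - t) = 1 + t by rewrite /b -mulrA [_ * (1 - t)]mulrC mul_binv ?mulr1.
have sbt : s b * (1 + t) = 1 - t.
  have -> : 1 + t = s (1 - t) by rewrite rmorphB rmorph1 st opprK.
  by rewrite -rmorphM bt rmorphD rmorph1 st.
have ub : ~~ unitb (b - 1).
  apply/negP => h; have := unitbM h u1t; rewrite mulrDl bt mulN1r.
  have -> : 1 + t - (1 - t) = 2 * t by ring.
  by move=> /unitbMr; rewrite (negPf ut).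
rewrite ub andbT; split.
  apply/eqP/(unitb_cancel (unitbM u1t u1t')).
  by rewrite mulrACA bt sbt mul1r mulrC.
have u1 : unitb (b + 1).
  have := unitb2; have -> : 2 = (b + 1) + (- (b - 1)) by ring.
  by move=> /locR; rewrite unitbN (negPf ub) orbF.
apply: (unitb_cancel u1); rewrite -mulrA [_ * (b + 1)]mulrC mul_binv // mulr1.
apply: (unitb_cancel u1t); rewrite mulrDl bt mulN1r -mulrA mulrDl bt.
by ring.
Qed.

(** An element of norm 1 is congruent to exactly one of 1 and -1, because the
    involution is trivial on residues; both classes have the same size. *)
Lemma card_norm1 : #|[set a | a * s a == 1]| = (cminus s).*2.
Proof.
have e : #|[set a : R | (a * s a == 1) && ~~ unitb (a + 1)]| = cminus s.
  rewrite -card_norm1_near1; apply: (@card_bij _ _ _ _ -%R -%R) => a;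
    rewrite rmorphN mulrNN opprK => /andP[-> ]; split=> //=.
    by rewrite -opprD unitbN.
  by rewrite -unitbN opprD opprK.
rewrite -addnn -{1}card_norm1_near1 -e.
rewrite -(cardsID [set a | ~~ unitb (a - 1)] [set a | a * s a == 1]).
congr (_ + _)%N; apply: eq_card => a; rewrite !inE //.
rewrite [~~ ~~ unitb _]negbK [LHS]andbC; apply: andb_id2l => /eqP Na.
apply/idP/idP => [u1|u1].
  case: (boolP (unitb (a + 1))) => // u2; have := unitbM u1 u2.
  have -> : (a - 1) * (a + 1) = - (a * (s a - a)).
    by rewrite mulrBr Na; ring.
  by rewrite unitbN => /unitbMr; rewrite (negPf (s_res a)).
have := unitb2; have -> : 2 = (a + 1) + (- (a - 1)) by ring.
by move=> /locR; rewrite unitbN (negPf u1).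
Qed.

Variable pi : R.
Hypothesis s_pi : s pi = - pi.
Hypothesis pi_neq0 : pi != 0.
Hypothesis pi_gen : forall x, ~~ unitb x -> exists y, x = pi * y.
Hypothesis pi_ann : forall r, s r = r -> pi * r = 0 -> r = 0.

Lemma pi_nonunit : ~~ unitb pi. Proof. exact: (unitb_skew h2P s_res s_pi). Qed.

(** Cancelling [pi] in a s(a) pi = pi loses no information: a s(a) - 1 is real,
    and [pi] annihilates no nonzero real element at the even levels. *)
Lemma nreps_pi : nreps s (pi%:M : 'M[R]_1) (pi%:M : 'M[R]_1) = (cminus s).*2.
Proof.
rewrite /nreps -card_norm1.
apply: (@card_bij _ _ _ _ (fun x : 'M[R]_1 => x 0 0) (fun a => a%:M)) => [x|a /eqP Na].
  rewrite [x]mx11_scalar; move: (x 0 0) => a.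
  rewrite adj_scalar -!scalar_mxM mxE mulr1n => /eqP/matrixP/(_ 0 0).
  rewrite !mxE !mulr1n => h; split=> //; rewrite -subr_eq0; apply/eqP/pi_ann.
    by rewrite rmorphB rmorphM sK rmorph1 mulrC.
  by rewrite mulrBr mulr1 mulrCA mulrA h subrr.
by rewrite adj_scalar -!scalar_mxM mulrAC Na mul1r eqxx mxE mulr1n.
Qed.

Lemma noprim_pi x : ~~ prim s (pi%:M : 'M[R]_1) x.
Proof.
apply/existsP => -[z]; rewrite [x]mx11_scalar [z]mx11_scalar adj_scalar -!scalar_mxM.
by rewrite mxE mulr1n => /unitbMl/unitbMr; rewrite (negPf pi_nonunit).
Qed.

Lemma noprim0 x : ~~ prim s (0 : 'M[R]_0) x.
Proof.
by apply/existsP => -[z]; rewrite mulmx0 mul0mx mxE unitb0.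
Qed.

Lemma skew0 n : (0 : 'M[R]_n)^* = - 0. Proof. by rewrite adj0 oppr0. Qed.

Lemma nonprim_norm k (x : 'rV[R]_(hdim k 0)) : ~~ prim s (Hs k (0 : 'M[R]_0)) x ->
  exists y, x *m Hs k (0 : 'M[R]_0) *m x^* = (pi * pi * y)%:M.
Proof.
elim: k x => [|k IH] x /=.
  by move=> _; exists 0; rewrite mulmx0 mul0mx mulr0 raddf0.
have [a [b [w ->]]] := row_triP x.
rewrite prim_tri ?adj_Hs ?skew0 // !negb_or => /and3P[/pi_gen[a' ->] /pi_gen[b' ->] /IH[y e]].
rewrite form_tri11 e -raddfD /=.
exists (- (a' * s b') + b' * s a' + y); congr (_%:M).
by rewrite !rmorphM s_pi; ring.
Qed.

(** A vector that is not primitive in a sum of hyperbolic planes is divisible by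
    [pi], so its norm is divisible by the square of [pi]. *)
Lemma prim_norm_pi k (x : 'rV[R]_(hdim k 0)) :
  x *m Hs k (0 : 'M[R]_0) *m x^* = (- pi)%:M -> prim s (Hs k (0 : 'M[R]_0)) x.
Proof.
move=> e; case: (boolP (prim _ _ _)) => // /nonprim_norm[y].
rewrite e => /matrixP/(_ 0 0); rewrite !mxE !mulr1n => h.
have : pi * (1 + pi * y) = 0.
  by rewrite mulrDr mulr1 mulrA -h subrr.
have u1 : unitb (1 + pi * y).
  by apply: unit1D; apply/negP => /unitbMl; rewrite (negPf pi_nonunit).
rewrite -(mul0r (1 + pi * y)) => /(unitb_cancel u1) /eqP.
by rewrite (negPf pi_neq0).
Qed.

(** Equidistribution, together with the count of the vectors that are not
    primitive: the hyperbolic coordinates must all be nonunits. *)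
Lemma nprimc_card k m (G : 'M[R]_m) c : G^* = - G -> s c = - c ->
  (forall x, ~~ prim s G x) ->
  (nprimc s (Hs k G) c * cminus s + cnonunit R ^ k.*2 * #|R| ^ m = #|R| ^ hdim k m)%N.
Proof.
move=> skG sc np.
have -> := equidistributed_Hs sK h2P locR s_res k skG (noprim_equidistributed np) sc.
rewrite -(nnonprim_all np) -(nnonprim_Hs locR) //.
exact: nprim_nonprim.
Qed.

Lemma nreps_norm_pi k :
  (nreps s (Hs k (0 : 'M[R]_0)) ((- pi)%:M : 'M[R]_1) * cminus s + cnonunit R ^ k.*2
   = #|R| ^ hdim k 0)%N.
Proof.
have sc : s (- pi) = - - pi by rewrite rmorphN /= s_pi.
rewrite -(nprimc_card k (skew0 0) sc noprim0) muln1; congr (_ * _ + _)%N.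
apply: eq_card => x; rewrite !inE; apply/idP/andP => [/eqP e|[]//].
by rewrite prim_norm_pi // e.
Qed.

Lemma nreps_hyp_card k m (G : 'M[R]_m) : G^* = - G -> (forall x, ~~ prim s G x) ->
  (nreps s (Hs k.+1 G) (Jmx R) * cminus s +
     cnonunit R ^ k.+1.*2 * #|R| ^ m * (cplus s * #|R| ^ hdim k m)
   = #|R| ^ hdim k.+1 m * (cplus s * #|R| ^ hdim k m))%N.
Proof.
move=> skG np; have s0 : s 0 = - 0 by rewrite rmorph0 oppr0.
rewrite (nreps_J sK h2P locR) ?adj_Hs // -(nprimc_card k.+1 skG s0 np).
by rewrite mulnDl mulnAC.
Qed.

Lemma nreps_Hs k m (G : 'M[R]_m) : G^* = - G ->
  nreps s (Hs k G) (Hs k G) =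
  (\prod_(i < k) nreps s (Hs i.+1 G) (Jmx R) * nreps s G G)%N.
Proof.
move=> skG; elim: k => [|k IH] /=; first by rewrite big_ord0 mul1n.
by rewrite (nreps_hyperbolic sK h2P locR) ?adj_Hs // IH big_ord_recr /= mulnCA mulnA.
Qed.

Lemma nreps_I1 k n (S : 'M[R]_n) :
  nreps s (Hs k.+1 (0 : 'M[R]_0)) (block_mx ((- pi)%:M : 'M[R]_1) 0 0 S) =
  (nreps s (Hs k.+1 (0 : 'M[R]_0)) ((- pi)%:M : 'M[R]_1) *
   nreps s (block_mx (pi%:M : 'M[R]_1) 0 0 (Hs k (0 : 'M[R]_0))) S)%N.
Proof.
rewrite -[in X in (_ * X)%N](opprK pi).
apply: (nreps_vector sK h2P locR); first by rewrite adj_Hs // skew0.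
exact: (@prim_norm_pi k.+1).
Qed.

Lemma nreps00 : nreps s (0 : 'M[R]_0) (0 : 'M[R]_0) = 1%N.
Proof.
rewrite /nreps; transitivity #|{: 'M[R]_(0, 0)}|; last by rewrite card_mx.
apply: eq_card => x; rewrite !inE.
by apply/eqP/matrixP => -[].
Qed.

End Ramified.

(** * Gauss sums of alternating bicharacters *)

(** The irreducible characters of the additive group; the last clause is the
    regular character. *)
Lemma additive_characters (U : finZmodType) :
  exists (I : finType) (chi : I -> U -> algC),
  [/\ forall i x y, chi i (x + y) = chi i x * chi i y,
      forall i, chi i 0 = 1 &
      forall x, \sum_i chi i x = (#|U| * (x == 0))%:R].
Proof.
pose G := [set: U]%G.
have abG : abelian G by exact: FinRing.Theory.zmod_abelian.
have lin i : 'chi[G]_i \is a linear_char by apply/char_abelianP.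
exists (Iirr G), (fun i x => 'chi_i x); split=> [i x y|i|x].
- by rewrite -(lin_charM (lin i)) ?inE.
- exact: (lin_char1 (lin i)).
have e := congr1 (fun phi : 'CF(G) => phi x) (@cfReg_sum _ G).
rewrite /= cfRegE sum_cfunE cardsT in e.
rewrite natrM mulr_natr -[x == 0]/(x == 1%g) e.
by apply: eq_bigr => i _; rewrite cfunE (lin_char1 (lin i)) mul1r.
Qed.

Lemma sum_subgroup_char (U : finZmodType) (J : {set U}) (chi : U -> algC) :
  {in J &, forall x y, x + y \in J} -> {in J, forall x, - x \in J} ->
  {in J &, forall x y, chi (x + y) = chi x * chi y} ->
  \sum_(x in J) chi x = (#|J| * [forall x in J, chi x == 1])%:R.
Proof.
move=> JD JN chiD; case: (boolP [forall x in J, chi x == 1]) => [/forall_inP c1|].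
  rewrite muln1 (eq_bigr (fun _ => 1)) => [|x /c1 /eqP //].
  by rewrite sumr_const.
rewrite negb_forall_in => /exists_inP[x0 Jx0 nx0]; rewrite muln0 mulr0n.
have e : \sum_(x in J) chi x = (\sum_(x in J) chi x) * chi x0.
  rewrite mulr_suml (reindex_inj (addIr x0)) /=.
  rewrite (eq_bigl (fun x => x \in J)) => [|x].
    by apply: eq_bigr => x Jx; rewrite chiD.
  apply/idP/idP => h; last exact: JD.
  by rewrite -(addrK x0 x) JD // JN.
apply/eqP; have : (\sum_(x in J) chi x) * (chi x0 - 1) == 0.
  by rewrite mulrBr mulr1 -e subrr.
by rewrite mulf_eq0 subr_eq0 (negPf nx0) orbF.
Qed.

(** Here [w] is a real uniformizer (the square of pi) and [T] a set of real
    representatives of the residue field. *)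
Section GaussSum.
Variables (R : finComNzRingType) (s : {rmorphism R -> R}).
Local Notation "A ^*" := (adj s A) : ring_scope.
Hypothesis sK : involutive s.
Variables (w : R) (T : {set R}) (N q : nat).
Hypothesis sw : s w = w.
Hypothesis w_nilp : w ^+ N = 0.
Hypothesis T_real : forall t, t \in T -> s t = t.
Hypothesis T_rep : forall c, s c = c ->
  exists2 t, t \in T & exists2 c', s c' = c' & c = t + w * c'.
Hypothesis T_unit : forall t t', t \in T -> t' \in T -> t != t' -> unitb (t - t').
Hypothesis cardT : #|T| = q.

Variables (n : nat) (chi : 'M[R]_n -> algC).
Hypothesis chiD : forall x y, chi (x + y) = chi x * chi y.
Hypothesis chi0 : chi 0 = 1.

Let U := 'cV[R]_n.
(** The contribution of one hyperbolic plane to the Gram matrix.  Composed with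
    an additive character it is an alternating bicharacter of [U] for which the
    real scalars are self-adjoint. *)
Definition alt (A B : U) : 'M[R]_n := A *m B^* - B *m A^*.

Lemma altDl A A' B : alt (A + A') B = alt A B + alt A' B.
Proof. by rewrite /alt adjD mulmxDl mulmxDr opprD addrACA. Qed.
Lemma altC A B : alt A B = - alt B A.
Proof. by rewrite /alt opprB. Qed.
Lemma altDr A B B' : alt A (B + B') = alt A B + alt A B'.
Proof. by rewrite altC altDl opprD -!altC. Qed.
Lemma altZl c A B : s c = c -> alt (c *: A) B = c *: alt A B.
Proof. by move=> sc; rewrite /alt adjZ sc -scalemxAl -scalemxAr scalerBr. Qed.
Lemma altZr c A B : s c = c -> alt A (c *: B) = c *: alt A B.
Proof. by move=> sc; rewrite altC altZl // -scalerN -altC. Qed.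
Lemma altxx A : alt A A = 0. Proof. exact: subrr. Qed.

Lemma chiN x : chi (- x) = (chi x)^-1.
Proof.
have e : chi (- x) * chi x = 1 by rewrite -chiD addNr.
have nz : chi x != 0 by apply/eqP => h; move/eqP: e; rewrite h mulr0 eq_sym oner_eq0.
by rewrite -[LHS](mulfK nz) e mul1r.
Qed.

Lemma chiDl A A' B : chi (alt (A + A') B) = chi (alt A B) * chi (alt A' B).
Proof. by rewrite altDl chiD. Qed.
Lemma chiDr A B B' : chi (alt A (B + B')) = chi (alt A B) * chi (alt A B').
Proof. by rewrite altDr chiD. Qed.

Lemma chi_altC A B : (chi (alt A B) == 1) = (chi (alt B A) == 1).
Proof. by rewrite altC chiN invr_eq1. Qed.

Definition chirad : {set U} := [set A | [forall B, chi (alt A B) == 1]].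

Lemma alt_sum : \sum_A \sum_B chi (alt A B) = (#|U| * #|chirad|)%:R.
Proof.
rewrite (eq_bigr (fun A => (#|U| * (A \in chirad))%:R)).
  rewrite -natr_sum -big_distrr /=; congr (_ * _)%:R.
  by rewrite -sum1_card [RHS]big_mkcond /=; apply: eq_bigr => A _; case: (_ \in _).
move=> A _; have := @sum_subgroup_char U finset.setT (fun B => chi (alt A B)).
rewrite cardsT => h.
rewrite (eq_bigl (fun B => B \in [set: U]%SET)) => [|B]; last by rewrite !inE.
rewrite h; [|by move=> *; rewrite inE|by move=> *; rewrite inE|by move=> *; rewrite chiDr].
congr (_ * _)%:R; rewrite inE; congr (nat_of_bool _).
by apply/forall_inP/forallP => k B; [apply: k; rewrite inE|move=> _; apply: k].
Qed.

(** Submodules over the ring of real elements. *)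
Record stable (J : {set U}) : Prop := Stable {
  stable0 : 0 \in J;
  stableD : forall x y, x \in J -> y \in J -> x + y \in J;
  stableZ : forall c x, s c = c -> x \in J -> c *: x \in J }.

Definition isotropic (J : {set U}) :=
  forall x y, x \in J -> y \in J -> chi (alt x y) = 1.

Definition perp (J : {set U}) : {set U} := [set x | [forall y in J, chi (alt x y) == 1]].

Lemma perpP (J : {set U}) x :
  reflect (forall y, y \in J -> chi (alt x y) = 1) (x \in perp J).
Proof.
by rewrite inE; apply: (iffP forall_inP) => h y Jy; apply/eqP/h.
Qed.

Lemma stableN J x : stable J -> x \in J -> - x \in J.
Proof. by move=> sJ Jx; rewrite -scaleN1r; apply: stableZ; rewrite ?rmorphN ?rmorph1. Qed.

Lemma stable_perp J : stable J -> stable (perp J).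
Proof.
move=> sJ; split.
- by apply/perpP => y _; rewrite -[0](scale0r 0) altZl ?rmorph0 // scale0r.
- by move=> x y /perpP hx /perpP hy; apply/perpP => z Jz; rewrite chiDl hx // hy // mulr1.
move=> c x sc /perpP hx; apply/perpP => y Jy.
by rewrite altZl // -altZr // hx //; apply: stableZ.
Qed.

(** Adjoining x multiplies the size by q, as J + R x is the disjoint union of the
    translates of J by the multiples t x with t in T. *)
Lemma extend_isotropic J x : stable J -> isotropic J -> x \in perp J -> x \notin J ->
  w *: x \in J ->
  exists J', [/\ stable J', isotropic J' & #|J'| = (#|J| * q)%N].
Proof.
move=> sJ iJ px nx wx.
pose J' := [set yc.1 + yc.2 *: x | yc in finset.setX J [set c | s c == c]].
have J'P z : reflect (exists y c, [/\ y \in J, s c = c & z = y + c *: x]) (z \in J').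
  apply: (iffP finset.imsetP) => [[[y c]]|[y [c [Jy sc ->]]]].
    by rewrite !inE => /andP[Jy /eqP sc] ->; exists y, c.
  by exists (y, c) => //; rewrite !inE sc eqxx Jy.
exists J'; split.
- split.
  + apply/J'P; exists 0, 0; split; [exact: stable0|exact: rmorph0|].
    by rewrite scale0r addr0.
  + move=> _ _ /J'P[y [c [Jy sc ->]]] /J'P[y' [c' [Jy' sc' ->]]].
    apply/J'P; exists (y + y'), (c + c'); split; first exact: stableD.
      by rewrite rmorphD /= sc sc'.
    by rewrite scalerDl addrACA.
  move=> a _ sa /J'P[y [c [Jy sc ->]]]; apply/J'P; exists (a *: y), (a * c); split.
  + exact: stableZ.
  + by rewrite rmorphM sa sc.
  by rewrite scalerDr scalerA.
- move=> _ _ /J'P[y [c [Jy sc ->]]] /J'P[y' [c' [Jy' sc' ->]]].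
  rewrite chiDl !chiDr iJ // (altZl _ _ sc) (altZr _ _ sc') -(altZl _ _ sc').
  rewrite -(altZr _ _ sc) (altZl _ _ sc) (altZr _ _ sc') altxx !scaler0 chi0.
  rewrite (eqP (_ : chi (alt (c' *: y) x) == 1)).
    by rewrite (perpP _ _ px) ?mulr1 //; apply: stableZ.
  by rewrite chi_altC (perpP _ _ px) //; apply: stableZ.
rewrite -cardT -finset.cardsX.
have -> : J' = [set yc.1 + yc.2 *: x | yc in finset.setX J T].
  apply/finset.setP => z; apply/J'P/finset.imsetP => [[y [c [Jy sc ->]]]|[[y t]]].
    have [t Tt [c' sc' ->]] := T_rep sc.
    exists (y + c' *: (w *: x), t); last by rewrite /= scalerDl scalerA [w * _]mulrC addrAC addrA.
    by rewrite inE Tt andbT; apply: stableD => //; apply: stableZ.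
  by rewrite inE => /andP[Jy Tt] ->; exists y, t; split=> //; apply: T_real.
apply: card_in_imset => -[y t] [y' t']; rewrite !inE /= => /andP[Jy Tt] /andP[Jy' Tt'] e.
have dx : (t - t') *: x \in J.
  have -> : (t - t') *: x = y' - y.
    by rewrite scalerBl; apply: (addrI y); rewrite addrA e addrK addrC subrK.
  by apply: stableD => //; apply: stableN.
case: (eqVneq t t') => [tt|ne].
  by move: e; rewrite tt => /addIr ->.
have /unitbP[u uP] := T_unit Tt Tt' ne.
have su : s u = u.
  have e1 : (t - t') * s u = 1.
    by rewrite -[RHS](rmorph1 s) -uP rmorphM rmorphB /= (T_real Tt) (T_real Tt').
  by rewrite -[LHS]mul1r -uP mulrAC e1 mul1r.
case/negP: nx; have := stableZ sJ su dx.
by rewrite scalerA mulrC uP scale1r.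
Qed.

(** If the orthogonal of J contains x outside J, then the last multiple w^i x
    outside J can be adjoined to J. *)
Lemma lagrangian j J : stable J -> isotropic J -> #|J| = (q ^ j)%N -> (1 < q)%N ->
  exists j' J', [/\ stable J', perp J' = J' & #|J'| = (q ^ j')%N].
Proof.
move=> + + + q1.
have [m] := ubnP (#|U| - #|J|); elim: m => // m IH in j J *; rewrite ltnS => le_m sJ iJ cJ.
case: (boolP (perp J \subset J)) => [sub|].
  exists j, J; split=> //; apply/eqP; rewrite finset.eqEsubset sub /=.
  by apply/fintype.subsetP => x Jx; apply/perpP => y Jy; apply: iJ.
move=> /fintype.subsetPn[x px nx].
have ex : exists i, w ^+ i *: x \in J by exists N; rewrite w_nilp scale0r; apply: stable0.
case: (ex_minnP ex) => -[|i] wi imin; first by rewrite expr0 scale1r (negPf nx) in wi.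
have swi : s (w ^+ i) = w ^+ i by rewrite rmorphXn /= sw.
have px' : w ^+ i *: x \in perp J by apply: stableZ => //; apply: stable_perp.
have nx' : w ^+ i *: x \notin J by apply/negP => /imin; rewrite ltnn.
have wx' : w *: (w ^+ i *: x) \in J by rewrite scalerA -exprS.
have [J' [sJ' iJ' cJ']] := extend_isotropic sJ iJ px' nx' wx'.
apply: (IH j.+1 J') => //; last by rewrite cJ' cJ expnSr.
have lt : (#|J| < #|J'|)%N by rewrite cJ' ltn_Pmulr // cJ expn_gt0 ltnW.
apply: leq_trans le_m; apply: ltn_sub2l => //.
by apply: leq_trans lt _; apply: max_card.
Qed.

(** With J its own orthogonal, the sum over A in J and over all B can be taken in
    both orders: it is |U| times the size of the radical, which is the full sum,
    and it is also the square of |J|. *)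
Lemma gauss_sum : (1 < q)%N ->
  exists j, \sum_A \sum_B chi (alt A B) = (q ^ j)%:R ^+ 2 /\ (q ^ j <= #|U|)%N.
Proof.
move=> q1.
have s0 : stable [set 0].
  split; first by rewrite inE.
    by move=> x y; rewrite !inE => /eqP-> /eqP->; rewrite addr0.
  by move=> c x _; rewrite !inE => /eqP->; rewrite scaler0.
have i0 : isotropic [set 0].
  by move=> x y; rewrite !inE => /eqP -> _; rewrite /alt mul0mx adj0 mulmx0 subrr.
have [j [J [sJ pJ cJ]]] := lagrangian (j := 0) s0 i0 (cards1 _) q1.
exists j; split; last by rewrite -cJ max_card.
rewrite alt_sum -cJ -natrX; congr (_%:R).
have radJ : chirad \subset J.
  apply/fintype.subsetP => A; rewrite inE => /forallP h; rewrite -pJ; apply/perpP => y _; exact/eqP.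
have : \sum_(A in J) \sum_B chi (alt A B) = \sum_B \sum_(A in J) chi (alt A B).
  exact: exchange_big.
rewrite (eq_bigr (fun A => (#|U| * (A \in chirad))%:R)); last first.
  move=> A JA; have := @sum_subgroup_char U finset.setT (fun B => chi (alt A B)).
  rewrite cardsT => h.
  rewrite (eq_bigl (fun B => B \in [set: U]%SET)) => [|B]; last by rewrite !inE.
  rewrite h; [|by move=> *; rewrite inE|by move=> *; rewrite inE|by move=> *; rewrite chiDr].
  congr (_ * _)%:R; rewrite inE; congr (nat_of_bool _).
  by apply/forall_inP/forallP => k B; [apply: k; rewrite inE|move=> _; apply: k].
rewrite [in RHS](eq_bigr (fun B => (#|J| * (B \in J))%:R)); last first.
  move=> B _; rewrite (@sum_subgroup_char U J (fun A => chi (alt A B))).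
  - congr (_ * _)%:R; rewrite -[in RHS]pJ inE; congr (nat_of_bool _).
    by apply: eq_forallb => A; rewrite chi_altC.
  - by move=> x y Jx Jy; apply: stableD.
  - by move=> x Jx; apply: stableN.
  - by move=> x y _ _; rewrite altDl chiD.
rewrite -!natr_sum -!big_distrr /= => /eqP; rewrite eqr_nat => /eqP.
rewrite (_ : \sum_(A in J) (A \in chirad) = #|chirad|)%N; last first.
  rewrite -sum1_card big_mkcond [RHS]big_mkcond /=; apply: eq_bigr => A _.
  by case: (boolP (A \in chirad)) => [/(fintype.subsetP radJ) ->|]; rewrite ?if_same.
rewrite (_ : \sum_B (B \in J) = #|J|)%N; last first.
  by rewrite -sum1_card [RHS]big_mkcond /=; apply: eq_bigr => A _; case: (_ \in _).
by move=> ->; rewrite mulnn.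
Qed.

End GaussSum.

(** * The number of representations is polynomial in the number of hyperbolic planes *)
Lemma interpolation (F : fieldType) (x y : nat -> F) : injective x ->
  forall D, exists2 p : {poly F}, (size p <= D)%N &
    forall i, (i < D)%N -> p.[x i] = y i.
Proof.
move=> xI; elim=> [|D [p sp hp]]; first by exists 0 => //; rewrite size_poly0.
pose m := \prod_(i < D) ('X - (x i)%:P).
have mD : m.[x D] != 0.
  rewrite horner_prod; apply/prodf_neq0 => i _; rewrite hornerXsubC subr_eq0.
  by rewrite (inj_eq xI) eq_sym neq_ltn ltn_ord.
have mi i : (i < D)%N -> m.[x i] = 0.
  move=> lt; rewrite horner_prod (bigD1 (Ordinal lt)) //= hornerXsubC subrr.
  by rewrite mul0r.
have sm : size m = D.+1.
  rewrite /m -(big_mkord xpredT (fun i => 'X - (x i)%:P)) size_prod_XsubC.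
  by rewrite /index_iota subn0 size_iota.
exists (p + ((y D - p.[x D]) / m.[x D]) *: m).
  apply: leq_trans (size_polyD _ _) _; rewrite geq_max (leqW sp) /=.
  by apply: leq_trans (size_scale_leq _ _) _; rewrite sm.
move=> i; rewrite ltnS leq_eqVlt hornerD hornerZ => /orP[/eqP->|lt].
  by rewrite divfK // addrCA subrr addr0.
by rewrite (mi i lt) mulr0 addr0 hp.
Qed.

(** Interpolation gives a rational polynomial of bounded degree with the same
    values, and it is equal to P. *)
Lemma rational_poly (P : {poly algC}) (x y : nat -> rat) : injective x ->
  (forall k, P.[ratr (x k)] = ratr (y k)) ->
  exists p : {poly rat}, forall k, p.[x k] = y k.
Proof.
move=> xI Pxy; have [p sp hp] := interpolation y xI (size P).
have e : map_poly ratr p = P.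
  apply/eqP; rewrite -subr_eq0; apply/eqP.
  apply: (@roots_geq_poly_eq0 _ _ [seq ratr (x i) | i <- iota 0 (size P)]).
  - apply/allP => z /mapP[i]; rewrite mem_iota add0n => /= lt ->.
    by rewrite rootE hornerD hornerN horner_map Pxy hp // subrr.
  - rewrite map_inj_uniq ?iota_uniq // => i j /fmorph_inj; exact: xI.
  rewrite size_map size_iota; apply: leq_trans (size_polyD _ _) _.
  by rewrite size_polyN size_map_poly geq_max sp leqnn.
exists p => k; apply: (fmorph_inj (ratr : {rmorphism rat -> algC})).
by rewrite /= -Pxy -e horner_map.
Qed.

Section Polynomiality.
Variables (R : finComNzRingType) (s : {rmorphism R -> R}).
Local Notation "A ^*" := (adj s A) : ring_scope.
Hypothesis sK : involutive s.
Variables (w : R) (T : {set R}) (N q a : nat).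
Hypothesis sw : s w = w.
Hypothesis w_nilp : w ^+ N = 0.
Hypothesis T_real : forall t, t \in T -> s t = t.
Hypothesis T_rep : forall c, s c = c ->
  exists2 t, t \in T & exists2 c', s c' = c' & c = t + w * c'.
Hypothesis T_unit : forall t t', t \in T -> t' \in T -> t != t' -> unitb (t - t').
Hypothesis cardT : #|T| = q.
Hypothesis q1 : (1 < q)%N.
Hypothesis cardR : #|R| = (q ^ a)%N.

Variables (m n : nat) (G : 'M[R]_m) (S : 'M[R]_n).

Lemma char_sum_Hs (chi : 'M[R]_n -> algC) k :
  (forall x y, chi (x + y) = chi x * chi y) ->
  \sum_(X : 'M[R]_(n, hdim k m)) chi (X *m Hs k G *m X^*) =
  (\sum_(X : 'M[R]_(n, m)) chi (X *m G *m X^*)) * (\sum_A \sum_B chi (alt s A B)) ^+ k.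
Proof.
move=> chiD; elim: k => [|k IH]; first by rewrite mulr1.
rewrite exprSr mulrA -IH mulr_suml.
rewrite (reindex (fun t : 'M[R]_(n, hdim k m) * 'cV[R]_n * 'cV[R]_n => tri t.1.2 t.2 t.1.1)) /=.
  rewrite -(pair_bigA _ (fun t B => chi (tri t.2 B t.1 *m Hs k.+1 G *m (tri t.2 B t.1)^*))) /=.
  rewrite -(pair_bigA _ (fun W A => (\sum_B chi (tri A B W *m Hs k.+1 G *m (tri A B W)^*)))) /=.
  apply: eq_bigr => W _; rewrite mulr_sumr; apply: eq_bigr => A _.
  rewrite mulr_sumr; apply: eq_bigr => B _.
  by rewrite form_tri chiD mulrC.
exists (fun x => (rsubmx x, lsubmx (lsubmx x), rsubmx (lsubmx x))).
  by move=> [[W A] B] _ /=; rewrite /tri row_mxKr row_mxKl row_mxKl row_mxKr.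
by move=> x _ /=; rewrite -triP.
Qed.

(** In the Fourier expansion each character contributes a constant times the k-th
    power of its Gauss sum q^{2j}, and q^{2jk} = (q^{an})^{2k} (q^{-2k})^{an - j}. *)
Lemma nreps_poly : exists P : {poly rat}, forall k,
  (nreps s (Hs k G) S)%:R = (q ^ (a * n))%:R ^+ k.*2 * P.[q%:R ^- k.*2] :> rat.
Proof.
have [I [chi [chiD chi0 chi_sum]]] := additive_characters 'M[R]_n.
have gs i : {j : nat | (\sum_A \sum_B chi i (alt s A B) == (q ^ j)%:R ^+ 2) && (j <= a * n)%N}.
  apply: sigW; have [j [e le]] := gauss_sum sw w_nilp T_real T_rep T_unit cardT (chiD i) (chi0 i) q1.
  exists j; rewrite e eqxx /=; move: le; rewrite card_mx cardR muln1 -expnM leq_exp2l //.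
pose c i := chi i (- S) * (\sum_(X : 'M[R]_(n, m)) chi i (X *m G *m X^*)) / #|{: 'M[R]_n}|%:R.
pose P : {poly algC} := \sum_i c i *: 'X^(a * n - sval (gs i)).
have Mn0 : #|{: 'M[R]_n}|%:R != 0 :> algC.
  by rewrite pnatr_eq0 -lt0n; apply/card_gt0P; exists 0.
have q0 : q%:R != 0 :> algC by rewrite pnatr_eq0 -lt0n ltnW.
have q0' : q%:R != 0 :> rat by rewrite pnatr_eq0 -lt0n ltnW.
(* Orthogonality of characters: the indicator function of X G X^* = S. *)
have key k : (nreps s (Hs k G) S)%:R = (q ^ (a * n))%:R ^+ k.*2 * P.[q%:R ^- k.*2] :> algC.
  have -> : (nreps s (Hs k G) S)%:R = \sum_i c i * (\sum_A \sum_B chi i (alt s A B)) ^+ k.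
    apply: (mulIf Mn0); rewrite mulr_suml.
    rewrite (eq_bigr (fun i => \sum_(X : 'M[R]_(n, hdim k m)) chi i (X *m Hs k G *m X^* - S))); last first.
      move=> i _; rewrite mulrAC /c divfK //.
      by rewrite -mulrA -char_sum_Hs // mulr_sumr; apply: eq_bigr => X _; rewrite chiD mulrC.
    rewrite exchange_big /= -natrM /nreps card_nat big_distrl natr_sum /=.
    apply: eq_bigr => X _; rewrite chi_sum subr_eq0 mulnC; congr (_ * _)%:R.
  rewrite horner_sum mulr_sumr; apply: eq_bigr => i _.
  rewrite hornerZ hornerXn mulrCA; congr (_ * _).
  case: (gs i) => j /= /andP[/eqP -> le]; rewrite !natrX -!exprM -exprVn -!exprM.
  move: (a * n - j)%N (subnK le) => e <-.
  rewrite mulnDl exprD [(k.*2 * e)%N]mulnC mulrAC exprVn mulfV ?mul1r ?mul2n //.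
  by rewrite expf_neq0.
pose x k : rat := q%:R ^- k.*2.
have xI : injective x.
  move=> k l /invr_inj /eqP; rewrite -!natrX eqr_nat eqn_exp2l // => /eqP.
  exact: double_inj.
have [|p hp] := @rational_poly P x (fun k => (nreps s (Hs k G) S)%:R / (q ^ (a * n))%:R ^+ k.*2) xI.
  move=> k; rewrite /x fmorphV fmorph_div /= !rmorphXn /= !ratr_nat key.
  by rewrite natrX [RHS]mulrC mulKf // !expf_neq0.
exists p => k; rewrite hp mulrC divfK //.
by rewrite natrX !expf_neq0.
Qed.

End Polynomiality.

(** * Counting tools for the passage from one level to the next *)
Lemma card_hom (U V : finZmodType) (f : {additive U -> V}) (P : pred U) (Q : pred V) :
  zmod_closed P -> (forall x, P x -> Q (f x)) ->
  (forall y, Q y -> exists2 x, P x & f x = y) ->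
  #|[set x | P x]| = (#|[set y | Q y]| * #|[set x | P x && (f x == 0%R)]|)%N.
Proof.
move=> [P0 PB] PQ QP; rewrite -sum1dep_card (partition_big f Q) //=.
have PD x y : P x -> P y -> P (x + y).
  move=> px py; rewrite -[y]opprK; apply: (PB) => //.
  by rewrite -sub0r; apply: (PB).
rewrite (eq_bigr (fun _ => #|[set x | P x && (f x == 0%R)]|)) ?sum_const_set // => y /QP[x0 px0 fx0].
rewrite sum1dep_card; apply: (@card_bij _ _ _ _ (fun x => x - x0) (fun x => x + x0)) => x /andP[px /eqP fx].
  by rewrite subrK raddfB fx fx0 subrr eqxx andbT; split=> //; apply: (PB).
by rewrite addrK raddfD fx fx0 add0r eqxx andbT; split=> //; apply: PD.
Qed.

Section Skew.
Variables (R : finComNzRingType) (s : {rmorphism R -> R}).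
Local Notation "A ^*" := (adj s A) : ring_scope.
Hypothesis sK : involutive s.

(** A skew-hermitian matrix is determined by its entries above the diagonal,
    which are free, and by its diagonal, which is skew. *)
Lemma card_skew n (P : pred R) a :
  (forall x, P x -> P (- s x)) ->
  #|[set x | P x]| = (a ^ 2)%N -> #|[set x | P x && (s x == - x)]| = a ->
  #|[set D : 'M[R]_n | [forall i, forall j, P (D i j)] && (D^* == - D)]| = (a ^ (n * n))%N.
Proof.
move=> Ps cP cPm.
pose A (ij : 'I_n * 'I_n) : pred R := fun x =>
  if (ij.1 < ij.2)%N then P x else if ij.1 == ij.2 then P x && (s x == - x) else x == 0.
have cA ij : #|A ij| = if (ij.1 < ij.2)%N then (a ^ 2)%N else if ij.1 == ij.2 then a else 1%N.
  rewrite /A; case: ifP => _; first by rewrite -cP; apply: eq_card => x; rewrite inE.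
  case: ifP => _; first by rewrite -cPm; apply: eq_card => x; rewrite inE.
  by rewrite -(card1 (0 : R)); apply: eq_card.
transitivity #|[set f : {ffun 'I_n * 'I_n -> R} | f \in family A]|.
  apply: (@card_bij _ _ _ _
    (fun D : 'M[R]_n => [ffun ij : 'I_n * 'I_n => if (ij.1 <= ij.2)%N then D ij.1 ij.2 else 0])
    (fun f : {ffun 'I_n * 'I_n -> R} => \matrix_(i, j) if (i <= j)%N then f (i, j) else - s (f (j, i)))).
    move=> D /andP[/forallP PD /eqP skD].
    have sD i j : s (D j i) = - D i j.
      by move/matrixP/(_ i j): skD; rewrite !mxE.
    split.
      apply/familyP => -[i j]; rewrite ffunE unfold_in /A /=.
      case: (ltngtP i j) => ij; first exact: (forallP (PD i) j).
        by case: eqP ij => [->|_]; rewrite ?ltnn.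
      by rewrite (val_inj ij) eqxx sD eqxx andbT; exact: (forallP (PD j) j).
    apply/matrixP => i j; rewrite mxE !ffunE /=; case: (leqP i j) => // ij.
    by rewrite (ltnW ij) sD opprK.
  move=> f /familyP fA; split.
    apply/andP; split.
      apply/forallP => i; apply/forallP => j; rewrite mxE.
      case: (leqP i j) => [|ij]; last first.
        have := fA (j, i); rewrite unfold_in /A /= ij; exact: Ps.
      rewrite leq_eqVlt => /orP[/eqP/val_inj->|ij]; last by have := fA (i, j); rewrite unfold_in /A /= ij.
      by have := fA (j, j); rewrite unfold_in /A /= ltnn eqxx => /andP[].
    apply/eqP/matrixP => i j; rewrite !mxE; case: (ltngtP i j) => ij.
    - by rewrite rmorphN /= sK.
    - by rewrite opprK.
    have := fA (i, j); rewrite unfold_in /A /= (val_inj ij) ltnn eqxx => /andP[_ /eqP ->//].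
  apply/ffunP => -[i j]; rewrite ffunE mxE /=; case: (leqP i j) => // ji.
  have := fA (i, j); rewrite unfold_in /A /= ltnNge (ltnW ji) /=.
  by case: eqP ji => [->|_ _ /eqP ->//]; rewrite ltnn.
rewrite (eq_card (B := family A)) => [|f]; last by rewrite inE.
rewrite card_family.
have -> : foldr muln 1%N [seq #|A i| | i] = (\prod_ij #|A ij|)%N.
  by rewrite foldrE big_image.
apply/eqP; rewrite -(eqn_exp2r _ _ (isT : (0 < 2)%N)) -mulnn.
rewrite {2}(reindex_inj (h := fun ij : 'I_n * 'I_n => (ij.2, ij.1))); last by move=> [? ?] [? ?] [-> ->].
rewrite -big_split /= (eq_bigr (fun _ => (a ^ 2)%N)) => [|[i j] _].
  by rewrite prod_nat_const card_prod card_ord -!expnM mulnC.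
rewrite !cA /= eq_sym; case: (ltngtP i j) => ij.
- by case: eqP ij => [->|_]; rewrite ?ltnn // muln1.
- by case: eqP ij => [->|_]; rewrite ?ltnn // mul1n.
by rewrite (val_inj ij) eqxx mulnn.
Qed.

Lemma nreps_congr m n (G : 'M[R]_m) (S g g' : 'M[R]_n) :
  g *m g' = 1%:M -> nreps s G (g *m S *m g^*) = nreps s G S.
Proof.
move=> gg'; have g'g := mulmx1C gg'; have gg's : g'^* *m g^* = 1%:M :> 'M[R]_n.
  by rewrite -adjM gg' adj1.
have g'gs : g^* *m g'^* = 1%:M :> 'M[R]_n by rewrite -adjM g'g adj1.
rewrite /nreps; apply: (@card_bij _ _ _ _ (mulmx g') (mulmx g)) => X /eqP e.
  split; last by rewrite mulmxA gg' mul1mx.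
  by rewrite adjM !mulmxA -(mulmxA g') -(mulmxA g') e !mulmxA g'g mul1mx -mulmxA g'gs mulmx1.
split; last by rewrite mulmxA g'g mul1mx.
by rewrite adjM !mulmxA -(mulmxA g) -(mulmxA g) e.
Qed.

End Skew.

(** * Valuations and the ramified quadratic extension *)
Section Valuation.
Variables (K : fieldType) (v : valuation K).

Lemma vgeE m x : (x \in vge v m) = (x == 0) || (m <= v x).
Proof. by []. Qed.

Lemma vge0 m : 0 \in vge v m.
Proof. by rewrite vgeE eqxx. Qed.

Lemma vge_neq0 m x : x != 0 -> (x \in vge v m) = (m <= v x).
Proof. by rewrite vgeE => /negPf ->. Qed.

Lemma vfunN x : x != 0 -> v (- x) = v x.
Proof.
move=> x0; rewrite -mulN1r vfunM ?vfunN1 ?add0r //.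
by rewrite oppr_eq0 oner_eq0.
Qed.

Lemma vgeN m x : x \in vge v m -> - x \in vge v m.
Proof.
have [->|x0] := eqVneq x 0; first by rewrite oppr0.
by rewrite !vge_neq0 ?oppr_eq0 // vfunN.
Qed.

Lemma vgeD m x y : x \in vge v m -> y \in vge v m -> x + y \in vge v m.
Proof.
have [->|x0] := eqVneq x 0; first by rewrite add0r.
have [->|y0] := eqVneq y 0; first by rewrite addr0.
have [->|xy0] := eqVneq (x + y) 0; first by move=> *; rewrite vge0.
rewrite !vge_neq0 // => hx hy; apply: le_trans (vfunD v x0 y0 xy0).
by rewrite le_min hx.
Qed.

Lemma vgeB m x y : x \in vge v m -> y \in vge v m -> x - y \in vge v m.
Proof. by move=> hx hy; apply: vgeD => //; apply: vgeN. Qed.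

Lemma vgeM m n x y : x \in vge v m -> y \in vge v n -> x * y \in vge v (m + n).
Proof.
have [->|x0] := eqVneq x 0; first by move=> *; rewrite mul0r vge0.
have [->|y0] := eqVneq y 0; first by move=> *; rewrite mulr0 vge0.
by rewrite !vge_neq0 ?mulf_neq0 // vfunM // => hx hy; apply: lerD.
Qed.

Lemma vge_le m n x : m <= n -> x \in vge v n -> x \in vge v m.
Proof.
have [->|x0] := eqVneq x 0; first by rewrite !vge0.
by rewrite !vge_neq0 //; apply: le_trans.
Qed.

Lemma vge_sum (I : Type) (r : seq I) (P : pred I) (f : I -> K) m :
  (forall i, P i -> f i \in vge v m) -> \sum_(i <- r | P i) f i \in vge v m.
Proof.
move=> h; elim/big_rec: _ => [|i x Pi hx]; first exact: vge0.
by apply: vgeD hx; apply: h.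
Qed.

Lemma vfunV x : x != 0 -> v x^-1 = - v x.
Proof.
move=> x0; apply/eqP; rewrite -addr_eq0 -vfunM ?invr_eq0 //.
by rewrite mulVf // vfun1.
Qed.

Lemma vfunX x n : x != 0 -> v (x ^+ n) = v x *+ n.
Proof.
move=> x0; elim: n => [|n IH]; first by rewrite vfun1.
by rewrite exprS vfunM ?expf_neq0 // IH mulrS.
Qed.

Lemma vge_all0 x : (forall n : nat, x \in vge v n%:Z) -> x = 0.
Proof.
move=> h; apply/eqP; apply: contraT => x0.
by have := h `|v x|.+1; rewrite vge_neq0 // => h'; lia.
Qed.

Lemma vge1 : 1 \in vge v 0.
Proof. by rewrite vgeE vfun1 lexx orbT. Qed.

(** When the values differ, the value of the sum is the smaller one. *)
Lemma vge_sum_neq m x y : (x != 0 -> y != 0 -> v x != v y) ->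
  x + y \in vge v m -> x \in vge v m /\ y \in vge v m.
Proof.
have [->|x0] := eqVneq x 0; first by rewrite add0r vge0.
have [->|y0] := eqVneq y 0; first by rewrite addr0 vge0.
move=> /(_ isT isT) ne hxy.
have aux a b : a != 0 -> b != 0 -> v a < v b -> a + b \in vge v m ->
    a \in vge v m /\ b \in vge v m.
  move=> a0 b0 lt hab; suff ha : a \in vge v m.
    by split=> //; rewrite -(addKr a b); apply: vgeD => //; apply: vgeN.
  have ab0 : a + b != 0.
    by apply: contraTneq lt => /eqP; rewrite addr_eq0 => /eqP ->; rewrite vfunN // ltxx.
  have := vfunD v ab0 (_ : - b != 0); rewrite oppr_eq0 addrK => /(_ b0 a0).
  rewrite vfunN // ge_min => /orP[h|]; last by rewrite leNgt lt.
  by move: hab; rewrite !vge_neq0 // => /le_trans; apply.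
case: (ltgtP (v x) (v y)) ne => // lt _; first exact: aux.
by have [] := aux y x y0 x0 lt; rewrite // addrC.
Qed.

End Valuation.

Section Field.
Variables (p : nat) (E : ramQuadExt p).
Local Notation K := (F E).
Local Notation v := (vF E).
Local Notation sg := (conjF E).
Local Notation piK := (piF E).

Lemma nat_neq0 (n : nat) : (0 < n)%N -> n%:R != 0 :> K.
Proof.
move=> n0; have c0 := (pcharf0P (Qp E)).1 (Qp_char0 (QpP E)).
rewrite -(rmorph_nat (in_alg K)) -(rmorph_nat (in_alg (F0 E))) /=.
by rewrite !scaler_eq0 !oner_eq0 !orbF c0 -lt0n.
Qed.

Lemma vF_alg (a : F0 E) : a != 0 -> v a%:A = v0 E a *+ 2.
Proof. exact: F_ramified. Qed.

(** As p is odd, 2 has valuation 0 in Qp, hence in F. *)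
Lemma vF2 : prime p -> odd p -> v 2 = 0.
Proof.
move=> p_prime p_odd.
have [e _ ve] := v0_ext E; have c0 := (pcharf0P (Qp E)).1 (Qp_char0 (QpP E)).
have q2 : 2%:R != 0 :> Qp E by rewrite c0.
have f2 : 2%:R != 0 :> F0 E.
  by rewrite -(rmorph_nat (in_alg (F0 E))) /= scaler_eq0 oner_eq0 orbF.
rewrite -(rmorph_nat (in_alg K)) /= vF_alg // -(rmorph_nat (in_alg (F0 E))) /= ve //.
rewrite (Qp_val (QpP E)) // (_ : logn p 2 = 0%N) ?mul0rn //.
apply/eqP; rewrite lognE p_prime /=; case: ifP => // /(dvdn_leq (isT : (0 < 2)%N)).
by move: p_odd p_prime; case: p => [|[|[|n]]].
Qed.

Lemma half_int : prime p -> odd p -> (2^-1 : K) \in vge v 0.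
Proof.
by move=> p_prime p_odd; rewrite vge_neq0 ?invr_eq0 ?nat_neq0 // vfunV ?nat_neq0 // vF2 ?oppr0. Qed.

Lemma F_decomp (x : K) : exists a b : F0 E, x = a%:A + b%:A * piK.
Proof.
have fr : free [:: 1; piK].
  apply/freeP => k; rewrite big_ord_recl big_ord1 /= => e.
  have : sg (k ord0 *: 1 + k (lift ord0 ord0) *: piK) = 0 by rewrite e rmorph0.
  rewrite rmorphD -[k (lift _ _) *: piK]mulr_algl rmorphM /= !conjF_fix piF_conj mulrN.
  rewrite mulr_algl => e'.
  have k0 : k ord0 = 0.
    have : (k ord0)%:A *+ 2 = 0 :> K by rewrite mulr2n -[RHS](addr0 0) -{1}e -e' addrACA subrr addr0.
    rewrite -mulr_natl => /eqP; rewrite mulf_eq0 (negPf (nat_neq0 _)) //=.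
    by rewrite scaler_eq0 oner_eq0 orbF => /eqP.
  have k1 : k (lift ord0 ord0) = 0.
    move: e; rewrite k0 scale0r add0r => /eqP.
    by rewrite scaler_eq0 (negPf (piF_neq0 E)) orbF => /eqP.
  by move=> i; case: (unliftP ord0 i) => [j ->|->//]; rewrite ord1.
have /andP[/eqP sp _] : basis_of fullv [:: 1; piK].
  by rewrite basisEfree fr subvf F_quadratic.
have : x \in <<[:: 1%R; piK]>>%VS by rewrite sp memvf.
rewrite span_cons span_seq1 => /memv_addP[_ /vlineP[a ->] [_ /vlineP[b ->] ->]].
by exists a, b; rewrite mulr_algl.
Qed.

(** The two summands have valuations of different parity. *)
Lemma vge_decomp m (a b : F0 E) : a%:A + b%:A * piK \in vge v m ->
  a%:A \in vge v m /\ b%:A * piK \in vge v m.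
Proof.
apply: vge_sum_neq => a0 b0.
have a0' : a != 0 by apply: contraNneq a0 => ->; rewrite scale0r.
have b0' : b != 0 by apply: contraNneq b0 => ->; rewrite scale0r mul0r.
have b1 : b%:A != 0 :> K by rewrite scaler_eq0 oner_eq0 orbF.
rewrite vfunM ?piF_neq0 // !vF_alg // piF_uniformizer.
by apply/eqP => h; lia.
Qed.

Lemma vge_conj m x : x \in vge v m -> sg x \in vge v m.
Proof.
have [a [b ->]] := F_decomp x.
move=> /vge_decomp[ha hb]; rewrite rmorphD rmorphM /= !conjF_fix piF_conj mulrN.
exact: vgeB.
Qed.

Lemma vge_alg_even (a : F0 E) (m : int) : a%:A \in vge v (m * 2 - 1) -> a%:A \in vge v (m * 2).
Proof.
have [->|a0] := eqVneq a 0; first by rewrite scale0r !vge0.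
rewrite !vge_neq0 ?scaler_eq0 ?oner_eq0 ?orbF // vF_alg // => h; lia.
Qed.

Lemma vge_alg_odd (b : F0 E) (m : int) : b%:A * piK \in vge v (m * 2) ->
  b%:A * piK \in vge v (m * 2 + 1).
Proof.
have [->|b0] := eqVneq b 0; first by rewrite scale0r mul0r !vge0.
have b1 : b%:A != 0 :> K by rewrite scaler_eq0 oner_eq0 orbF.
rewrite !vge_neq0 ?mulf_neq0 ?piF_neq0 // vfunM ?piF_neq0 // vF_alg // piF_uniformizer => h.
lia.
Qed.

End Field.

(** * The quotients of the ring of integers *)
Section Integers.
Variables (p : nat) (E : ramQuadExt p).
Local Notation K := (F E).
Local Notation O := (OF E).
Local Notation v := (vF E).
Local Notation sg := (conjF E).
Local Notation piK := (piF E).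

Lemma vvalD (x y : O) : vval (x + y) = vval x + vval y. Proof. by []. Qed.
Lemma vvalM (x y : O) : vval (x * y) = vval x * vval y. Proof. by []. Qed.
Lemma vvalN (x : O) : vval (- x) = - vval x. Proof. by []. Qed.
Lemma vvalB (x y : O) : vval (x - y) = vval x - vval y. Proof. by []. Qed.
Lemma vval0 : vval (0 : O) = 0. Proof. by []. Qed.
Lemma vval1 : vval (1 : O) = 1. Proof. by []. Qed.
Lemma vvalX (x : O) n : vval (x ^+ n) = vval x ^+ n.
Proof. by elim: n => // n IH; rewrite !exprS vvalM IH. Qed.
Lemma vval_inj : injective (@vval _ _ : O -> K). Proof. exact: val_inj. Qed.

Definition toK : O -> K := fun x => vval x.
Fact toK_is_additive : zmod_morphism toK. Proof. by []. Qed.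
Fact toK_is_multiplicative : monoid_morphism toK. Proof. by []. Qed.
HB.instance Definition _ := GRing.isZmodMorphism.Build O K toK toK_is_additive.
HB.instance Definition _ := GRing.isMonoidMorphism.Build O K toK toK_is_multiplicative.

Definition conjO (x : O) : O := VInt (vge_conj (vvalP x)).
Fact conjO_is_additive : zmod_morphism conjO.
Proof. by move=> x y; apply: vval_inj; rewrite /= rmorphB. Qed.
Fact conjO_is_multiplicative : monoid_morphism conjO.
Proof.
split; first by apply: vval_inj; rewrite /= rmorph1.
by move=> x y; apply: vval_inj; rewrite /= rmorphM.
Qed.
HB.instance Definition _ := GRing.isZmodMorphism.Build O O conjO conjO_is_additive.
HB.instance Definition _ := GRing.isMonoidMorphism.Build O O conjO conjO_is_multiplicative.

Lemma vval_conjO x : vval (conjO x) = sg (vval x). Proof. by []. Qed.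

Lemma conjOK : involutive conjO.
Proof. by move=> x; apply: vval_inj; rewrite !vval_conjO rmorphK. Qed.

Definition pid (j : nat) : {pred O} := fun x => vval x \in vge v j.+1%:Z.

Lemma pidE j (x : O) : (x \in pid j) = (vval x \in vge v j.+1%:Z). Proof. by []. Qed.

Fact pid_closed j : idealr_closed (pid j).
Proof.
split; rewrite ?pidE ?vval0 ?vge0 //.
  by rewrite vval1 vge_neq0 ?oner_eq0 // vfun1.
move=> a x y; rewrite !pidE vvalD vvalM => hx hy; apply: vgeD => //.
by rewrite -[j.+1%:Z]add0r; apply: vgeM => //; apply: vvalP.
Qed.

HB.instance Definition _ (j : nat) := isIdealr.Build O (pid j) (pid_closed j).

(** The exponent of pi is shifted by one, so that the ring is never zero. *)
Definition Rq (j : nat) : Type := {ideal_quot (pid j)}.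
HB.instance Definition _ j := GRing.ComNzRing.on (Rq j).
HB.instance Definition _ j := EqQuotient.on (Rq j).

Definition red j (x : O) : Rq j := \pi_{ideal_quot (pid j)}%qT x.
Fact red_is_additive j : zmod_morphism (red j).
Proof. by move=> x y; rewrite /red raddfB. Qed.
Fact red_is_multiplicative j : monoid_morphism (red j).
Proof. split; [exact: rmorph1|exact: rmorphM]. Qed.
HB.instance Definition _ j := GRing.isZmodMorphism.Build O (Rq j) (red j) (red_is_additive j).
HB.instance Definition _ j := GRing.isMonoidMorphism.Build O (Rq j) (red j) (red_is_multiplicative j).

Lemma red_eq j (x y : O) : (red j x == red j y) = (vval x - vval y \in vge v j.+1%:Z).
Proof. by rewrite /red -Quotient.idealrBE. Qed.

Lemma red_eq0 j (x : O) : (red j x == 0) = (vval x \in vge v j.+1%:Z).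
Proof. by rewrite -(rmorph0 (red j)) red_eq vval0 subr0. Qed.

Definition lift j (x : Rq j) : O := repr x.
Lemma liftK j : cancel (@lift j) (@red j).
Proof. by move=> x; rewrite /red /lift reprK. Qed.

Lemma lift_red j x : vval (lift (red j x)) - vval x \in vge v j.+1%:Z.
Proof. by rewrite -red_eq liftK. Qed.

Definition conjq j (x : Rq j) : Rq j := red j (conjO (lift x)).

Lemma conjq_red j x : conjq (red j x) = red j (conjO x).
Proof.
apply/eqP; rewrite red_eq !vval_conjO -rmorphB; apply: vge_conj.
exact: lift_red.
Qed.

Fact conjq_is_additive j : zmod_morphism (@conjq j).
Proof.
by move=> x y; rewrite -[x]liftK -[y]liftK -rmorphB !conjq_red !rmorphB.
Qed.
Fact conjq_is_multiplicative j : monoid_morphism (@conjq j).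
Proof.
split; first by rewrite -(rmorph1 (red j)) conjq_red [conjO 1]rmorph1.
move=> x y; rewrite -[x]liftK -[y]liftK -rmorphM !conjq_red. by rewrite !rmorphM.
Qed.
HB.instance Definition _ j := GRing.isZmodMorphism.Build (Rq j) (Rq j) (@conjq j) (@conjq_is_additive j).
HB.instance Definition _ j := GRing.isMonoidMorphism.Build (Rq j) (Rq j) (@conjq j) (@conjq_is_multiplicative j).

Lemma conjqK j : involutive (@conjq j).
Proof. by move=> x; rewrite -[x]liftK !conjq_red conjOK. Qed.

(** The representatives lie in F_0, so that the conjugation fixes them. *)
Fact rep_subproof (c : resField E) : exists x : K,
  x \in vge v 0 /\ exists2 y : vint (v0 E), x = (vval y)%:A & resMap E y = c.
Proof.
have [y yc] := resMap_surj c; exists (vval y)%:A; split; last by exists y.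
have [->|y0] := eqVneq (vval y) 0; first by rewrite scale0r vge0.
rewrite vge_neq0 ?scaler_eq0 ?oner_eq0 ?orbF // vF_alg //.
have := vvalP y; rewrite unfold_in /vge (negPf y0) /= => h.
lia.
Qed.

Definition rep (c : resField E) : O := VInt (projT2 (cid (rep_subproof c))).1.

Lemma rep_spec c : exists2 y : vint (v0 E), vval (rep c) = (vval y)%:A & resMap E y = c.
Proof. exact: (projT2 (cid (rep_subproof c))).2. Qed.

Lemma conj_rep c : conjO (rep c) = rep c.
Proof.
by have [y e _] := rep_spec c; apply: vval_inj; rewrite vval_conjO e conjF_fix.
Qed.

Lemma rep_inj c c' : vval (rep c) - vval (rep c') \in vge v 1 -> c = c'.
Proof.
have [y -> <-] := rep_spec c; have [y' -> <-] := rep_spec c'.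
rewrite -scalerBl => h; apply/eqP; rewrite -subr_eq0 -rmorphB resMap_ker.
rewrite -[vval (y - y')]/(vval y - vval y').
have [->|d0] := eqVneq (vval y - vval y') 0; first exact: vge0.
move: h; rewrite !vge_neq0 ?scaler_eq0 ?oner_eq0 ?orbF // vF_alg //.
by move: (v0 E _) => z h; lia.
Qed.

Lemma ex_residue (x : O) : exists c, vval x - vval (rep c) \in vge v 1.
Proof.
have [a [b e]] := F_decomp (vval x).
have := vvalP x; rewrite [vval x]e => /vge_decomp[ha hb].
have {}hb : b%:A * piK \in vge v 1.
  by apply: (@vge_alg_odd _ E b 0); rewrite mul0r.
have ia : a \in vring (v0 E).
  rewrite unfold_in /vge; have [//|a0] /= := eqVneq a 0.
  move: ha; rewrite vge_neq0 ?scaler_eq0 ?oner_eq0 ?orbF // vF_alg // => h.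
  lia.
exists (resMap E (VInt ia)).
have [y -> yc] := rep_spec (resMap E (VInt ia)).
rewrite addrAC -scalerBl; apply: vgeD => //.
have := resMap_ker (y - VInt ia); rewrite rmorphB yc subrr eqxx => /esym.
rewrite -[vval (y - _)]/(vval y - a); set d := vval y - a.
have -> : a - vval y = - d by rewrite opprB.
rewrite scaleNr => h; apply: vgeN; move: h.
have [e0|d0] := eqVneq d 0; first by rewrite e0 scale0r !vge0.
rewrite !vge_neq0 ?scaler_eq0 ?oner_eq0 ?orbF // vF_alg //.
by move: (v0 E _) => z h; lia.
Qed.

Definition residue (x : O) : resField E := projT1 (cid (ex_residue x)).

Lemma residueP x : vval x - vval (rep (residue x)) \in vge v 1.
Proof. exact: (projT2 (cid (ex_residue x))). Qed.

Lemma residue_uniq x c : vval x - vval (rep c) \in vge v 1 -> residue x = c.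
Proof.
move=> h; apply: rep_inj.
have -> : vval (rep (residue x)) - vval (rep c) =
  (vval x - vval (rep c)) - (vval x - vval (rep (residue x))) by ring.
by apply: vgeB => //; apply: residueP.
Qed.

Fact next_subproof (x : O) : (vval x - vval (rep (residue x))) / piK \in vge v 0.
Proof.
rewrite -[0](subrr 1); apply: vgeM; first exact: residueP.
by rewrite vge_neq0 ?invr_eq0 ?piF_neq0 // vfunV ?piF_neq0 // piF_uniformizer.
Qed.

(** [residue] and [next] are the first pi-adic digit and the shifted expansion;
    they show that a quotient of O_F is finite and give its cardinality. *)
Definition next (x : O) : O := VInt (next_subproof x).

Lemma nextE x : x = rep (residue x) + piO E * next x.
Proof.
apply: vval_inj; rewrite vvalD vvalM /= mulrCA mulfV ?piF_neq0 // mulr1.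
by rewrite addrC subrK.
Qed.

Lemma vge_piM m (x : K) : (piK * x \in vge v (m + 1)) = (x \in vge v m).
Proof.
have [->|x0] := eqVneq x 0; first by rewrite mulr0 !vge0.
rewrite !vge_neq0 ?mulf_neq0 ?piF_neq0 // vfunM ?piF_neq0 // piF_uniformizer.
by rewrite [1 + _]addrC lerD2r.
Qed.

Lemma residue_step c x : residue (rep c + piO E * x) = c /\ next (rep c + piO E * x) = x.
Proof.
have rc : residue (rep c + piO E * x) = c.
  apply: residue_uniq; rewrite vvalD addrAC subrr add0r vvalM.
  by rewrite -[1]add0r vge_piM; apply: vvalP.
split=> //; have := nextE (rep c + piO E * x); rewrite rc => /addrI e.
have := congr1 (@vval _ _) e; rewrite !vvalM => /(mulfI (piF_neq0 E)) e'.
exact/esym/vval_inj.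
Qed.

Lemma congr_residue j (x y : O) : (vval x - vval y \in vge v j.+1%:Z) =
  (residue x == residue y) && ((j == 0)%N || (vval (next x) - vval (next y) \in vge v j%:Z)).
Proof.
apply/idP/andP => [h|[/eqP r]].
  have r : residue x = residue y.
    apply: residue_uniq; rewrite -[vval x](subrK (vval y)) -addrA; apply: vgeD.
      by apply: vge_le h; lia.
    exact: residueP.
  split; first exact/eqP.
  have [//|j0] := eqVneq j 0%N; apply/orP; right; move: h; rewrite {1}(nextE x) {1}(nextE y) r.
  rewrite !vvalD !vvalM opprD addrACA subrr add0r -mulrBr.
  by rewrite -[j.+1]addn1 PoszD vge_piM.
rewrite [in X in _ -> X](nextE x) [in X in _ -> X](nextE y) r.
rewrite !vvalD !vvalM opprD addrACA subrr add0r -mulrBr.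
rewrite -[j.+1]addn1 PoszD vge_piM.
case/orP => // /eqP ->; apply: vgeB; exact: vvalP.
Qed.

Fixpoint digits (x : O) (i : nat) : resField E :=
  if i is i'.+1 then digits (next x) i' else residue x.

Lemma congr_digits j (x y : O) :
  (vval x - vval y \in vge v j.+1%:Z) <-> (forall i, (i <= j)%N -> digits x i = digits y i).
Proof.
elim: j x y => [|j IH] x y; rewrite congr_residue /=.
  rewrite andbT; split=> [/eqP e i|h]; last exact/eqP/(h 0%N).
  by rewrite leqn0 => /eqP ->.
split=> [/andP[/eqP e h] [|i]|h] //; first exact: (proj1 (IH (next x) (next y)) h).
apply/andP; split; first exact/eqP/(h 0%N).
by apply/(proj2 (IH (next x) (next y))) => i le; apply: (h i.+1).
Qed.

Lemma digits_surj j (f : nat -> resField E) :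
  exists x, forall i, (i <= j)%N -> digits x i = f i.
Proof.
elim: j f => [|j IH] f.
  exists (rep (f 0%N) + piO E * 0) => i; rewrite leqn0 => /eqP -> /=.
  by have [] := residue_step (f 0%N) 0.
have [x hx] := IH (f \o succn); exists (rep (f 0%N) + piO E * x).
have [r n] := residue_step (f 0%N) x.
by move=> [|i] /= le; rewrite ?r // n hx.
Qed.

Definition qdigits j (x : Rq j) : {ffun 'I_j.+1 -> resField E} := [ffun i => digits (lift x) (nat_of_ord i)].

Lemma qdigits_bij j : bijective (@qdigits j).
Proof.
have inj : injective (@qdigits j).
  move=> x y e; rewrite -[x]liftK -[y]liftK; apply/eqP; rewrite red_eq.
  apply/(proj2 (congr_digits _ _ _)) => i le; have /ffunP/(_ (Ordinal (le : (i < j.+1)%N))) := e.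
  by rewrite !ffunE.
have surj f : exists x : Rq j, qdigits x = f.
  have [x hx] := digits_surj j (fun i => f (inord i)).
  exists (red j x); apply/ffunP => i; rewrite ffunE.
  rewrite (proj1 (congr_digits _ _ _) (lift_red j x)); last by rewrite -ltnS.
  by rewrite hx ?inord_val // -ltnS.
pose g f := projT1 (cid (surj f)).
have gK : cancel g (@qdigits j) by move=> f; apply: (projT2 (cid (surj f))).
by exists g => // x; apply: inj; rewrite gK.
Qed.

Fact qdigits_can j : exists g, cancel (@qdigits j) g.
Proof. by have [g gK _] := qdigits_bij j; exists g. Qed.

HB.instance Definition _ j := CanIsCountable (projT2 (cid (qdigits_can j))).
HB.instance Definition _ j := fintype.isFinite.Build (Rq j)
  (pcan_enumP (can_pcan (projT2 (cid (qdigits_can j))))).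

Lemma card_Rq j : #|{: Rq j}| = (resq E ^ j.+1)%N.
Proof.
rewrite (bij_eq_card (qdigits_bij j)) card_ffun card_ord //.
Qed.

End Integers.

(** * The structure of the quotients *)
Section Level.
Variables (p : nat) (E : ramQuadExt p).
Hypotheses (p_prime : prime p) (p_odd : odd p).
Local Notation K := (F E).
Local Notation O := (OF E).
Local Notation v := (vF E).
Local Notation sg := (conjF E).
Local Notation piK := (piF E).
Local Notation q := (resq E).

Definition halfO : O := VInt (half_int E p_prime p_odd).

Lemma halfOP : halfO + halfO = 1.
Proof.
apply: vval_inj; rewrite vvalD vval1 /= -mulr2n -(mulr_natr 2^-1) mulVf //.
exact: nat_neq0.
Qed.

Section AnyLevel.
Variable j : nat.
Local Notation R := (Rq E j).
Local Notation s := (@conjq p E j).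

Lemma red_halfP : red j halfO + red j halfO = 1 :> R.
Proof. by rewrite -rmorphD halfOP rmorph1. Qed.

Lemma vge_unit (x : K) : x \in vge v 0 -> x \notin vge v 1 -> x^-1 \in vge v 0.
Proof.
move=> h0 h1; have x0 : x != 0 by apply: contraNneq h1 => ->; rewrite vge0.
move: h0 h1; rewrite !vge_neq0 ?invr_eq0 // vfunV // => h0 h1.
by lia.
Qed.

Lemma unitb_red (x : O) : unitb (red j x) = (vval x \notin vge v 1).
Proof.
apply/unitbP/idP => [[y]|nx].
  rewrite -[y]liftK -rmorphM -(rmorph1 (red j)) => /eqP; rewrite red_eq vvalM vval1 => h.
  apply/negP => hx; have : 1 \in vge v 1.
    have -> : 1 = vval x * vval (lift y) - (vval x * vval (lift y) - 1) by ring.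
    apply: vgeB; last by apply: vge_le h; lia.
    by rewrite -[1]addr0; apply: vgeM => //; apply: vvalP.
  by rewrite vge_neq0 ?oner_eq0 // vfun1.
have x0 : vval x != 0 by apply: contraNneq nx => ->; rewrite vge0.
exists (red j (VInt (vge_unit (vvalP x) nx))).
rewrite -rmorphM -(rmorph1 (red j)); congr red; apply: vval_inj.
by rewrite vvalM /= mulfV.
Qed.

Lemma local_Rq (x y : R) : unitb (x + y) -> unitb x || unitb y.
Proof.
rewrite -[x]liftK -[y]liftK -rmorphD !unitb_red vvalD -negb_and.
by apply: contra => /andP[hx hy]; apply: vgeD.
Qed.

Lemma conj_diff (a b : F0 E) : sg (a%:A + b%:A * piK) - (a%:A + b%:A * piK) = - 2 * (b%:A * piK).
Proof. by rewrite rmorphD rmorphM /= !conjF_fix piF_conj; ring. Qed.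

Lemma vge_im m (a b : F0 E) :
  (sg (a%:A + b%:A * piK) - (a%:A + b%:A * piK) \in vge v m) = (b%:A * piK \in vge v m).
Proof.
rewrite conj_diff; apply/idP/idP => h.
  have -> : b%:A * piK = - 2^-1 * (- 2 * (b%:A * piK)).
    by rewrite mulrA mulrNN mulVf ?nat_neq0 // mul1r.
  by rewrite -[m]add0r; apply: vgeM => //; apply: vgeN; apply: half_int.
rewrite -[m]add0r; apply: vgeM => //; apply: vgeN.
by rewrite vge_neq0 ?nat_neq0 // vF2.
Qed.

Lemma conj_residue (x : R) : ~~ unitb (s x - x).
Proof.
rewrite -[x]liftK conjq_red -rmorphB unitb_red negbK vvalB vval_conjO.
have := vvalP (lift x); have [a [b ->]] := F_decomp (vval (lift x)).
rewrite vge_im => /vge_decomp[_ hb].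
by apply: (@vge_alg_odd _ E b 0); rewrite mul0r.
Qed.

Lemma conj_pi : s (red j (piO E)) = - red j (piO E).
Proof.
rewrite conjq_red -rmorphN; congr red; apply: vval_inj.
by rewrite vval_conjO vvalN /= piF_conj.
Qed.

Lemma nonunit_pi (x : R) : ~~ unitb x -> exists y, x = red j (piO E) * y.
Proof.
rewrite -[x]liftK unitb_red negbK => h.
have hx : vval (lift x) / piK \in vge v 0.
  rewrite -[0](subrr 1); apply: vgeM => //.
  by rewrite vge_neq0 ?invr_eq0 ?piF_neq0 // vfunV ?piF_neq0 // piF_uniformizer.
exists (red j (VInt hx)); rewrite -rmorphM; congr red; apply: vval_inj.
by rewrite vvalM /= mulrCA mulfV ?piF_neq0 // mulr1.
Qed.

Lemma red_rep_inj c c' : unitb (red j (rep c) - red j (rep c') : R) = (c != c').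
Proof.
rewrite -rmorphB unitb_red vvalB; congr (~~ _); apply/idP/eqP => [/rep_inj //|->].
by rewrite subrr vge0.
Qed.

Lemma conj_red_rep c : s (red j (rep c)) = red j (rep c).
Proof. by rewrite conjq_red conj_rep. Qed.

Definition reps : {set R} := [set red j (rep c) | c in [set: resField E]].

Lemma card_reps : #|reps| = q.
Proof.
rewrite card_imset ?cardsT // => c c' e; apply/eqP; apply: contraT.
rewrite -red_rep_inj e subrr => /unitbP[y] /eqP.
by rewrite mul0r eq_sym oner_eq0.
Qed.

Lemma resq_gt1 : (1 < q)%N.
Proof.
have -> : q = #|[set: resField E]| by rewrite cardsT.
by apply/card_gt1P; exists 0, 1; rewrite !inE eq_sym oner_eq0.
Qed.

(** An element is a digit plus a nonunit. *)
Lemma card_nonunit : (q * cnonunit R = #|{: R}|)%N.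
Proof.
rewrite -[q]cardsT /cnonunit -cardsT.
rewrite (@card_bij _ _ (fun _ => true)
   (fun cy : resField E * R => (cy.1 \in [set: _]) && (~~ unitb cy.2))
   (fun x => (residue (lift x), x - red j (rep (residue (lift x)))))
   (fun cy => red j (rep cy.1) + cy.2)) => [|x _|[c y]] /=.
- by rewrite -cardsX; apply: eq_card => -[c y]; rewrite !inE.
- rewrite inE addrCA subrr addr0; split=> //=.
  by rewrite -{1}[x]liftK -rmorphB unitb_red negbK vvalB; apply: residueP.
rewrite inE /= => uy; split=> //.
have -> : residue (lift (red j (rep c) + y)) = c.
  apply: residue_uniq; move: uy; rewrite -{1}[y]liftK unitb_red negbK => uy.
  have h := lift_red j (rep c + lift y); rewrite (rmorphD (red j)) /= liftK in h.
  set z := lift _ in h *.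
  have -> : vval z - vval (rep c) = (vval z - (vval (rep c) + vval (lift y))) + vval (lift y) by ring.
  by apply: vgeD => //; apply: vge_le h; lia.
by rewrite addrAC subrr add0r.
Qed.

End AnyLevel.

(** Levels of the form 2d + 2, that is, powers of the uniformizer of F_0. *)
Section EvenLevel.
Variable d : nat.
Local Notation j := (d.*2.+1).
Local Notation R := (Rq E j).
Local Notation s := (@conjq p E j).
Local Notation pi := (red j (piO E) : R).

Lemma pi_neq0 : pi != 0.
Proof.
rewrite red_eq0 vge_neq0 ?piF_neq0 //= piF_uniformizer.
by lia.
Qed.

Lemma real_decomp (x : O) : s (red j x) = red j x ->
  exists a : F0 E, a%:A \in vge v 0 /\ vval x - a%:A \in vge v j.+1%:Z.
Proof.
rewrite conjq_red => /eqP; rewrite red_eq vval_conjO.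
have := vvalP x; have [a [b ->]] := F_decomp (vval x).
rewrite vge_im => /vge_decomp[ha _] hb; exists a; split=> //.
by rewrite addrAC subrr add0r.
Qed.

(** A real element has even valuation.  If it is divisible by pi^{2d+1}, then it is
    divisible by pi^{2d+2}. *)
Lemma pi_real_ann (r : R) : s r = r -> pi * r = 0 -> r = 0.
Proof.
rewrite -[r]liftK => /real_decomp[a [ha hxa]] /eqP.
rewrite -rmorphM red_eq0 vvalM /= -[j.+1]addn1 PoszD vge_piM => h.
apply/eqP; rewrite red_eq0 -[vval (lift r)](subrK a%:A); apply: vgeD => //.
have -> : j.+1%:Z = d.+1%:Z * 2 by lia.
apply: vge_alg_even; have -> : d.+1%:Z * 2 - 1 = j by lia.
have -> : a%:A = vval (lift r) - (vval (lift r) - a%:A) by ring.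
by apply: vgeB => //; apply: vge_le hxa; lia.
Qed.

Lemma conj_pi2 : s (pi ^+ 2) = pi ^+ 2.
Proof. by rewrite rmorphXn /= conj_pi sqrrN. Qed.

Lemma pi2_nilp : (pi ^+ 2) ^+ d.+1 = 0.
Proof.
apply/eqP; rewrite -exprM -rmorphXn red_eq0 vvalX.
rewrite vge_neq0 ?expf_neq0 ?piF_neq0 //= vfunX ?piF_neq0 // piF_uniformizer.
by lia.
Qed.

(** The first digit of a real element, and a remainder whose valuation is even,
    hence divisible by the square of pi. *)
Lemma real_reps (c : R) : s c = c ->
  exists2 t, t \in reps j & exists2 c', s c' = c' & c = t + pi ^+ 2 * c'.
Proof.
rewrite -[c]liftK => /real_decomp[a [ha hxa]].
set t := residue (lift c); exists (red j (rep t)).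
  by apply/imsetP; exists t; rewrite ?inE.
have [y ye _] := rep_spec t.
have h2 : (a - vval y)%:A \in vge v 2.
  apply: (@vge_alg_even _ E _ 1); rewrite mul1r scalerBl -ye.
  have -> : a%:A - vval (rep t) = (vval (lift c) - vval (rep t)) - (vval (lift c) - a%:A) by ring.
  by apply: vgeB; [apply: residueP|apply: vge_le hxa; lia].
have hz : (a - vval y)%:A / piK ^+ 2 \in vge v 0.
  rewrite -[0](subrr 2); apply: vgeM => //.
  rewrite vge_neq0 ?invr_eq0 ?expf_neq0 ?piF_neq0 // vfunV ?expf_neq0 ?piF_neq0 //.
  by rewrite vfunX ?piF_neq0 // piF_uniformizer.
exists (red j (VInt hz)).
  rewrite conjq_red; congr red; apply: vval_inj; rewrite vval_conjO /=.
  by rewrite fmorph_div rmorphXn /= conjF_fix piF_conj sqrrN.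
rewrite -rmorphXn -rmorphM -rmorphD; apply/eqP; rewrite red_eq vvalD vvalM vvalX /=.
rewrite mulrCA mulfV ?expf_neq0 ?piF_neq0 // mulr1 scalerBl -ye.
by rewrite [vval (rep t) + _]addrC subrK.
Qed.

(** Multiplication by pi maps the real elements bijectively onto the skew ones at
    the even levels. *)
Lemma cplus_cminus : cplus s = cminus s.
Proof.
rewrite /cplus /cminus -(card_in_imset (f := fun r => pi * r)); last first.
  move=> x y; rewrite !inE => /eqP sx /eqP sy e; apply/eqP; rewrite -subr_eq0; apply/eqP.
  by apply: pi_real_ann; rewrite ?rmorphB /= ?sx ?sy // mulrBr e subrr.
apply: eq_card => x; apply/imsetP/idP => [[r]|].
  by rewrite !inE => /eqP sr ->; rewrite rmorphM /= conj_pi sr mulNr.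
rewrite inE -[x]liftK => /eqP sx.
have : vval (lift x) + sg (vval (lift x)) \in vge v j.+1%:Z.
  by move/eqP: sx; rewrite -addr_eq0 /= conjq_red -rmorphD red_eq0 vvalD vval_conjO addrC.
have := vvalP (lift x); case: (F_decomp (vval (lift x))) => a [b e].
rewrite e => /vge_decomp[_ hb].
rewrite rmorphD rmorphM /= !conjF_fix piF_conj => hs.
have ha : a%:A \in vge v j.+1%:Z.
  have -> : a%:A = 2^-1 * (a%:A + b%:A * piK + (a%:A + b%:A * - piK)).
    by rewrite mulrN addrACA subrr addr0 -mulr2n -(mulr_natl a%:A) mulKf ?nat_neq0.
  by rewrite -[j.+1%:Z]add0r; apply: vgeM => //; apply: half_int.
have hb0 : b%:A \in vge v 0.
  by rewrite -vge_piM mulrC; apply: (@vge_alg_odd _ E b 0); rewrite mul0r.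
exists (red j (VInt hb0)).
  rewrite inE /= conjq_red; apply/eqP; congr red; apply: vval_inj.
  by rewrite vval_conjO /= conjF_fix.
apply/eqP; rewrite -rmorphM red_eq vvalM e /= [piK * _]mulrC addrK.
exact: ha.
Qed.

Lemma cminusE : cminus s = (q ^ d.+1)%N.
Proof.
have := card_split (@conjqK p E j) (@red_halfP j).
rewrite cplus_cminus card_Rq mulnn => e; apply/eqP.
rewrite -(eqn_exp2r _ _ (isT : (0 < 2)%N)) -e -expnM; apply/eqP; congr (_ ^ _)%N.
by lia.
Qed.

End EvenLevel.
End Level.

(** * Gram matrices of lattices and the counting function of the density *)
Lemma card_fset_image (T : finType) (U : choiceType) (f : T -> U) (P : {set T})
    (A : set U) :
  injective f -> (forall u, A u <-> exists2 x, x \in P & u = f x) ->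
  #|` fset_set A|%fset = #|P|.
Proof.
move=> fI AP.
have -> : A = (f @` [set` [fset x in P]%fset])%classic.
  apply/seteqP; split=> u /=.
    by move=> /AP[x Px ->]; exists x => //; rewrite /= inE.
  by move=> [x /=]; rewrite inE => Px <-; apply/AP; exists x.
by rewrite fset_set_image // set_fsetK card_imfset //= -card_finset.
Qed.

Section Lattice.
Variables (p : nat) (E : ramQuadExt p).
Local Notation K := (F E).
Local Notation O := (OF E).
Local Notation v := (vF E).
Local Notation sg := (conjF E).
Local Notation piK := (piF E).

Section Form.
Variable L : hermLattice E.

Lemma hl_formC (x y : L) : hl_form x y = sg (hl_form y x).
Proof.
have [V [i [_ h _]]] := hl_ext L.
by rewrite -!h hermC expr0 mul1r.
Qed.

Lemma hl_formPl (a : O) (x y z : L) :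
  hl_form (a *: x + y) z = vval a * hl_form x z + hl_form y z.
Proof.
have [V [i [lin h _]]] := hl_ext L.
by rewrite -!h lin linearPl.
Qed.

Lemma hl_form0l (z : L) : hl_form 0 z = 0.
Proof.
have := hl_formPl 1 0 0 z; rewrite scaler0 addr0 vval1 mul1r => e.
by apply: (addrI (hl_form 0 z)); rewrite addr0 -e.
Qed.

Lemma hl_formDl (x y z : L) : hl_form (x + y) z = hl_form x z + hl_form y z.
Proof. by rewrite -[x]scale1r hl_formPl vval1 mul1r scale1r. Qed.

Lemma hl_formZl (a : O) (x z : L) : hl_form (a *: x) z = vval a * hl_form x z.
Proof. by rewrite -[a *: x]addr0 hl_formPl hl_form0l addr0. Qed.

Lemma hl_formZr (a : O) (x z : L) : hl_form z (a *: x) = sg (vval a) * hl_form z x.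
Proof. by rewrite hl_formC hl_formZl rmorphM /= -hl_formC. Qed.

Lemma hl_form_suml (I : Type) (r : seq I) (P : pred I) (f : I -> L) z :
  hl_form (\sum_(i <- r | P i) f i) z = \sum_(i <- r | P i) hl_form (f i) z.
Proof.
elim/big_rec2: _ => [|i x y _ <-]; first exact: hl_form0l.
exact: hl_formDl.
Qed.

Lemma hl_form_sumr (I : Type) (r : seq I) (P : pred I) (f : I -> L) z :
  hl_form z (\sum_(i <- r | P i) f i) = \sum_(i <- r | P i) hl_form z (f i).
Proof.
rewrite hl_formC hl_form_suml rmorph_sum /=; apply: eq_bigr => i _.
by rewrite -hl_formC.
Qed.

End Form.

(** The factor pi makes the matrix of an integral form integral, and skew-hermitian. *)
Definition has_gram (L : hermLattice E) n (G : 'M[O]_n) : Prop :=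
  exists b : n.-tuple L, free_basis b /\
    forall i j, vval (G i j) = piK * hl_form (tnth b i) (tnth b j).

Section Coordinates.
Variables (L : hermLattice E) (n : nat) (b : n.-tuple L).
Hypothesis bP : free_basis b.

Definition comb (c : 'rV[O]_n) : L := \sum_i c 0 i *: tnth b i.
Definition coord (x : L) : 'rV[O]_n := projT1 (cid (bP x)).

Lemma coordK : cancel coord comb.
Proof. by move=> x; rewrite /coord; case: cid => c [/= e _]; rewrite /comb -e. Qed.

Lemma combK : cancel comb coord.
Proof.
move=> c; rewrite /coord; case: cid => c' [/= e u].
by apply/u.
Qed.

Lemma comb_linear a c d : comb (a *: c + d) = a *: comb c + comb d.
Proof.
rewrite /comb scaler_sumr -big_split /=; apply: eq_bigr => i _.
by rewrite !mxE scalerDl scalerA.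
Qed.

Lemma comb0 : comb 0 = 0.
Proof. by rewrite /comb big1 // => i _; rewrite mxE scale0r. Qed.

Lemma combZ a c : comb (a *: c) = a *: comb c.
Proof. by rewrite -[a *: c]addr0 comb_linear comb0 addr0. Qed.

Lemma combB c d : comb (c - d) = comb c - comb d.
Proof. by rewrite -[- d]scaleN1r [c + _]addrC comb_linear scaleN1r addrC. Qed.

Lemma coord_linear a x y : coord (a *: x + y) = a *: coord x + coord y.
Proof. by rewrite -[x]coordK -[y]coordK -comb_linear !combK. Qed.

Lemma coord_basis i : coord (tnth b i) = delta_mx 0 i.
Proof.
rewrite -[RHS]combK; congr coord; rewrite /comb (bigD1 i) //= mxE !eqxx scale1r.
by rewrite big1 ?addr0 // => k /negPf ki; rewrite mxE ki andbF scale0r.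
Qed.

Lemma to_quot_comb (a : O) c d :
  to_quot a (comb c) = to_quot a (comb d) <-> exists e, c - d = a *: e.
Proof.
split=> [/eqP/to_quotP[z]|[e h]].
  by rewrite -combB -[z]coordK -combZ => /(can_inj combK) ->; exists (coord z).
by apply/eqP/to_quotP; exists (comb e); rewrite -combB h combZ.
Qed.

Lemma form_comb (G : 'M[O]_n) c d :
  (forall i j, vval (G i j) = piK * hl_form (tnth b i) (tnth b j)) ->
  piK * hl_form (comb c) (comb d) = vval ((c *m G *m adj (@conjO p E) d) 0 0).
Proof.
move=> hG; rewrite -[vval _]/(toK _) mxE rmorph_sum /=.
rewrite /comb hl_form_sumr mulr_sumr; apply: eq_bigr => j _.
rewrite hl_formZr hl_form_suml mxE !mulr_sumr.
rewrite -[vval (\sum_k _)]/(toK _) rmorph_sum /= mulr_suml; apply: eq_bigr => i _.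
rewrite hl_formZl !mxE vval_conjO hG; ring.
Qed.

End Coordinates.

Lemma divides_pi (k : nat) (x : O) :
  vval x \in vge v k%:Z <-> exists y, x = piO E ^+ k * y.
Proof.
split=> [h|[y ->]]; last first.
  rewrite vvalM vvalX -[k%:Z]addr0; apply: vgeM; last exact: vvalP.
  by rewrite vge_neq0 ?expf_neq0 ?piF_neq0 // vfunX ?piF_neq0 // piF_uniformizer; lia.
have hy : vval x / piK ^+ k \in vge v 0.
  rewrite -[0](subrr k%:Z); apply: vgeM => //.
  rewrite vge_neq0 ?invr_eq0 ?expf_neq0 ?piF_neq0 // vfunV ?expf_neq0 ?piF_neq0 //.
  rewrite vfunX ?piF_neq0 // piF_uniformizer.
  by lia.
exists (VInt hy); apply: vval_inj; rewrite vvalM vvalX /= mulrCA mulfV ?mulr1 //.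
by rewrite expf_neq0 ?piF_neq0.
Qed.

Lemma red_mx_eq j m n (A B : 'M[O]_(m, n)) :
  map_mx (red j) A = map_mx (red j) B <-> exists D, A - B = piO E ^+ j.+1 *: D.
Proof.
split=> [h|[D e]].
  have hij i k : exists y, (A - B) i k = piO E ^+ j.+1 * y.
    apply/divides_pi; rewrite !mxE vvalB -red_eq.
    by move/matrixP/(_ i k): h; rewrite !mxE => ->.
  exists (\matrix_(i, k) projT1 (cid (hij i k))); apply/matrixP => i k.
  by rewrite [RHS]mxE mxE; case: cid => y.
apply/matrixP => i k; rewrite !mxE; apply/eqP; rewrite red_eq -vvalB.
by apply/divides_pi; exists (D i k); move/matrixP/(_ i k): e; rewrite !mxE.
Qed.

Lemma adj_red j m n (A : 'M[O]_(m, n)) :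
  map_mx (red j) (adj (@conjO p E) A) = adj (@conjq p E j) (map_mx (red j) A).
Proof. by apply/matrixP => i k; rewrite !mxE conjq_red. Qed.

(** At index d + 1 the forms are compared modulo pi^{2d+1}, that is, their Gram
    matrices, which are multiplied by pi, are compared modulo pi^{2d+2}. *)
Section Count.
Variables (L M : hermLattice E) (n m d : nat) (S : 'M[O]_n) (G : 'M[O]_m).
Variables (b : n.-tuple L) (c : m.-tuple M).
Hypotheses (bP : free_basis b) (cP : free_basis c).
Hypothesis hS : forall i j, vval (S i j) = piK * hl_form (tnth b i) (tnth b j).
Hypothesis hG : forall i j, vval (G i j) = piK * hl_form (tnth c i) (tnth c j).
Local Notation j := (d.*2.+1).
Local Notation a := (piO E ^+ d.+1.*2).
Local Notation R := (Rq E j).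

Definition lmx (X : 'M[R]_(n, m)) : 'M[O]_(n, m) := map_mx (@lift p E j) X.

Lemma red_lmx X : map_mx (red j) (lmx X) = X.
Proof. by apply/matrixP => i k; rewrite !mxE liftK. Qed.

Definition hom_of_mx (X : 'M[R]_(n, m)) (x : lquot a L) : lquot a M :=
  to_quot a (comb c (coord bP (repr x) *m lmx X)).

Lemma hom_of_mxE X x :
  hom_of_mx X (to_quot a x) = to_quot a (comb c (coord bP x *m lmx X)).
Proof.
apply/(to_quot_comb cP); have : to_quot a (repr (to_quot a x)) = to_quot a x.
  by rewrite -to_quot_surj.
rewrite -{1}(coordK bP (repr _)) -{2}(coordK bP x) => /(to_quot_comb bP)[e he].
by exists (e *m lmx X); rewrite -mulmxBl he scalemxAl.
Qed.

Lemma hom_of_mx_linear X : linear (hom_of_mx X).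
Proof.
move=> k x y; rewrite [x]to_quot_surj [y]to_quot_surj.
have qZ (N : lmodType O) (z : N) : k *: to_quot a z = to_quot a (k *: z).
  exact: qscaleE.
rewrite qZ -to_quotD !hom_of_mxE qZ -to_quotD; congr to_quot.
by rewrite coord_linear mulmxDl -scalemxAl comb_linear.
Qed.

Lemma hom_of_mx_inj : injective hom_of_mx.
Proof.
move=> X Y e; rewrite -[X]red_lmx -[Y]red_lmx; apply/matrixP => i k.
have := congr1 (fun f => f (to_quot a (tnth b i))) e.
rewrite !hom_of_mxE coord_basis -!rowE => /(to_quot_comb cP)[f hf].
have /matrixP/(_ 0 k) : map_mx (red j) (row i (lmx X)) = map_mx (red j) (row i (lmx Y)).
  by apply/red_mx_eq; exists f.
by rewrite !mxE.
Qed.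

(** The matrix has as rows the coordinates of the images of the basis of L. *)
Lemma hom_of_mx_surj (phi : lquot a L -> lquot a M) : linear phi ->
  exists X, phi = hom_of_mx X.
Proof.
move=> lphi.
pose r i := coord cP (repr (phi (to_quot a (tnth b i)))).
exists (map_mx (red j) (\matrix_(i, k) r i 0 k)).
set X := \matrix_(i, k) _.
have phiD x y : phi (x + y) = phi x + phi y by rewrite -[x]scale1r lphi !scale1r.
have phi0 : phi 0 = 0.
  by apply: (addrI (phi 0)); rewrite -phiD !addr0.
have phiZ k x : phi (k *: x) = k *: phi x by rewrite -[k *: x]addr0 lphi phi0 addr0.
have phi_sum (f : 'I_n -> lquot a L) : phi (\sum_i f i) = \sum_i phi (f i).
  by apply: (big_morph phi phiD phi0).
have qZ (N : lmodType O) k (z : N) : k *: to_quot a z = to_quot a (k *: z).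
  exact: qscaleE.
have q_sum (N : lmodType O) (f : 'I_n -> N) : to_quot a (\sum_i f i) = \sum_i to_quot a (f i).
  have q0 : to_quot a (0 : N) = 0 by rewrite /to_quot raddf0.
  exact: (big_morph (@to_quot _ a N) (@to_quotD _ a N) q0).
apply/funext => x; rewrite [x]to_quot_surj hom_of_mxE.
set y := repr x; rewrite -{1}(coordK bP y) {1}/comb q_sum phi_sum.
have -> : to_quot a (comb c (coord bP y *m lmx (map_mx (red j) X))) = to_quot a (comb c (coord bP y *m X)).
  apply/(to_quot_comb cP).
  have /red_mx_eq[D hD] : map_mx (red j) (lmx (map_mx (red j) X)) = map_mx (red j) X.
    by rewrite red_lmx.
  by exists (coord bP y *m D); rewrite -mulmxBr hD scalemxAr.
have -> : comb c (coord bP y *m X) = \sum_i coord bP y 0 i *: comb c (r i).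
  rewrite {1}/comb; under eq_bigr => k _ do rewrite mxE scaler_suml.
  rewrite exchange_big /=; apply: eq_bigr => i _; rewrite /comb scaler_sumr.
  by apply: eq_bigr => k _; rewrite mxE scalerA.
rewrite q_sum; apply: eq_bigr => i _; rewrite -!qZ phiZ; congr (_ *: _).
by rewrite coordK -to_quot_surj.
Qed.

Lemma form_rows (X Y : 'M[O]_(n, m)) i k :
  piK * hl_form (comb c (row i X)) (comb c (row k Y)) =
  vval ((X *m G *m adj (@conjO p E) Y) i k).
Proof.
rewrite (form_comb _ _ hG); congr vval.
have -> : adj (@conjO p E) (row k Y) = col k (adj (@conjO p E) Y).
  by apply/matrixP => u w; rewrite !mxE.
rewrite -row_mul [LHS]mxE [RHS]mxE; apply: eq_bigr => l _.
by rewrite [row _ _ _ _]mxE [col _ _ _ _]mxE.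
Qed.

Lemma vge_form (x : K) : (x \in vge v (d.+1.*2%:Z - 1)) = (piK * x \in vge v j.+1%:Z).
Proof.
by rewrite -[in LHS]vge_piM subrK.
Qed.

Lemma hom_of_mx_Herm X : @Herm p E L M d.+1 (hom_of_mx X) <->
  X *m map_mx (red j) G *m adj (@conjq p E j) X = map_mx (red j) S.
Proof.
have eX : X *m map_mx (red j) G *m adj (@conjq p E j) X =
    map_mx (red j) (lmx X *m G *m adj (@conjO p E) (lmx X)).
  by rewrite !map_mxM adj_red red_lmx.
rewrite eX; split=> [[_ h]|h].
  apply/matrixP => i k; rewrite [LHS]mxE [RHS]mxE; apply/eqP.
  rewrite red_eq -form_rows hS -mulrBr -vge_form.
  by apply: h; rewrite hom_of_mxE coord_basis -rowE.
split; first exact: hom_of_mx_linear.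
move=> x y x' y'; rewrite -[x](coordK bP) -[y](coordK bP) -[x'](coordK cP) -[y'](coordK cP).
move: (coord bP x) (coord bP y) (coord cP x') (coord cP y') => u w u' w'.
rewrite !hom_of_mxE !combK => /(to_quot_comb cP)[e he] /(to_quot_comb cP)[f hf].
rewrite vge_form mulrBr (form_comb _ _ hG) (form_comb _ _ hS) -red_eq.
have he' : map_mx (red j) u' = map_mx (red j) (u *m lmx X).
  by apply/esym/red_mx_eq; exists e.
have hf' : map_mx (red j) w' = map_mx (red j) (w *m lmx X).
  by apply/esym/red_mx_eq; exists f.
suff : map_mx (red j) (u' *m G *m adj (@conjO p E) w') =
    map_mx (red j) (u *m S *m adj (@conjO p E) w).
  by move=> /matrixP/(_ 0 0); rewrite !mxE => ->.
rewrite !map_mxM !adj_red he' hf' -h !map_mxM adj_red !adjM -adj_red red_lmx !mulmxA.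
by rewrite adj_red red_lmx.
Qed.

Lemma card_Herm : #|` fset_set (@Herm p E L M d.+1)|%fset =
  nreps (@conjq p E j) (map_mx (red j) G) (map_mx (red j) S).
Proof.
rewrite /nreps; apply: (card_fset_image hom_of_mx_inj) => phi; split.
  move=> hphi; have [X e] := hom_of_mx_surj hphi.1.
  by exists X => //; rewrite inE; apply/eqP/hom_of_mx_Herm; rewrite -e.
by move=> [X]; rewrite inE => /eqP h ->; apply/hom_of_mx_Herm.
Qed.

End Count.

Lemma has_gram_card_Herm (L M : hermLattice E) n m d (S : 'M[O]_n) (G : 'M[O]_m) :
  has_gram L S -> has_gram M G ->
  #|` fset_set (@Herm p E L M d.+1)|%fset =
  nreps (@conjq p E d.*2.+1) (map_mx (red d.*2.+1) G) (map_mx (red d.*2.+1) S).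
Proof. by move=> [b [bP hS]] [c [cP hG]]; exact: (card_Herm d bP cP hS hG). Qed.

End Lattice.

(** * Gram matrices of the standard lattices *)
Section GramLattices.
Variables (p : nat) (E : ramQuadExt p).
Local Notation K := (F E).
Local Notation O := (OF E).
Local Notation v := (vF E).
Local Notation sg := (conjF E).
Local Notation piK := (piF E).

(** Isometries as bare maps, which are easy to compose and to add. *)
Definition lat_iso (L M : hermLattice E) : Prop :=
  exists f : L -> M, [/\ linear f, bijective f &
    forall x y, hl_form (f x) (f y) = hl_form x y].

Lemma isometric_lat_iso (L M : hermLattice E) : isometric L M -> lat_iso L M.
Proof.
move=> [f [bf hf]]; exists f; split=> // a x y.
by rewrite linearP.
Qed.

Lemma lat_iso_trans (L M N : hermLattice E) : lat_iso L M -> lat_iso M N -> lat_iso L N.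
Proof.
move=> [f [lf bf hf]] [g [lg bg hg]]; exists (g \o f); split.
- by move=> a x y /=; rewrite lf lg.
- exact: bij_comp.
by move=> x y /=; rewrite hg hf.
Qed.

Lemma linear_fun0 (A : comNzRingType) (U W : lmodType A) (f : U -> W) : linear f -> f 0 = 0.
Proof.
by move=> lf; apply: (addrI (f 0)); rewrite -[X in X + _]scale1r -lf scaler0 !addr0.
Qed.

Lemma linear_funZ (A : comNzRingType) (U W : lmodType A) (f : U -> W) : linear f ->
  forall a x, f (a *: x) = a *: f x.
Proof. by move=> lf a x; rewrite -[a *: x]addr0 lf linear_fun0 // addr0. Qed.

Lemma linear_fun_sum (A : comNzRingType) (U W : lmodType A) (f : U -> W) : linear f ->
  forall (I : Type) (r : seq I) (P : pred I) (g : I -> U),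
  f (\sum_(i <- r | P i) g i) = \sum_(i <- r | P i) f (g i).
Proof.
move=> lf I r P g; elim/big_rec2: _ => [|i x y _ <-]; first exact: linear_fun0.
by rewrite -[g i]scale1r lf !scale1r.
Qed.

Lemma has_gram_iso (L M : hermLattice E) n (G : 'M[O]_n) :
  lat_iso L M -> has_gram L G -> has_gram M G.
Proof.
move=> [f [lf [g fK gK] hf]] [b [bP hG]].
exists (map_tuple f b); split=> [y|i j]; last by rewrite !tnth_map hf.
have fc c : f (\sum_i c 0 i *: tnth b i) = \sum_i c 0 i *: tnth (map_tuple f b) i.
  rewrite linear_fun_sum //; apply: eq_bigr => i _; by rewrite tnth_map linear_funZ.
have [c [/= e u]] := bP (g y); exists c; split.
  by rewrite /= -fc -e gK.
by move=> c' e'; apply: u; rewrite e' -fc fK.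
Qed.

Lemma has_gram_iso' (L M : hermLattice E) n (G : 'M[O]_n) :
  lat_iso L M -> has_gram M G -> has_gram L G.
Proof.
move=> [f [lf [g fK gK] hf]]; apply: has_gram_iso; exists g; split.
- by move=> a x y; apply: (can_inj fK); rewrite lf !gK.
- by exists f.
by move=> x y; rewrite -hf !gK.
Qed.

Lemma lat_iso_oplusC (L M : hermLattice E) : lat_iso (oplus L M) (oplus M L).
Proof.
exists (fun x => (x.2, x.1)); split=> [a x y||x y]; first by [].
  by exists (fun x => (x.2, x.1)) => -[].
by rewrite /= /oplus_form addrC.
Qed.

Lemma lat_iso_oplusA (L M N : hermLattice E) :
  lat_iso (oplus (oplus L M) N) (oplus L (oplus M N)).
Proof.
exists (fun x => (x.1.1, (x.1.2, x.2))); split=> [a x y||x y]; first by [].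
  by exists (fun x => ((x.1, x.2.1), x.2.2)) => [[[]]|[? []]].
by rewrite /= /oplus_form /= /oplus_form /= addrA.
Qed.

Lemma lat_iso_oplus (L M L' M' : hermLattice E) :
  lat_iso L L' -> lat_iso M M' -> lat_iso (oplus L M) (oplus L' M').
Proof.
move=> [f [lf [g fK gK] hf]] [f' [lf' [g' fK' gK'] hf']].
exists (fun x => (f x.1, f' x.2)); split=> [a x y||x y].
- by rewrite /= lf lf'.
- by exists (fun x => (g x.1, g' x.2)) => -[x y]; rewrite /= ?fK ?fK' ?gK ?gK'.
by rewrite /= /oplus_form /= hf hf'.
Qed.

Lemma lat_iso_refl (L : hermLattice E) : lat_iso L L.
Proof. by exists id; split=> //; exists id. Qed.

Lemma has_gram_oplus (L M : hermLattice E) n m (G : 'M[O]_n) (G' : 'M[O]_m) :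
  has_gram L G -> has_gram M G' -> has_gram (oplus L M) (block_mx G 0 0 G').
Proof.
move=> [b [bP hG]] [c [cP hG']].
pose bc : (n + m).-tuple (oplus L M) :=
  cat_tuple (map_tuple (fun x => (x, 0 : M)) b) (map_tuple (fun y => (0 : L, y)) c).
have bcl i : tnth bc (lshift m i) = (tnth b i, 0) by rewrite tnth_lshift tnth_map.
have bcr i : tnth bc (rshift n i) = (0, tnth c i) by rewrite tnth_rshift tnth_map.
have sum_bc (d : 'rV[O]_(n + m)) : \sum_k d 0 k *: tnth bc k =
    (\sum_k (lsubmx d) 0 k *: tnth b k, \sum_k (rsubmx d) 0 k *: tnth c k).
  rewrite big_split_ord /=.
  under eq_bigr => i _ do rewrite bcl.
  under [X in _ + X = _]eq_bigr => i _ do rewrite bcr.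
  have fstE (I : finType) (f : I -> L * M) : (\sum_i f i).1 = \sum_i (f i).1.
    exact: (big_morph (fun x : L * M => x.1)).
  have sndE (I : finType) (f : I -> L * M) : (\sum_i f i).2 = \sum_i (f i).2.
    exact: (big_morph (fun x : L * M => x.2)).
  rewrite [LHS]surjective_pairing; congr pair.
    rewrite [LHS]/= fstE fstE /= [X in _ + X]big1 ?addr0 => [|i _].
      by apply: eq_bigr => i _; rewrite mxE.
    by rewrite scaler0.
  rewrite [LHS]/= sndE sndE /= [X in X + _]big1 ?add0r => [|i _].
    by apply: eq_bigr => i _; rewrite mxE.
  by rewrite scaler0.
exists bc; split=> [[x y]|i j].
  have [d [dx du]] := bP x; have [e [ey eu]] := cP y.
  exists (row_mx d e); split.
    by rewrite sum_bc row_mxKl row_mxKr -dx -ey.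
  by move=> f; rewrite sum_bc => -[/du -> /eu ->]; apply: hsubmxK.
rewrite -[i]fintype.splitK -[j]fintype.splitK; case: (fintype.split i) => k; case: (fintype.split j) => l; rewrite /= /oplus_form.
- by rewrite !bcl block_mxEul /= hl_form0l addr0.
- by rewrite bcl bcr block_mxEur /= mxE hl_form0l [X in X + _]hl_formC hl_form0l rmorph0 addr0 mulr0.
- by rewrite bcl bcr block_mxEdl /= mxE hl_form0l hl_formC hl_form0l rmorph0 addr0 mulr0.
by rewrite !bcr block_mxEdr /= hl_form0l add0r.
Qed.

Lemma has_gram_lattice n (A : hermitian_matrix n false (conjF E))
    (uA : (A : 'M[K]_n) \in unitmx) (G : 'M[O]_n) :
  (forall i j, vval (G i j) = piK * A i j) -> has_gram (gram_lattice uA) G.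
Proof.
move=> hG; exists [tuple delta_mx 0 i | i < n]; split=> [x|i j].
  exists x; split.
    by rewrite [LHS]row_sum_delta; apply: eq_bigr => i _; rewrite tnth_mktuple.
  move=> c ->; rewrite [RHS]row_sum_delta.
  by apply: eq_bigr => i _; rewrite tnth_mktuple.
rewrite hG; congr (_ * _); rewrite !tnth_mktuple /= /form_of_matrix /gram_emb.
have eD k : map_mx (@vval _ _) (delta_mx 0 k : 'rV[O]_n) = delta_mx 0 k :> 'rV[K]_n.
  by apply/rowP => l; rewrite !mxE; case: (_ && _).
by rewrite !eD trmx_delta map_delta_mx -rowE -colE trace_mx11 !mxE.
Qed.

Lemma has_gram_I1 (eps : F0 E) (u : eps != 0 /\ v0 E eps = 0) (a : O) :
  vval a = piK * eps%:A -> has_gram (I1 u) (a%:M : 'M[O]_1).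
Proof.
move=> ha; apply: has_gram_lattice => i j; rewrite !ord1 !mxE /= !mulr1n.
exact: ha.
Qed.

Lemma has_gram_H : has_gram (latticeH E) (Jmx O).
Proof.
suff h (i j : 'I_(1 + 1)) : vval (Jmx O i j) = piK * H_mx E i j.
  by apply: has_gram_lattice => i j; apply: h.
rewrite [H_mx E i j]mxE.
rewrite -[i]fintype.splitK -[j]fintype.splitK; case: (fintype.split i) => k; case: (fintype.split j) => l; rewrite !ord1 /Jmx /=.
- by rewrite block_mxEul mxE /= ?eqxx mulr0.
- by rewrite block_mxEur mxE /= mulfV ?piF_neq0.
- by rewrite block_mxEdl !mxE /= mulrN mulfV ?piF_neq0.
by rewrite block_mxEdr mxE /= ?eqxx mulr0.
Qed.

Lemma has_gram_0 : has_gram (lattice0 E) (0 : 'M[O]_0).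
Proof. by apply: has_gram_lattice => -[]. Qed.

Lemma has_gram_cast (L : hermLattice E) n m (e : n = m) (G : 'M[O]_n) (G' : 'M[O]_m) :
  G' = castmx (e, e) G -> has_gram L G -> has_gram L G'.
Proof. by case: m / e G' => G' ->; rewrite castmx_id. Qed.

Lemma has_gram_oplus_Hpow (L : hermLattice E) k m (G : 'M[O]_m) :
  has_gram L G -> has_gram (oplus (Hpow E k) L) (Hs k G).
Proof.
move=> hL; elim: k => [|k IH].
  have := has_gram_oplus has_gram_0 hL.
  apply: (has_gram_cast (e := erefl m)).
  rewrite castmx_id; have e (i : 'I_m) : i = rshift 0 i by apply: val_inj.
  apply/matrixP => i j.
  transitivity (block_mx (0 : 'M[O]_0) 0 0 G (rshift 0 i) (rshift 0 j)).
    by rewrite block_mxEdr.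
  by rewrite -!e.
apply: has_gram_iso'; first exact: lat_iso_oplusA.
exact: has_gram_oplus has_gram_H IH.
Qed.

Lemma has_gram_Hpow k : has_gram (Hpow E k) (Hs k (0 : 'M[O]_0)).
Proof.
elim: k => [|k IH]; first exact: has_gram_0.
exact: has_gram_oplus has_gram_H IH.
Qed.

Lemma has_gram_Hpow2 a k : has_gram (oplus (Hpow E a) (Hpow E k)) (Hs (a + k) (0 : 'M[O]_0)).
Proof.
elim: a => [|a IH]; first exact: (has_gram_oplus_Hpow 0 (has_gram_Hpow k)).
apply: has_gram_iso'; first exact: lat_iso_oplusA.
exact: has_gram_oplus has_gram_H IH.
Qed.

Lemma has_gram_integral (L : hermLattice E) n (G : 'M[O]_n) :
  has_gram L G -> integral_lattice L.
Proof.
move=> [b [bP hG]] x y; rewrite -[x](coordK bP) -[y](coordK bP).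
by rewrite -[-1]add0r -vge_piM -addrA addNr (form_comb _ _ hG); apply: vvalP.
Qed.

Lemma has_gram_skew (L : hermLattice E) n (G : 'M[O]_n) :
  has_gram L G -> adj (@conjO p E) G = - G.
Proof.
move=> [b [bP hG]]; apply/matrixP => i j; rewrite !mxE; apply: vval_inj.
by rewrite vval_conjO vvalN !hG rmorphM /= piF_conj -hl_formC mulNr.
Qed.

End GramLattices.

Section GramUnit.
Variables (p : nat) (E : ramQuadExt p).
Local Notation K := (F E).
Local Notation O := (OF E).
Local Notation v := (vF E).
Local Notation sg := (conjF E).
Local Notation piK := (piF E).

(** The Gram matrix is invertible over F: a row vector in its kernel gives a vector
    orthogonal to a basis of the nondegenerate space. *)
Lemma integral_gram (L : hermLattice E) n (V : hermSpace E) (i : L -> V) :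
  integral_lattice L -> is_extension n (@hl_form p E L) i ->
  exists (b : n.-tuple L) (G : 'M[O]_n),
  [/\ free_basis b, basis_of fullv (map_tuple i b),
      forall k l, vval (G k l) = piK * hl_form (tnth b k) (tnth b l) &
      map_mx (@toK p E) G \in unitmx].
Proof.
move=> intL [ilin iform [b bP ib]].
have hG k l : piK * hl_form (tnth b k) (tnth b l) \in vring v.
  have := vge_piM (-1) (hl_form (tnth b k) (tnth b l)); rewrite addNr => e.
  by have := intL (tnth b k) (tnth b l); rewrite -e.
exists b, (\matrix_(k, l) VInt (hG k l)); split=> // [k l|]; first by rewrite mxE.
rewrite -row_free_unit -kermx_eq0; apply/rowV0P => u /sub_kermxP uG0.
pose w : V := \sum_k u 0 k *: i (tnth b k).
have wb l : hs_form V w (i (tnth b l)) = 0.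
  rewrite /w linear_sumlz /=; apply: (mulfI (piF_neq0 E)); rewrite mulr0 mulr_sumr.
  have /matrixP/(_ 0 l) := uG0; rewrite !mxE => e; rewrite -[RHS]e; apply: eq_bigr => k _.
  by rewrite linearZl_LR /= iform !mxE mulrCA.
have w0 : w = 0.
  apply/eqP; rewrite -memv0 -(eqP (hs_nondeg V)); apply/mem_orthovP => y _.
  have : y \in <<map_tuple i b>>%VS by rewrite (span_basis ib) memvf.
  move=> /coord_span ->; rewrite linear_sumr big1 // => l _.
  rewrite linearZr_LR -tnth_nth tnth_map /= wb mulr0 //.
have /freeP fr := basis_free ib.
apply/rowP => k; rewrite mxE; apply: (fr (fun k => u 0 k)).
rewrite -[RHS]w0 /w; apply: eq_bigr => l _.
by rewrite -tnth_nth tnth_map.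
Qed.

(** The rank is well defined, by comparison of the base change matrices over F. *)
Lemma free_basis_le (L : lmodType O) n n' (b : n.-tuple L) (b' : n'.-tuple L) :
  (forall x : L, exists! c : 'rV[O]_n, x = \sum_i c 0 i *: tnth b i) ->
  (forall x : L, exists! c : 'rV[O]_n', x = \sum_i c 0 i *: tnth b' i) -> (n' <= n)%N.
Proof.
move=> bP bP'.
pose A : 'M[O]_(n', n) := \matrix_(i, k) (projT1 (cid (bP (tnth b' i)))) 0 k.
pose B : 'M[O]_(n, n') := \matrix_(i, k) (projT1 (cid (bP' (tnth b i)))) 0 k.
have hA i : tnth b' i = \sum_k A i k *: tnth b k.
  rewrite {1}(_ : tnth b' i = \sum_k (projT1 (cid (bP (tnth b' i)))) 0 k *: tnth b k).
    by apply: eq_bigr => k _; rewrite mxE.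
  by case: cid => c [].
have hB i : tnth b i = \sum_k B i k *: tnth b' k.
  rewrite {1}(_ : tnth b i = \sum_k (projT1 (cid (bP' (tnth b i)))) 0 k *: tnth b' k).
    by apply: eq_bigr => k _; rewrite mxE.
  by case: cid => c [].
have AB : A *m B = 1%:M.
  apply/row_matrixP => i.
  have [c [/= _ u]] := bP' (tnth b' i).
  rewrite -(u (row i 1%:M)); last first.
    rewrite (bigD1 i) //= !mxE eqxx scale1r big1 ?addr0 // => k ki.
    by rewrite !mxE eq_sym (negPf ki) scale0r.
  apply/esym/u; rewrite [LHS]hA.
  transitivity (\sum_k \sum_l A i k *: (B k l *: tnth b' l)).
    by apply: eq_bigr => k _; rewrite -scaler_sumr -hB.
  rewrite exchange_big /=; apply: eq_bigr => l _; rewrite !mxE scaler_suml.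
  by apply: eq_bigr => k _; rewrite scalerA.
have /mulmx1_min : map_mx (@toK p E) A *m map_mx (@toK p E) B = 1%:M.
  by rewrite -map_mxM AB map_mx1.
by [].
Qed.

Lemma free_basis_rk (L : hermLattice E) n (G : 'M[O]_n) : has_gram L G -> rk L = n.
Proof.
move=> [b [bP _]]; have [V [i [_ _ [b' bP' _]]]] := hl_ext L.
by apply/eqP; rewrite eqn_leq (free_basis_le bP bP') (free_basis_le bP' bP).
Qed.

Lemma integral_has_gram (L : hermLattice E) : integral_lattice L ->
  exists2 G : 'M[O]_(rk L), has_gram L G & map_mx (@toK p E) G \in unitmx.
Proof.
move=> intL; have [V [i ext]] := hl_ext L.
have [b [G [bP _ hG uG]]] := integral_gram intL ext.
by exists G => //; exists b.
Qed.

Lemma vge_ex (x : K) : exists c : nat, forall k, (c <= k)%N -> piK ^+ k * x \in vge v 0.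
Proof.
exists `|v x|%N => k le; have [->|x0] := eqVneq x 0; first by rewrite mulr0 vge0.
rewrite vge_neq0 ?mulf_neq0 ?expf_neq0 ?piF_neq0 // vfunM ?expf_neq0 ?piF_neq0 //.
rewrite vfunX ?piF_neq0 // piF_uniformizer.
by lia.
Qed.

Lemma mx_denominator m n (A : 'M[K]_(m, n)) :
  exists c : nat, forall k, (c <= k)%N -> forall i j, piK ^+ k * A i j \in vge v 0.
Proof.
pose c i j := projT1 (cid (vge_ex (A i j))).
exists (\max_i \max_j c i j)%N => k le i j.
apply: (projT2 (cid (vge_ex (A i j)))); apply: leq_trans le.
by apply: leq_trans (leq_bigmax i); apply: (leq_bigmax (F := c i)).
Qed.

(** An inverse over F after clearing denominators by an even power of pi, which is
    real. *)
Lemma quasi_inverse n (G : 'M[O]_n) : map_mx (@toK p E) G \in unitmx ->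
  exists (c : nat) (G' : 'M[O]_n), G' *m G = (piO E ^+ c.*2)%:M.
Proof.
move=> uG; have [c hc] := mx_denominator (invmx (map_mx (@toK p E) G)).
have le : (c <= c.*2)%N by rewrite -addnn leq_addr.
exists c, (\matrix_(i, j) VInt (hc _ le i j)).
have inj : injective (map_mx (@toK p E) : 'M[O]_n -> 'M[K]_n).
  move=> A B e; apply/matrixP => i j; apply: vval_inj.
  by move/matrixP/(_ i j): e; rewrite !mxE.
apply: inj; rewrite map_mxM map_scalar_mx.
have -> : map_mx (@toK p E) (\matrix_(i, j) VInt (hc _ le i j)) =
   piK ^+ c.*2 *: invmx (map_mx (@toK p E) G).
  by apply/matrixP => i j; rewrite !mxE.
rewrite -scalemxAl mulVmx // scalemx1; congr (_%:M).
by rewrite rmorphXn.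
Qed.

End GramUnit.

(** * The normalised counts are eventually constant *)
Section Stability.
Variables (p : nat) (E : ramQuadExt p).
Hypotheses (p_prime : prime p) (p_odd : odd p).
Local Notation K := (F E).
Local Notation O := (OF E).
Local Notation v := (vF E).
Local Notation sg := (conjF E).
Local Notation piK := (piF E).
Local Notation q := (resq E).
Local Notation h2 := (halfO E p_prime p_odd).

Section Step.
Variable d : nat.
Local Notation j := (d.*2.+1).
Local Notation R0 := (Rq E j).
Local Notation R1 := (Rq E j.+2).
Local Notation s0 := (@conjq p E j).
Local Notation s1 := (@conjq p E j.+2).

Definition trunc (x : R1) : R0 := red j (lift x).

Lemma trunc_red x : trunc (red j.+2 x) = red j x.
Proof. by apply/eqP; rewrite red_eq; apply: vge_le (lift_red _ _); lia. Qed.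

Fact trunc_is_additive : zmod_morphism trunc.
Proof. by move=> x y; rewrite -[x]liftK -[y]liftK -rmorphB !trunc_red rmorphB. Qed.
Fact trunc_is_multiplicative : monoid_morphism trunc.
Proof.
split; first by rewrite -(rmorph1 (red j.+2)) trunc_red rmorph1.
by move=> x y; rewrite -[x]liftK -[y]liftK -rmorphM !trunc_red rmorphM.
Qed.
HB.instance Definition _ := GRing.isZmodMorphism.Build R1 R0 trunc trunc_is_additive.
HB.instance Definition _ := GRing.isMonoidMorphism.Build R1 R0 trunc trunc_is_multiplicative.

Lemma trunc_conj x : trunc (s1 x) = s0 (trunc x).
Proof. by rewrite -[x]liftK conjq_red !trunc_red conjq_red. Qed.

Lemma trunc_surj (y : R0) : exists x, trunc x = y.
Proof. by exists (red j.+2 (lift y)); rewrite trunc_red liftK. Qed.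

Lemma card_trunc_ker : #|[set x : R1 | trunc x == 0]| = (q ^ 2)%N.
Proof.
have := card_hom (U := R1) (V := R0) (f := trunc) (P := xpredT) (Q := xpredT).
move=> /(_ (conj isT (fun _ _ _ _ => isT)) (fun _ _ => isT)).
rewrite !cardsT !card_Rq => h; have {}h := h (fun y _ => let: ex_intro x e := trunc_surj y in ex_intro2 _ _ x isT e).
have e : (q ^ j.+3 = q ^ j.+1 * q ^ 2)%N by rewrite -expnD addn2.
move/eqP: h; rewrite e.
by rewrite eqn_pmul2l ?expn_gt0 ?(ltnW (resq_gt1 E)) // => /eqP <-.
Qed.

Lemma card_trunc_ker_skew : #|[set x : R1 | (trunc x == 0) && (s1 x == - x)]| = q.
Proof.
have := card_hom (U := R1) (V := R0) (f := trunc) (P := fun x => s1 x == - x)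
  (Q := fun x => s0 x == - x).
rewrite -/(cminus s1) -/(cminus s0) (cminusE E p_prime p_odd d.+1) (cminusE E p_prime p_odd d).
move=> h; have {}h : (q ^ d.+2 = q ^ d.+1 * #|[set x : R1 | (s1 x == - x) && (trunc x == 0%R)]|)%N.
  apply: h.
  - split; first by rewrite unfold_in rmorph0 oppr0.
    by move=> x y; rewrite !unfold_in rmorphB /= => /eqP -> /eqP ->; rewrite opprB opprK addrC.
  - by move=> x /eqP e; rewrite -trunc_conj e rmorphN.
  move=> y /eqP ey; have [x ex] := trunc_surj y.
  exists ((red j.+2 h2 : R1) * (x - s1 x)).
    by rewrite rmorphM rmorphB /= conjqK (s_h2 s1 (red_halfP E p_prime p_odd _)) -mulrN opprB.
  rewrite /= rmorphM rmorphB /= trunc_conj ex ey opprK trunc_red mulrDr.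
  exact: (half_sum (red_halfP E p_prime p_odd _)).
have e : #|[set x : R1 | (trunc x == 0) && (s1 x == - x)]| = #|[set x : R1 | (s1 x == - x) && (trunc x == 0)]|.
  by apply: eq_card => x; rewrite !inE andbC.
rewrite e; move: h; rewrite expnSr => /eqP.
by rewrite eqn_pmul2l ?expn_gt0 ?(ltnW (resq_gt1 E)) // => /eqP <-.
Qed.

Variables (n m c : nat) (G : 'M[O]_m) (S S' : 'M[O]_n).
Hypothesis skG : adj (@conjO p E) G = - G.
Hypothesis skS : adj (@conjO p E) S = - S.
Hypothesis S'S : S' *m S = (piO E ^+ c.*2)%:M.
Hypothesis c_le : (c.*2 <= d)%N.

Local Notation G1 := (map_mx (red j.+2) G).
Local Notation T1 := (map_mx (red j.+2) S).
Local Notation "A ^*" := (adj s1 A) : ring_scope.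

Lemma red_pi_eq0 k : (j.+3 <= k)%N -> red j.+2 (piO E) ^+ k = 0.
Proof.
move=> le; apply/eqP; rewrite -rmorphXn red_eq0; apply: (vge_le (n := k%:Z)); first by lia.
by apply/divides_pi; exists 1; rewrite mulr1.
Qed.

Lemma trunc_ker_div (D : 'M[R1]_n) : map_mx trunc D = 0 ->
  exists D', D = red j.+2 (piO E) ^+ j.+1 *: D'.
Proof.
move=> D0; have [D' hD] : exists D', map_mx (@lift p E j.+2) D - 0 = piO E ^+ j.+1 *: D'.
  by apply/red_mx_eq; rewrite map_mx0 -D0; apply/matrixP => i k; rewrite !mxE.
exists (map_mx (red j.+2) D'); rewrite -rmorphXn -map_mxZ -hD subr0.
by apply/matrixP => i k; rewrite !mxE /= liftK.
Qed.

(** With x = D S^{-1}/2, the matrix g = 1 + x satisfies g S g^* = S + D, because D is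
    so divisible by pi that x D^* and x^2 vanish at this level. *)
Lemma nreps_perturb (D : 'M[R1]_n) : map_mx trunc D = 0 -> D^* = - D ->
  nreps s1 G1 (T1 + D) = nreps s1 G1 T1.
Proof.
move=> D0 skD; have [D' eD] := trunc_ker_div D0.
set w := red j.+2 (piO E) in eD; pose h := red j.+2 h2.
have hP : h + h = 1 by apply: red_halfP.
have sw2 : s1 (w ^+ 2) = w ^+ 2 by rewrite rmorphXn /= conj_pi sqrrN.
(* D is divisible by pi^{j+1} and S' is pi^{2c} times the inverse of S, so that D S^{-1}
   is divisible by pi^e. *)
pose e := (j.+1 - c.*2)%N; have ec : (e = (d.+1 - c) * 2)%N by rewrite /e; lia.
have swe : s1 (w ^+ e) = w ^+ e by rewrite ec mulnC exprM rmorphXn /= sw2.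
pose Y := D' *m map_mx (red j.+2) S'.
pose x := (h * w ^+ e) *: Y.
have xT : x *m T1 = h *: D.
  rewrite /x /Y -scalemxAl -mulmxA -map_mxM S'S map_scalar_mx rmorphXn /= -/w.
  rewrite mul_mx_scalar scalerA -mulrA -exprD subnK; last by lia.
  by rewrite eD scalerA.
have skT : T1^* = - T1 by rewrite -adj_red skS map_mxN.
have sh : s1 h = h by apply: s_h2.
have Tx : T1 *m x^* = h *: D.
  have /(congr1 (@adj _ s1 _ _)) := xT.
  by rewrite (adjM s1 x) (adjZ s1 h D) skT skD /= sh mulNmx scalerN => /oppr_inj.
have xx : x *m x = 0.
  rewrite /x -scalemxAl -scalemxAr scalerA mulrACA -exprD red_pi_eq0 ?mulr0 ?scale0r //.
  by rewrite ec; lia.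
have Dx : D *m x^* = 0.
  rewrite eD /x adjZ rmorphM /= sh swe -scalemxAl -scalemxAr scalerA mulrCA -exprD.
  rewrite red_pi_eq0 ?mulr0 ?scale0r //.
  by rewrite ec; lia.
have g1 : (1%:M + x) *m (1%:M - x) = 1%:M.
  by rewrite mulmxBr mulmx1 mulmxDl mul1mx xx addr0 addrK.
rewrite -(nreps_congr s1 G1 T1 g1); congr nreps.
rewrite mulmxDl mul1mx xT adjD adj1 mulmxDr mulmx1 mulmxDl Tx -scalemxAl Dx scaler0 addr0.
by rewrite -addrA halfD.
Qed.

Lemma card_perturb :
  #|[set D : 'M[R1]_n | (map_mx trunc D == 0) && (D^* == - D)]| = (q ^ (n * n))%N.
Proof.
rewrite -(card_skew (@conjqK p E _) n _ card_trunc_ker card_trunc_ker_skew); last first.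
  by move=> x /eqP e; rewrite rmorphN /= trunc_conj e rmorph0 oppr0.
apply: eq_card => D; rewrite !inE; congr (_ && _).
apply/eqP/forallP => [D0 i|h].
  by apply/forallP => k; apply/eqP; move/matrixP/(_ i k): D0; rewrite !mxE.
by apply/matrixP => i k; rewrite !mxE; apply/eqP/(forallP (h i)).
Qed.

(** Count the matrices at the higher level whose Gram matrix is congruent to S at
    the lower one.  Sorted by their Gram matrix, each of the q^{n^2} skew
    perturbations of S occurs equally often; sorted by their reduction, each
    representation at the lower level has q^{2nm} lifts. *)
Lemma nreps_step :
  (nreps s1 G1 T1 * q ^ (n * n) =
   nreps s0 (map_mx (red j) G) (map_mx (red j) S) * q ^ (2 * (n * m)))%N.
Proof.
have tr_form (X : 'M[R1]_(n, m)) : map_mx trunc (X *m G1 *m X^*) =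
    map_mx trunc X *m map_mx (red j) G *m adj s0 (map_mx trunc X).
  rewrite !map_mxM; congr (_ *m _ *m _).
    by apply/matrixP => i k; rewrite !mxE /= trunc_red.
  by apply/matrixP => i k; rewrite !mxE /= trunc_conj.
have trT : map_mx trunc T1 = map_mx (red j) S.
  by apply/matrixP => i k; rewrite !mxE /= trunc_red.
transitivity #|[set X : 'M[R1]_(n, m) | map_mx trunc (X *m G1 *m X^*) == map_mx (red j) S]|.
  rewrite -card_perturb mulnC -[RHS]sum1dep_card.
  rewrite (partition_big (fun X => X *m G1 *m X^* - T1)
    (fun D => (map_mx trunc D == 0) && (D^* == - D))) /=; last first.
    move=> X /eqP hX; rewrite map_mxB hX trT subrr eqxx /=.
    rewrite adjB -adj_red skS map_mxN !adjM (adjK (@conjqK p E _)) -adj_red skG map_mxN.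
    by rewrite mulNmx mulmxN mulmxA opprB opprK addrC.
  rewrite (eq_bigr (fun _ => nreps s1 G1 T1)) ?sum_const_set // => D /andP[/eqP D0 /eqP skD].
  rewrite sum1dep_card -(nreps_perturb D0 skD) /nreps; apply: eq_card => X; rewrite !inE.
  apply/andP/eqP => [[_ /eqP <-]|->]; first by rewrite addrC subrK.
  by rewrite map_mxD D0 trT addr0 eqxx addrAC subrr add0r eqxx.
pose f : 'M[R1]_(n, m) -> 'M[R0]_(n, m) := map_mx trunc.
rewrite -sum1dep_card (partition_big f
  (fun X => X *m map_mx (red j) G *m adj s0 X == map_mx (red j) S)) /=; last first.
  by move=> X; rewrite tr_form.
rewrite (eq_bigr (fun _ => (q ^ (2 * (n * m)))%N)) ?sum_const_set // => X0 /eqP hX0.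
pose X1 := map_mx (fun y => red j.+2 (lift y)) X0.
have fX1 : f X1 = X0 by apply/matrixP => i k; rewrite !mxE /= trunc_red liftK.
rewrite sum1dep_card (@card_bij _ _ _ (fun D => f D == 0) (fun X => X - X1) (fun D => D + X1)).
- have -> : [set D | f D == 0] = [set D : 'M[R1]_(n, m) | D \in [set map_mx val g | g : 'M[{x : R1 | trunc x == 0}]_(n, m)]].
    apply/setP => D; rewrite !inE; apply/eqP/imsetP => [D0|[g _ ->]].
      have hD i k : trunc (D i k) == 0 by move/matrixP/(_ i k): D0; rewrite !mxE => ->.
      exists (\matrix_(i, k) exist (fun x => trunc x == 0) (D i k) (hD i k)) => //.
      by apply/matrixP => i k; rewrite !mxE.
    by apply/matrixP => i k; rewrite !mxE; apply/eqP/(valP (g i k)).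
  rewrite cardsE card_imset; last first.
    move=> g g' e; apply/matrixP => i k; apply: val_inj.
    by move/matrixP/(_ i k): e; rewrite !mxE.
  rewrite card_mx card_sig [RHS]expnM -card_trunc_ker; congr (_ ^ _)%N.
  by apply: eq_card => x; rewrite !inE.
- move=> X /andP[_ /eqP fX]; rewrite subrK /f map_mxB -/(f X) -/(f X1) fX fX1 subrr eqxx.
  by [].
move=> D /eqP fD; rewrite addrK tr_form -/(f _) (_ : f (D + X1) = X0) ?hX0 ?eqxx //.
by rewrite /f map_mxD -/(f D) -/(f X1) fD fX1 add0r.
Qed.

End Step.
End Stability.

(** * Completeness of F and self-adjoint square roots *)
Section Complete.

Definition cauchy (K : fieldType) (v : valuation K) (u : nat -> K) : Prop :=
  forall m : int, exists N : nat, forall i j, (N <= i)%N -> (N <= j)%N ->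
    u i - u j \in vge v m.

Definition tends (K : fieldType) (v : valuation K) (u : nat -> K) (l : K) : Prop :=
  forall m : int, exists N : nat, forall i, (N <= i)%N -> u i - l \in vge v m.

Definition complete (K : fieldType) (v : valuation K) : Prop :=
  forall u, cauchy v u -> exists l, tends v u l.

(** Induction on a spanning list.  A vector x outside a complete subspace keeps a
    positive distance from it; hence, along a Cauchy sequence in the sum, the
    coefficients of x are Cauchy, and so are the components in the subspace. *)
Lemma complete_ext (K : fieldType) (L : fieldExtType K) (v : valuation K)
    (w : valuation L) (e : nat) :
  (0 < e)%N -> has_ramification_index v w e -> complete v -> complete w.
Proof.
move=> e0 ram cv.
have walg (c : K) : c != 0 -> w c%:A = v c *+ e by apply: ram.
have alg0 (c : K) : c != 0 -> c%:A != 0 :> L by move=> c0; rewrite scaler_eq0 oner_eq0 orbF.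
suff main (X : seq L) : forall u, (forall i, u i \in <<X>>%VS) -> cauchy w u ->
    exists2 l, l \in <<X>>%VS & tends w u l.
  move=> u cu; have [i|l _ ul] := main (vbasis {:L}) u _ cu; last by exists l.
  by rewrite (span_basis (vbasisP _)) memvf.
elim: X => [|x X IH] u uX cu.
  exists 0; first exact: mem0v.
  move=> m; exists 0%N => i _; have := uX i; rewrite span_nil memv0 => /eqP ->.
  by rewrite subrr vge0.
have [xX|xX] := boolP (x \in <<X>>%VS).
  have XX : (<<x :: X>> = <<X>>)%VS by rewrite span_cons; apply/addv_idPr.
  by rewrite XX; apply: IH => // i; rewrite -XX.
(* [x] is at positive distance from the complete subspace <<X>> *)
have [C hC] : exists C : int, forall y, y \in <<X>>%VS -> x + y \notin vge w C.
  apply: contrapT => nC.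
  have {}nC (n : nat) : exists y, y \in <<X>>%VS /\ x + y \in vge w n%:Z.
    apply: contrapT => h; apply: nC; exists n%:Z => y yX; apply/negP => hy.
    by apply: h; exists y.
  pose y n := projT1 (cid (nC n)).
  have yX n : y n \in <<X>>%VS by have [] := projT2 (cid (nC n)).
  have xy n : x + y n \in vge w n%:Z by have [] := projT2 (cid (nC n)).
  have [|l lX yl] := IH y yX.
    move=> m; exists `|m|%N => i j hi hj.
    have -> : y i - y j = (x + y i) - (x + y j) by ring.
    apply: vgeB; [apply: vge_le (xy i)|apply: vge_le (xy j)]; lia.
  have : x + l = 0.
    apply: (@vge_all0 _ w) => n; have [N hN] := yl n%:Z.
    have -> : x + l = (x + y (maxn N n)) - (y (maxn N n) - l) by ring.
    apply: vgeB; last by apply: hN; rewrite leq_maxl.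
    by apply: vge_le (xy _); have := leq_maxr N n; lia.
  move/eqP; rewrite addr_eq0 => /eqP xl.
  by case/negP: xX; rewrite xl rpredN.
have coef (c : K) (y : L) (k : int) : y \in <<X>>%VS ->
    c *: x + y \in vge w (k *+ e + C) -> c \in vge v k.
  have [->|c0] := eqVneq c 0; first by rewrite vge0.
  move=> yX; have -> : c *: x + y = c%:A * (x + c^-1 *: y).
    by rewrite mulr_algl scalerDr scalerA mulfV // scale1r.
  have := hC (c^-1 *: y) (memvZ _ yX); set z := x + _ => hz.
  have z0 : z != 0 by apply: contraNneq hz => ->; rewrite vge0.
  move: hz; rewrite !vge_neq0 ?mulf_neq0 ?alg0 // vfunM ?alg0 // walg // -ltNge => hz h.
  move: h hz; move: (v c) (w z) => a b h hz; rewrite leNgt; apply/negP => ak.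
  have : a *+ e + b < k *+ e + C by apply: ltr_leD => //; rewrite ?ltrMn2r ?e0 ?ltW.
  by rewrite ltNge h.
have dec i : exists cy : K * L, cy.2 \in <<X>>%VS /\ u i = cy.1 *: x + cy.2.
  have := uX i; rewrite span_cons => /memv_addP[_ /vlineP[c ->] [y yX ->]].
  by exists (c, y).
pose c i := (projT1 (cid (dec i))).1; pose y i := (projT1 (cid (dec i))).2.
have yX i : y i \in <<X>>%VS by have [] := projT2 (cid (dec i)).
have ucy i : u i = c i *: x + y i by have [] := projT2 (cid (dec i)).
have cc : cauchy v c.
  move=> k; have [N hN] := cu (k *+ e + C); exists N => i j hi hj.
  apply: (coef _ (y i - y j)); first by rewrite rpredB.
  by rewrite scalerBl addrACA -opprD -!ucy; apply: hN.
have [c' hc'] := cv c cc.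
have scal (a : nat -> K) : tends v a 0 -> tends w (fun i => a i *: x) 0.
  move=> ha m; have [x0|x0] := eqVneq x 0.
    by exists 0%N => i _; rewrite x0 scaler0 subr0 vge0.
  have [N hN] := ha (`|m| + `|w x|); exists N => i hi; rewrite subr0.
  have := hN i hi; rewrite subr0; have [->|a0] := eqVneq (a i) 0.
    by rewrite scale0r !vge0.
  rewrite -mulr_algl !vge_neq0 ?mulf_neq0 ?alg0 // vfunM ?alg0 // walg // => h.
  have : v (a i) *+ 1 <= v (a i) *+ e.
    rewrite ler_wpMn2l //; apply: le_trans h; lia.
  by rewrite mulr1n => h'; lia.
have tc : tends v (fun i => c i - c') 0.
  by move=> m; have [N hN] := hc' m; exists N => i hi; rewrite subr0; apply: hN.
have tcx := scal _ tc.
have cy : cauchy w y.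
  move=> m; have [N hN] := cu m; have [N' hN'] := tcx m.
  exists (maxn N N') => i j; rewrite !geq_max => /andP[i1 i2] /andP[j1 j2].
  have -> : y i - y j = (u i - u j) - (((c i - c') *: x - 0) - ((c j - c') *: x - 0)).
    by rewrite !ucy !subr0 -scalerBl opprB addrA subrK scalerBl; ring.
  by apply: vgeB; [apply: hN|apply: vgeB; apply: hN'].
have [l lX hl] := IH y yX cy.
exists (c' *: x + l).
  by rewrite span_cons memv_add // memvZ // memv_line.
move=> m; have [N hN] := hl m; have [N' hN'] := tcx m.
exists (maxn N N') => i; rewrite geq_max => /andP[i1 i2].
have -> : u i - (c' *: x + l) = ((c i - c') *: x - 0) + (y i - l).
  by rewrite ucy subr0 scalerBl opprD addrACA.
by apply: vgeD; [apply: hN'|apply: hN].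
Qed.

End Complete.

Section SquareRoot.
Variables (p : nat) (E : ramQuadExt p).
Hypotheses (p_prime : prime p) (p_odd : odd p).
Local Notation K := (F E).
Local Notation O := (OF E).
Local Notation v := (vF E).
Local Notation sg := (conjF E).

Lemma complete_F : complete v.
Proof.
apply: (complete_ext (e := 2) _ (@F_ramified p E)) => //.
have [e e0 ram] := v0_ext E; apply: (complete_ext e0 ram).
exact: (Qp_complete (QpP E)).
Qed.

Definition mxge m n (k : int) (A : 'M[K]_(m, n)) : Prop := forall i j, A i j \in vge v k.

Lemma mxgeD m n k (A B : 'M[K]_(m, n)) : mxge k A -> mxge k B -> mxge k (A + B).
Proof. by move=> hA hB i j; rewrite mxE; apply: vgeD. Qed.

Lemma mxgeN m n k (A : 'M[K]_(m, n)) : mxge k A -> mxge k (- A).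
Proof. by move=> hA i j; rewrite mxE; apply: vgeN. Qed.

Lemma mxgeB m n k (A B : 'M[K]_(m, n)) : mxge k A -> mxge k B -> mxge k (A - B).
Proof. by move=> hA hB; apply: mxgeD => //; apply: mxgeN. Qed.

Lemma mxgeM m n r k l (A : 'M[K]_(m, n)) (B : 'M[K]_(n, r)) :
  mxge k A -> mxge l B -> mxge (k + l) (A *m B).
Proof.
by move=> hA hB i j; rewrite mxE; apply: vge_sum => t _; apply: vgeM.
Qed.

Lemma mxge_le m n k l (A : 'M[K]_(m, n)) : k <= l -> mxge l A -> mxge k A.
Proof. by move=> kl hA i j; apply: vge_le (hA i j). Qed.

Lemma mxgeZ m n k a (A : 'M[K]_(m, n)) : a \in vge v 0 -> mxge k A -> mxge k (a *: A).
Proof. by move=> ha hA i j; rewrite mxE -[k]add0r; apply: vgeM. Qed.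

Lemma mxge_adj m n k (A : 'M[K]_(m, n)) : mxge k A -> mxge k (adj sg A).
Proof. by move=> hA i j; rewrite !mxE; apply: vge_conj. Qed.

Lemma mxge1 n : mxge 0 (1%:M : 'M[K]_n).
Proof. by move=> i j; rewrite mxE; case: (i == j); rewrite ?vge0 ?vge1. Qed.

Lemma mxge_all0 m n (A : 'M[K]_(m, n)) : (forall k : nat, mxge k.+1%:Z A) -> A = 0.
Proof.
move=> h; apply/matrixP => i j; rewrite mxE; apply: (@vge_all0 _ v) => k.
by apply: vge_le (h k i j); lia.
Qed.

Section Newton.
Variables (n : nat) (A S : 'M[K]_n).
Hypothesis A1 : mxge 1 (A - 1%:M).
Hypothesis AS : A *m S = S *m adj sg A.
Hypothesis S0 : mxge 0 S.

(** Newton iteration for the equation T^2 = A, with the derivative 2T replaced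
    by 2, as T is congruent to 1. *)
Fixpoint newton (k : nat) : 'M[K]_n :=
  if k is k'.+1 then newton k' - 2^-1 *: (newton k' *m newton k' - A) else 1%:M.

(** Every iterate is a polynomial in A.  Therefore it commutes with A and, like A,
    is self-adjoint for S. *)
Lemma newtonP k : [/\ mxge 1 (newton k - 1%:M),
  mxge k.+1%:Z (newton k *m newton k - A),
  newton k *m A = A *m newton k & newton k *m S = S *m adj sg (newton k)].
Proof.
have hh := half_int E p_prime p_odd.
elim: k => [|k [t1 te tA tS]] /=.
  split; first by rewrite subrr => i j; rewrite mxE vge0.
  - by rewrite mul1mx -opprB; apply: mxgeN.
  - by rewrite mulmx1 mul1mx.
  by rewrite adj1 mulmx1 mul1mx.
set t := newton k in t1 te tA tS *; set e := t *m t - A in te *.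
have et : t *m e = e *m t by rewrite /e mulmxBr mulmxBl mulmxA tA.
split.
- rewrite addrAC; apply: mxgeB => //; apply: mxgeZ => //.
  by apply: mxge_le te; lia.
- have -> : (t - 2^-1 *: e) *m (t - 2^-1 *: e) - A =
      2^-1 *: (2^-1 *: (e *m e)) - (t - 1%:M) *m e.
    have ee : t *m e = 2^-1 *: (t *m e) + 2^-1 *: (t *m e).
      by rewrite -scalerDl -mulr2n -(mulr_natr 2^-1) mulVf ?nat_neq0 // scale1r.
    have eE : t *m t = e + A by rewrite /e subrK.
    clearbody e; rewrite !mulmxBl !mulmxBr -!scalemxAl -!scalemxAr -et mul1mx eE [X in _ = _ - (X - _)]ee.
    move: (t *m e) (e *m e) => b c.
    by apply/matrixP => i j; rewrite !mxE; ring.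
  apply: mxgeB.
    apply: mxgeZ => //; apply: mxgeZ => //.
    by apply: mxge_le (mxgeM te te); lia.
  by apply: mxge_le (mxgeM t1 te); lia.
- rewrite mulmxBl mulmxBr tA -scalemxAl -scalemxAr /e mulmxBl mulmxBr; congr (_ - _ *: (_ - _)).
  by rewrite -mulmxA tA mulmxA tA mulmxA.
have sgh : sg 2^-1 = 2^-1 by rewrite fmorphV rmorph_nat.
rewrite mulmxBl adjB adjZ /= sgh mulmxBr tS -scalemxAl -scalemxAr /e adjB adjM mulmxBl mulmxBr AS.
by rewrite -mulmxA tS !mulmxA tS.
Qed.

Lemma newton_cauchy k l : (k <= l)%N -> mxge k.+1%:Z (newton l - newton k).
Proof.
have hh := half_int E p_prime p_odd.
elim: l => [|l IH].
  by rewrite leqn0 => /eqP ->; rewrite subrr => i j; rewrite mxE vge0.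
rewrite leq_eqVlt => /orP[/eqP->|lt]; first by rewrite subrr => i j; rewrite mxE vge0.
have [_ te _ _] := newtonP l.
rewrite /= addrAC; apply: mxgeB; first exact: IH.
by apply: mxgeZ => //; apply: mxge_le te; lia.
Qed.

(** The entries of the Newton iterates converge, and the properties of the
    iterates pass to the limit. *)
Lemma selfadjoint_sqrt : exists T : 'M[K]_n,
  [/\ mxge 1 (T - 1%:M) & T *m S *m adj sg T = A *m S].
Proof.
have lim i j : exists l, tends v (fun k => newton k i j) l.
  apply: complete_F => m; exists `|m|%N => k l hk hl.
  have aux r : (`|m| <= r)%N -> newton r i j - newton `|m| i j \in vge v m.
    by move=> hr; have := newton_cauchy hr i j; rewrite !mxE; apply: vge_le; lia.
  have -> : newton k i j - newton l i j =
    (newton k i j - newton `|m| i j) - (newton l i j - newton `|m| i j) by ring.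
  by apply: vgeB; apply: aux.
pose T := \matrix_(i, j) projT1 (cid (lim i j)).
have Tk k : mxge k.+1%:Z (T - newton k).
  move=> i j; rewrite !mxE; have [N hN] := projT2 (cid (lim i j)) k.+1%:Z.
  set l := projT1 _ in hN *; have hM := hN (maxn N k) (leq_maxl _ _).
  have := newton_cauchy (leq_maxr N k) i j; rewrite !mxE => hM'.
  have -> : l - newton k i j = (newton (maxn N k) i j - newton k i j) - (newton (maxn N k) i j - l) by ring.
  exact: vgeB.
have T1 : mxge 1 (T - 1%:M) by apply: (Tk 0%N).
have T0 : mxge 0 T.
  rewrite -[T](subrK 1%:M); apply: mxgeD; last exact: mxge1.
  by apply: mxge_le T1.
have n0 k : mxge 0 (newton k).
  have [t1 _ _ _] := newtonP k; rewrite -[newton k](subrK 1%:M); apply: mxgeD; last exact: mxge1.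
  by apply: mxge_le t1.
have TT : T *m T = A.
  apply/eqP; rewrite -subr_eq0; apply/eqP/mxge_all0 => k.
  have [_ te _ _] := newtonP k.
  have -> : T *m T - A = (T *m (T - newton k) + (T - newton k) *m newton k) +
     (newton k *m newton k - A).
    rewrite mulmxBr mulmxBl; move: (T *m T) (T *m newton k) (newton k *m newton k) => a b c.
    by apply/matrixP => i j; rewrite !mxE; ring.
  apply: mxgeD => //; apply: mxgeD.
    by rewrite -[k.+1%:Z]add0r; apply: mxgeM.
  by rewrite -[k.+1%:Z]addr0; apply: mxgeM.
have TS : T *m S = S *m adj sg T.
  apply/eqP; rewrite -subr_eq0; apply/eqP/mxge_all0 => k.
  have [_ _ _ tS] := newtonP k.
  have -> : T *m S - S *m adj sg T = (T - newton k) *m S - S *m adj sg (T - newton k).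
      by rewrite adjB mulmxBr mulmxBl tS opprB [RHS]addrA subrK.
  apply: mxgeB.
    by rewrite -[k.+1%:Z]addr0; apply: mxgeM.
  by rewrite -[k.+1%:Z]add0r; apply: mxgeM => //; apply: mxge_adj.
by exists T; split=> //; rewrite -mulmxA -TS mulmxA TT.
Qed.

End Newton.

Lemma mxge1_unit n (T : 'M[K]_n) : mxge 1 (T - 1%:M) -> T \in unitmx.
Proof.
move=> T1.
have T0 i j : T i j \in vring v.
  have -> : T i j = (T - 1%:M) i j + (1%:M : 'M[K]_n) i j by rewrite !mxE subrK.
  by apply: vgeD; [apply: vge_le (T1 i j)|apply: mxge1].
pose TO : 'M[O]_n := \matrix_(i, j) VInt (T0 i j).
have eT : T = map_mx (@toK p E) TO by apply/matrixP => i j; rewrite !mxE.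
have red1 : map_mx (red 0) TO = 1%:M :> 'M[Rq E 0]_n.
  apply/matrixP => i j; rewrite !mxE -(rmorph1 (red 0)) -rmorphMn; apply/eqP.
  rewrite red_eq; have := T1 i j; rewrite !mxE; case: (i == j) => //=.
rewrite eT unitmxE det_map_mx unitfE; apply/eqP => d0.
have : red 0 (\det TO) = 1 :> Rq E 0 by rewrite -det_map_mx red1 det1.
have -> : \det TO = 0 by apply: vval_inj.
by rewrite rmorph0 => /eqP; rewrite eq_sym oner_eq0.
Qed.

End SquareRoot.

(** * From approximate isometries to a lattice in the space *)
Section Approximate.
Variables (p : nat) (E : ramQuadExt p).
Hypotheses (p_prime : prime p) (p_odd : odd p).
Local Notation K := (F E).
Local Notation O := (OF E).
Local Notation v := (vF E).
Local Notation sg := (conjF E).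
Local Notation piK := (piF E).
Local Notation tK := (map_mx (@toK p E)).

Lemma adj_toK m n (A : 'M[O]_(m, n)) : tK (adj (@conjO p E) A) = adj sg (tK A).
Proof. by apply/matrixP => i j; rewrite !mxE. Qed.

(** If X G X^* = A S with A close to 1, then A is self-adjoint for S.  A self-adjoint
    square root T of A gives A S = T S T^*, and T^{-1} X is an exact isometry. *)
Lemma approx_congruence n (G S : 'M[O]_n) :
  adj (@conjO p E) G = - G -> adj (@conjO p E) S = - S -> tK S \in unitmx ->
  (forall N : nat, exists X : 'M[O]_n,
     mxge N%:Z (tK (X *m G *m adj (@conjO p E) X - S))) ->
  exists2 Z : 'M[K]_n, Z \in unitmx & Z *m tK G *m adj sg Z = tK S.
Proof.
move=> skG skS uS appr; have [c hc] := mx_denominator (invmx (tK S)).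
have [X hX] := appr c.+1.
set S1 := X *m G *m _ in hX.
have Si : mxge (- c%:Z) (invmx (tK S)).
  move=> i j; have h := hc c (leqnn c) i j.
  have -> : invmx (tK S) i j = (piK ^+ c)^-1 * (piK ^+ c * invmx (tK S) i j).
    by rewrite mulKf // expf_neq0 ?piF_neq0.
  rewrite -[- c%:Z]addr0; apply: vgeM => //.
  rewrite vge_neq0 ?invr_eq0 ?expf_neq0 ?piF_neq0 // vfunV ?expf_neq0 ?piF_neq0 //.
  by rewrite vfunX ?piF_neq0 // piF_uniformizer; lia.
pose A := 1%:M + tK (S1 - S) *m invmx (tK S).
have A1 : mxge 1 (A - 1%:M).
  rewrite /A addrAC subrr add0r; apply: mxge_le (mxgeM hX Si).
  by lia.
have AS : A *m tK S = tK S1.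
  by rewrite mulmxDl mul1mx -mulmxA mulVmx // mulmx1 map_mxB addrC subrK.
have skSK : adj sg (tK S) = - tK S by rewrite -adj_toK skS map_mxN.
have skS1 : adj sg (tK S1) = - tK S1.
  rewrite -adj_toK /S1 !adjM (adjK (@conjOK p E)) skG mulNmx mulmxN mulmxA.
  by rewrite map_mxN.
have ASS : A *m tK S = tK S *m adj sg A.
  apply: oppr_inj; rewrite {1}AS -skS1 -AS adjM skSK mulNmx //.
have S0 : mxge 0 (tK S) by move=> i j; rewrite mxE; apply: vvalP.
have [T [T1 TS]] := selfadjoint_sqrt p_prime p_odd A1 ASS S0.
have uT := mxge1_unit T1.
have uTs : adj sg T *m adj sg (invmx T) = 1%:M.
  by rewrite -adjM mulVmx // adj1.
pose Z := invmx T *m tK X.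
have ZS : Z *m tK G *m adj sg Z = tK S.
  have -> : Z *m tK G *m adj sg Z = invmx T *m tK S1 *m adj sg (invmx T).
    by rewrite /Z /S1 adjM !map_mxM adj_toK !mulmxA.
  by rewrite -AS -TS !mulmxA mulVmx // mul1mx -mulmxA uTs mulmx1.
exists Z => //; have : tK S \in unitmx by [].
by rewrite -ZS -mulmxA unitmx_mul => /andP[].
Qed.

Lemma lattice_in_congr (L M : hermLattice E) (V : hermSpace E) n (i : L -> V)
    (b : n.-tuple L) (S G : 'M[O]_n) (Z : 'M[K]_n) :
  is_extension (rk L) (@hl_form p E L) i -> basis_of fullv (map_tuple i b) ->
  (forall k l, vval (S k l) = piK * hl_form (tnth b k) (tnth b l)) ->
  has_gram M G -> Z \in unitmx -> Z *m tK G *m adj sg Z = tK S ->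
  lattice_in M V.
Proof.
move=> [ilin iform _] ib hS hM uZ ZG; have rkM := free_basis_rk hM.
case: hM => c [cP hG]; rewrite /lattice_in rkM.
pose W := invmx Z.
have WS : W *m tK S *m adj sg W = tK G.
  rewrite -ZG !mulmxA mulVmx // mul1mx -mulmxA -adjM mulVmx // adj1 mulmx1 //.
pose w j : V := \sum_k W j k *: i (tnth b k).
have wform j l : hs_form V (w j) (w l) = hl_form (tnth c j) (tnth c l).
  apply: (mulfI (piF_neq0 E)); rewrite -hG.
  have /matrixP/(_ j l) := WS; rewrite [RHS]mxE -[toK _]/(vval _) => <-.
  rewrite mxE /w linear_sumr mulr_sumr; apply: eq_bigr => k _.
  rewrite linearZr_LR linear_sumlz /= mxE !mulr_sumr mulr_suml; apply: eq_bigr => r _.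
  by rewrite linearZl_LR /= iform !mxE -[toK _]/(vval _) hS; ring.
pose i' (x : M) : V := \sum_j vval (coord cP x 0 j) *: w j.
have i'c j : i' (tnth c j) = w j.
  rewrite /i' coord_basis (bigD1 j) //= mxE !eqxx vval1 scale1r big1 ?addr0 // => k kj.
  by rewrite mxE (negPf kj) andbF scale0r.
exists i'; split.
- move=> a x y; rewrite /i' coord_linear scaler_sumr -big_split /=; apply: eq_bigr => j _.
  by rewrite !mxE vvalD vvalM scalerDl scalerA.
- move=> x y; rewrite -[in RHS](coordK cP x) -[in RHS](coordK cP y) /comb.
  rewrite hl_form_suml linear_sumlz; apply: eq_bigr => j _.
  rewrite hl_form_sumr linear_sumr; apply: eq_bigr => k _.
  by rewrite linearZl_LR linearZr_LR /= wform hl_formZl hl_formZr.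
exists c => //; rewrite basisEdim size_tuple.
have dV : \dim {:V} = n by rewrite -(size_basis ib).
rewrite dV leqnn andbT; apply/subvP => x _.
have : x \in <<map_tuple i b>>%VS by rewrite (span_basis ib) memvf.
move=> /coord_span ->; apply: rpred_sum => k _; apply: rpredZ.
have -> : (map_tuple i b)`_k = \sum_j Z k j *: w j.
  rewrite -tnth_nth tnth_map /w.
  transitivity (\sum_l (\sum_j Z k j * W j l) *: i (tnth b l)); last first.
    under eq_bigr => l _ do rewrite scaler_suml.
    rewrite exchange_big /=; apply: eq_bigr => j _; rewrite scaler_sumr.
    by apply: eq_bigr => l _; rewrite scalerA.
  have ZW l : \sum_j Z k j * W j l = (k == l)%:R.
    by have /matrixP/(_ k l) := mulmxV uZ; rewrite !mxE.
  rewrite (bigD1 k) //= ZW eqxx scale1r big1 ?addr0 // => l lk.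
  by rewrite ZW eq_sym (negPf lk) scale0r.
apply: rpred_sum => j _; apply: rpredZ; apply: memv_span.
by rewrite -i'c; apply: map_f; apply: mem_tnth.
Qed.

End Approximate.

(** * Densities as counts at one level *)
Section DensityLimit.
Variables (R : realType) (p : nat) (E : ramQuadExt p).
Hypotheses (p_prime : prime p) (p_odd : odd p).
Local Notation K := (F E).
Local Notation O := (OF E).
Local Notation q := (resq E).
Local Notation x := (q%:R : R).

(** The modulus is pi^{2d+2}. *)
Definition nrep d m n (G : 'M[O]_m) (S : 'M[O]_n) : nat :=
  nreps (@conjq p E d.*2.+1) (map_mx (red d.*2.+1) G) (map_mx (red d.*2.+1) S).

Lemma x_neq0 : x != 0.
Proof. by rewrite pnatr_eq0 -lt0n ltnW // resq_gt1. Qed.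

(** The exponent of q^d in the normalisation of the density. *)
Definition dens_exp (n m : nat) : int := n%:Z * (2 * m%:Z - n%:Z).

Lemma dens_expS d n m :
  x ^ (d.+2%:Z * dens_exp n m) * x ^+ (n * n) = x ^ (d.+1%:Z * dens_exp n m) * x ^+ (2 * (n * m)).
Proof.
rewrite !exprnP -!expfzDr ?x_neq0 //; congr (_ ^ _); rewrite /dens_exp.
by rewrite -[d.+2]addn2 -[d.+1]addn1 !PoszD !PoszM; ring.
Qed.

Lemma lim_eventually_const (u : nat -> R) (l : R) (N : nat) :
  (forall d, (N <= d)%N -> u d = l) -> limn u = l.
Proof.
move=> h; apply: cvg_lim => //.
apply: cvg_near_cst; near=> d; apply: h; near: d; exact: nbhs_infty_ge.
Unshelve. all: by end_near.
Qed.

(** The level [d0] depends on L only.  This allows all the lattices M, H-summands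
    included, to be treated at one level. *)
Lemma Den_stable (L : hermLattice E) : integral_lattice L ->
  exists d0, forall (M : hermLattice E) n m (S : 'M[O]_n) (G : 'M[O]_m) d,
    has_gram L S -> has_gram M G -> (d0 <= d)%N ->
    Den R M L = (nrep d G S)%:R / x ^ (d.+1%:Z * dens_exp n m).
Proof.
move=> intL; have [S0 hS0 uS0] := integral_has_gram intL.
have [c [S' S'S]] := quasi_inverse uS0.
exists c.*2 => M n m S G d hS hG le.
have rL := free_basis_rk hS; have rM := free_basis_rk hG.
have nE e : (c.*2 <= e)%N -> (nrep e.+1 G S * q ^ (n * n) = nrep e G S * q ^ (2 * (n * m)))%N.
  move=> le'; have := nreps_step p_prime p_odd (has_gram_skew hG) (has_gram_skew hS0) S'S le'.
  have a e' : nrep e' G S0 = nrep e' G S.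
    by rewrite /nrep -(has_gram_card_Herm e' hS0 hG) (has_gram_card_Herm e' hS hG).
  by rewrite -/(nrep e.+1 G S0) -/(nrep e G S0) !a rL.
have step e : (c.*2 <= e)%N ->
    (nrep e.+1 G S)%:R / x ^ (e.+2%:Z * dens_exp n m) = (nrep e G S)%:R / x ^ (e.+1%:Z * dens_exp n m).
  move=> /nE h; have nz k : x ^ k != 0 by rewrite expfz_neq0 ?x_neq0.
  have nzn k : x ^+ k != 0 by rewrite expf_neq0 ?x_neq0.
  apply: (mulIf (nz (e.+2%:Z * dens_exp n m))); rewrite divfK //.
  apply: (mulIf (nzn (n * n)%N)); rewrite -!natrX -natrM h natrM !natrX -mulrA.
  by rewrite dens_expS mulrA divfK.
have const e : (d <= e)%N ->
    (nrep e G S)%:R / x ^ (e.+1%:Z * dens_exp n m) = (nrep d G S)%:R / x ^ (d.+1%:Z * dens_exp n m).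
  elim: e => [|e IH]; first by rewrite leqn0 => /eqP ->.
  rewrite leq_eqVlt => /orP[/eqP-> //|lt].
  by rewrite step ?IH // (leq_trans le).
rewrite /Den; case: asboolP => // _.
apply: (@lim_eventually_const _ _ d.+1) => -[//|e] de.
by rewrite (has_gram_card_Herm _ hS hG) -(const e) // rL rM -mulrA.
Qed.

Lemma nrep_neq0 (L M : hermLattice E) n m (S : 'M[O]_n) (G : 'M[O]_m) :
  has_gram L S -> has_gram M G -> Den R M L != 0 ->
  exists d0, forall d, (d0 <= d)%N -> nrep d G S != 0%N.
Proof.
move=> hS hG; have intL := has_gram_integral hS.
have [d0 h] := Den_stable intL.
move=> D0; exists d0 => d le; move: D0; rewrite (h _ _ _ _ _ _ hS hG le).
by apply: contra => /eqP ->; rewrite mul0r.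
Qed.

End DensityLimit.

(** * Explicit counts and the density polynomial *)
Lemma map_Jmx (A B : comNzRingType) (f : {rmorphism A -> B}) : map_mx f (Jmx A) = Jmx B.
Proof. by rewrite /Jmx map_block_mx !map_mx0 map_mxN map_mx1. Qed.

Lemma map_Hs (A B : comNzRingType) (f : {rmorphism A -> B}) k m (G : 'M[A]_m) :
  map_mx f (Hs k G) = Hs k (map_mx f G).
Proof.
by elim: k => //= k IH; rewrite /Hsum map_block_mx map_Jmx !map_mx0 IH.
Qed.

Lemma expn_hdim (a k m : nat) : (a ^ hdim k m)%N = (a ^ (k.*2 + m))%N.
Proof. by rewrite hdimE. Qed.

Lemma norm_card_solve (K : fieldType) (Q x : K) (N c u M : nat) k :
  c%:R = Q -> u%:R = Q ^+ 2 / x -> M%:R = Q ^+ 2 ->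
  (N * c + u ^ k = M ^ k)%N ->
  N%:R * Q = Q ^+ (2 * k) * (1 - x ^- k).
Proof.
move=> hc hu hM /(congr1 (fun n => n%:R : K)); rewrite natrD natrM !natrX hc hu hM => e.
have {}e := canRL (addrK _) e; rewrite e expr_div_n.
by rewrite (exprM Q 2) mulrBr mulr1.
Qed.

Lemma hyp_card_solve (K : fieldType) (Q x : K) (N c c' u M a b m : nat) : Q != 0 ->
  c%:R = Q -> c'%:R = Q -> u%:R = Q ^+ 2 / x -> M%:R = Q ^+ 2 ->
  (N * c + u ^ a * M ^ m * (c' * M ^ b) = M ^ (a + m) * (c' * M ^ b))%N ->
  N%:R = Q ^+ (2 * a + 2 * m + 2 * b) * (1 - x ^- a).
Proof.
move=> Q0 hc hc' hu hM /(congr1 (fun n => n%:R : K)).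
rewrite natrD !natrM !natrX hc hc' hu hM => e; apply: (mulIf Q0).
have {}e := canRL (addrK _) e; rewrite e expr_div_n.
rewrite (exprD Q _ (2 * b)) (exprD Q (2 * a)) !(exprM Q 2) exprD.
move: (_ ^+ a) (_ ^+ m) (_ ^+ b) (x ^- _) => y1 y2 y3 y4.
by ring.
Qed.

Section Formulas.
Variables (R : realType) (p : nat) (E : ramQuadExt p).
Hypotheses (p_prime : prime p) (p_odd : odd p).
Local Notation K := (F E).
Local Notation O := (OF E).
Local Notation q := (resq E).
Local Notation x := (q%:R : R).
Local Notation pi := (piO E).

Section Level.
Variable d : nat.
Local Notation j := (d.*2.+1).
Local Notation s := (@conjq p E j).
Local Notation rpi := (red j pi).
Local Notation Q := (x ^+ d.+1).

Let sK := @conjqK p E j.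
Let h2P := red_halfP E p_prime p_odd j.
Let locR := @local_Rq p E p_prime p_odd j.
Let s_res := @conj_residue p E p_prime p_odd j.
Let s_pi := @conj_pi p E j.
Let pi_nz := @pi_neq0 p E p_prime p_odd d.
Let pi_gen := @nonunit_pi p E p_prime p_odd j.
Let pi_ann := @pi_real_ann p E p_prime p_odd d.

Lemma Q_neq0 : Q != 0. Proof. by rewrite expf_neq0 ?x_neq0. Qed.

Lemma cardR_real : (#|{: Rq E j}|)%:R = Q ^+ 2 :> R.
Proof. by rewrite card_Rq natrX -exprM; congr (_ ^+ _); lia. Qed.

Lemma cminus_real : (cminus s)%:R = Q.
Proof. by rewrite (cminusE E p_prime p_odd d) natrX. Qed.

Lemma cplus_real : (cplus s)%:R = Q.
Proof. by rewrite (cplus_cminus E p_prime p_odd d) cminus_real. Qed.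

Lemma cnonunit_real : (cnonunit (Rq E j))%:R = Q ^+ 2 / x :> R.
Proof.
have := card_nonunit E p_prime p_odd j => /(congr1 (fun n => n%:R : R)); rewrite natrM cardR_real => <-.
by rewrite mulrC mulKf ?x_neq0.
Qed.

Lemma nrep_I1 k n (S : 'M[O]_n) :
  nrep d (Hs k.+1 (0 : 'M[O]_0)) (block_mx ((- pi)%:M : 'M[O]_1) 0 0 S) =
  (nrep d (Hs k.+1 (0 : 'M[O]_0)) ((- pi)%:M : 'M[O]_1) *
   nrep d (block_mx (pi%:M : 'M[O]_1) 0 0 (Hs k (0 : 'M[O]_0))) S)%N.
Proof.
rewrite /nrep !map_Hs !map_block_mx !map_scalar_mx !map_mx0 !map_Hs !map_mx0 (rmorphN (red j)).
exact: (nreps_I1 sK h2P locR s_res s_pi pi_nz pi_gen).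
Qed.

Lemma nrep_norm k : (nrep d (Hs k (0 : 'M[O]_0)) ((- pi)%:M : 'M[O]_1))%:R * Q =
  Q ^+ (4 * k) * (1 - x ^- k.*2).
Proof.
have := nreps_norm_pi sK h2P locR s_res s_pi pi_nz pi_gen k.
rewrite expn_hdim addn0 /nrep !map_Hs !map_scalar_mx !map_mx0 (rmorphN (red j)).
have -> : (4 * k = 2 * k.*2)%N by lia.
exact: norm_card_solve cminus_real cnonunit_real cardR_real.
Qed.

Lemma nrep_J k m (G : 'M[O]_m) : adj (@conjO p E) G = - G ->
  (forall y, ~~ prim s (map_mx (red j) G) y) ->
  (nreps s (Hs k.+1 (map_mx (red j) G)) (Jmx _))%:R =
  Q ^+ (8 * k + 4 + 4 * m) * (1 - x ^- k.+1.*2).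
Proof.
move=> skG np; have skG' : adj s (map_mx (red j) G) = - map_mx (red j) G.
  by rewrite -adj_red skG map_mxN.
have := nreps_hyp_card sK h2P locR s_res k skG' np; rewrite !expn_hdim.
have -> : (8 * k + 4 + 4 * m = 2 * k.+1.*2 + 2 * m + 2 * (k.*2 + m))%N by lia.
exact: hyp_card_solve Q_neq0 cminus_real cplus_real cnonunit_real cardR_real.
Qed.

Lemma nrep_self k m (G : 'M[O]_m) : adj (@conjO p E) G = - G ->
  (forall y, ~~ prim s (map_mx (red j) G) y) ->
  (nrep d (Hs k G) (Hs k G))%:R = Q ^+ (4 * k * k + 4 * m * k) *
   (\prod_(i < k) (1 - x ^- i.+1.*2)) * (nrep d G G)%:R.
Proof.
move=> skG np; have skG' : adj s (map_mx (red j) G) = - map_mx (red j) G.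
  by rewrite -adj_red skG map_mxN.
rewrite /nrep !map_Hs (nreps_Hs sK h2P locR) // natrM; congr (_ * _).
rewrite natr_prod (eq_bigr (fun i : 'I_k => Q ^+ (8 * i + 4 + 4 * m) * (1 - x ^- i.+1.*2))).
  rewrite big_split /=; congr (_ * _); elim: k => [|k IH]; first by rewrite big_ord0 !muln0 expr0.
  by rewrite big_ord_recr /= IH -exprD; congr (_ ^+ _); lia.
by move=> i _; rewrite nrep_J.
Qed.

Lemma nrep_even k : (nrep d (Hs k (0 : 'M[O]_0)) (Hs k (0 : 'M[O]_0)))%:R =
  Q ^+ (4 * k * k) * \prod_(i < k) (1 - x ^- i.+1.*2).
Proof.
rewrite nrep_self ?adj0 ?oppr0 //; last by move=> y; rewrite map_mx0; apply: noprim0.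
rewrite muln0 mul0n addn0 /nrep map_mx0 nreps00 mulr1 //.
Qed.

Lemma nrep_odd k : (nrep d (Hs k (pi%:M : 'M[O]_1)) (Hs k (pi%:M : 'M[O]_1)))%:R =
  Q ^+ (4 * k * k + 4 * k + 1) * (2 * \prod_(i < k) (1 - x ^- i.+1.*2)).
Proof.
have npi : map_mx (red j) (pi%:M : 'M[O]_1) = rpi%:M by rewrite map_scalar_mx.
rewrite nrep_self; first last.
- by move=> y; rewrite npi; apply: (noprim_pi h2P s_res s_pi).
- rewrite adj_scalar -raddfN; congr (_%:M); apply: vval_inj.
  by rewrite vval_conjO vvalN /= piF_conj.
rewrite /nrep npi (nreps_pi sK h2P locR s_res pi_ann) -muln2 natrM cminus_real muln1.
by rewrite [in RHS]exprD expr1; ring.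
Qed.

End Level.

(** At a fixed sufficient level, [nreps_poly] applies to M plus k hyperbolic
    planes; the normalisation absorbs the power of q that grows with k. *)
Lemma DenX_exists (M L : hermLattice E) m (G : 'M[O]_m) :
  integral_lattice L -> has_gram M G -> exists P, is_DenX R M L P.
Proof.
move=> intL hM; have [S hL _] := integral_has_gram intL.
have [d hd] := Den_stable R p_prime p_odd intL.
have hk k : has_gram (oplus M (Hpow E k)) (Hs k G).
  by apply: has_gram_iso' (lat_iso_oplusC _ _) _; apply: has_gram_oplus_Hpow.
have T_real t : t \in reps E d.*2.+1 -> conjq t = t.
  by move=> /imsetP[c _ ->]; apply: conj_red_rep.
have T_unit t t' : t \in reps E d.*2.+1 -> t' \in reps E d.*2.+1 -> t != t' -> unitb (t - t').
  move=> /imsetP[c _ ->] /imsetP[c' _ ->] ne; rewrite (red_rep_inj p_prime p_odd).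
  by apply: contraNneq ne => ->.
have [P hP] := nreps_poly (@conj_pi2 p E d) (pi2_nilp E p_prime p_odd d) T_real
  (@real_reps p E p_prime p_odd d) T_unit (card_reps E p_prime p_odd d.*2.+1) (resq_gt1 E)
  (card_Rq E d.*2.+1) (map_mx (red d.*2.+1) G) (map_mx (red d.*2.+1) S).
pose e := dens_exp (rk L) m.
exists ((q%:R ^ (d.+1%:Z * e))^-1 *: P) => k.
have q0 : (q%:R : rat) != 0 by rewrite pnatr_eq0 -lt0n ltnW // resq_gt1.
rewrite (hd _ _ _ _ _ _ hL (hk k) (leqnn d)) /nrep map_Hs.
have := hP k => /(congr1 (@ratr R)); rewrite ratr_nat rmorphM /= => ->.
rewrite hornerZ rmorphM /= [RHS]mulrAC; congr (_ * _).
have -> : dens_exp (rk L) (hdim k m) = e + (k.*2 * rk L)%:Z * 2.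
  by rewrite /dens_exp /e /dens_exp hdimE PoszD PoszM; ring.
have x0 := x_neq0 R E.
have -> : (q ^ (d.*2.+2 * rk L))%:R ^+ k.*2 = q%:R ^ (d.+1%:Z * ((k.*2 * rk L)%:Z * 2)) :> rat.
  rewrite natrX -exprM exprnP; congr (_ ^ _).
  by rewrite -[d.*2.+2]/(d.+1.*2) -muln2 !PoszM; ring.
rewrite fmorphV !fmorphXz /= ratr_nat (mulrDr _ e) expfzDr //.
by rewrite [in RHS]mulrC invfM mulfVK // expfz_neq0.
Qed.

End Formulas.

(** * Cancellation of the vector of norm -1 *)
Section Cancellation.
Variables (R : realType) (p : nat) (E : ramQuadExt p).
Hypotheses (p_prime : prime p) (p_odd : odd p).
Local Notation K := (F E).
Local Notation O := (OF E).
Local Notation q := (resq E).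
Local Notation x := (q%:R : R).
Local Notation pi := (piO E).

Lemma has_gram_oplusH (M : hermLattice E) k m (G : 'M[O]_m) :
  has_gram M G -> has_gram (oplus M (Hpow E k)) (Hs k G).
Proof. by move=> hM; apply: has_gram_iso' (lat_iso_oplusC _ _) _; apply: has_gram_oplus_Hpow. Qed.

Lemma latticeM_even r : latticeM E r.+1.*2 = Hpow E r.+1.
Proof. by rewrite /latticeM odd_double doubleK. Qed.

Lemma latticeM_odd r : latticeM E r.*2.+1 = oplus (Hpow E r) (I1 (unit1 E)).
Proof. by rewrite /latticeM /= odd_double /= uphalf_double. Qed.

Lemma has_gram_unit1 : has_gram (I1 (unit1 E)) (pi%:M : 'M[O]_1).
Proof. by apply: has_gram_I1; rewrite scale1r mulr1. Qed.

Lemma has_gram_unitN1 : has_gram (I1 (unitN1 E)) ((- pi)%:M : 'M[O]_1).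
Proof. by apply: has_gram_I1; rewrite vvalN scaleN1r mulrN1. Qed.

Lemma has_gram_odd r : has_gram (latticeM E r.*2.+1) (Hs r (pi%:M : 'M[O]_1)).
Proof. by rewrite latticeM_odd; apply: has_gram_oplus_Hpow has_gram_unit1. Qed.

Lemma has_gram_odd_Hpow r k : has_gram (oplus (latticeM E r.*2.+1) (Hpow E k))
  (block_mx (pi%:M : 'M[O]_1) 0 0 (Hs (r + k) (0 : 'M[O]_0))).
Proof.
rewrite latticeM_odd; apply: (@has_gram_iso' _ _ _ (oplus (I1 (unit1 E)) (oplus (Hpow E r) (Hpow E k)))).
  apply: lat_iso_trans (lat_iso_oplusA _ _ _).
  by apply: lat_iso_oplus (lat_iso_oplusC _ _) (lat_iso_refl _).
by apply: has_gram_oplus has_gram_unit1 _; apply: has_gram_Hpow2.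
Qed.

Lemma has_gram_adjoin_N1 (Ls L : hermLattice E) n (S : 'M[O]_n) :
  isometric Ls (oplus L (I1 (unitN1 E))) -> has_gram L S ->
  has_gram Ls (block_mx ((- pi)%:M : 'M[O]_1) 0 0 S).
Proof.
move=> /isometric_lat_iso iso hL; apply: has_gram_iso' iso _.
apply: has_gram_iso' (lat_iso_oplusC _ _) _.
exact: has_gram_oplus has_gram_unitN1 hL.
Qed.

(** Splitting off the vector of norm -1 of L#: its images in H^{r+1+k} are counted by
    [nrep_norm], and their complement is the sum of I_1^1 and H^{r+k}. *)
Lemma Den_cancel (Ls L : hermLattice E) r k :
  isometric Ls (oplus L (I1 (unitN1 E))) -> integral_lattice L ->
  Den R (oplus (latticeM E r.+1.*2) (Hpow E k)) Ls =
  (1 - x ^- (r + k).+1.*2) * Den R (oplus (latticeM E r.*2.+1) (Hpow E k)) L.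
Proof.
move=> iso intL; have [S hL _] := integral_has_gram intL; have hLs := has_gram_adjoin_N1 iso hL.
have [d0 h] := Den_stable R p_prime p_odd intL.
have [d1 hs] := Den_stable R p_prime p_odd (has_gram_integral hLs).
pose d := maxn d0 d1.
have hM : has_gram (oplus (latticeM E r.+1.*2) (Hpow E k)) (Hs (r + k).+1 (0 : 'M[O]_0)).
  rewrite latticeM_even; exact: (has_gram_Hpow2 E r.+1 k).
rewrite (h _ _ _ _ _ _ hL (has_gram_odd_Hpow r k) (leq_maxl d0 d1)).
rewrite (hs _ _ _ _ _ _ hLs hM (leq_maxr d0 d1)) -/d nrep_I1 // natrM.
have := nrep_norm R E p_prime p_odd d (r + k).+1; set a := (r + k)%N.
move: (nrep _ _ _) (nrep _ _ _) => N1 N2 hN1.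
have x0 := x_neq0 R E; have nz e : x ^ e != 0 by rewrite expfz_neq0.
have -> : dens_exp (1 + rk L) (hdim a.+1 0) = dens_exp (rk L) (1 + hdim a 0) + (4 * a + 3)%N%:Z.
  by rewrite /dens_exp !hdimE -[a.+1]addn1 -!muln2 !PoszD !PoszM !PoszD; ring.
rewrite mulrDr expfzDr // invfM -!mulrA [RHS]mulrCA [LHS]mulrCA; congr (_ * _).
rewrite mulrCA [RHS]mulrC; congr (_ * _).
apply: (mulIf (nz (d.+1%:Z * (4 * a + 3)%N%:Z))); rewrite divfK //.
apply: (mulIf (nz d.+1%:Z)); rewrite -[x ^ d.+1]/(x ^+ d.+1) hN1 mulrC -mulrA; congr (_ * _).
rewrite (exprnP _ d.+1) -[in RHS]expfzDr // -exprM exprnP; congr (_ ^ _).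
by rewrite -[a.+1]addn1 !PoszM !PoszD; ring.
Qed.

End Cancellation.

(** * Derivatives of the density polynomials *)
Section Derivatives.
Variables (R : realType) (p : nat) (E : ramQuadExt p).
Hypotheses (p_prime : prime p) (p_odd : odd p).
Local Notation K := (F E).
Local Notation O := (OF E).
Local Notation q := (resq E).
Local Notation x := (q%:R : R).
Local Notation pi := (piO E).

Lemma Den_even r : Den R (latticeM E r.+1.*2) (latticeM E r.+1.*2) =
  \prod_(i < r.+1) (1 - x ^- i.+1.*2).
Proof.
have hM : has_gram (latticeM E r.+1.*2) (Hs r.+1 (0 : 'M[O]_0)).
  by rewrite latticeM_even; apply: has_gram_Hpow.
have [d h] := Den_stable R p_prime p_odd (has_gram_integral hM).
rewrite (h _ _ _ _ _ _ hM hM (leqnn d)) nrep_even // mulrC mulrA.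
have -> : d.+1%:Z * dens_exp (hdim r.+1 0) (hdim r.+1 0) = (d.+1 * (4 * r.+1 * r.+1))%N%:Z.
  by rewrite /dens_exp hdimE -muln2 addn0 !PoszM; ring.
by rewrite -exprM -exprnP mulVf ?mul1r // expf_neq0 // x_neq0.
Qed.

Lemma Den_odd r : Den R (latticeM E r.*2.+1) (latticeM E r.*2.+1) =
  2 * \prod_(i < r) (1 - x ^- i.+1.*2).
Proof.
have hM := has_gram_odd E r.
have [d h] := Den_stable R p_prime p_odd (has_gram_integral hM).
rewrite (h _ _ _ _ _ _ hM hM (leqnn d)) nrep_odd // mulrC mulrA.
have -> : d.+1%:Z * dens_exp (hdim r 1) (hdim r 1) = (d.+1 * (4 * r * r + 4 * r + 1))%N%:Z.
  by rewrite /dens_exp hdimE -muln2 !(PoszM, PoszD); ring.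
by rewrite -exprM -exprnP mulVf ?mul1r // expf_neq0 // x_neq0.
Qed.

(** A nonzero density yields isometries modulo all powers of pi, hence an isometry
    over F between V and the split space. *)
Lemma Den_nonsplit (V : hermSpace E) (L : hermLattice E) r :
  \dim {:V} = r.+1.*2 -> ~ split_space V -> lattice_in L V ->
  Den R (oplus (latticeM E r.+1.*2) (Hpow E 0)) L = 0.
Proof.
move=> dV nsp [i ext]; apply/eqP; apply: contraT => D0; case: nsp.
have intL : integral_lattice L.
  by move: D0; rewrite /Den; case: asboolP => //; rewrite eqxx.
pose G : 'M[O]_(hdim r.+1 0) := Hs r.+1 0.
have hM : has_gram (latticeM E r.+1.*2) G by rewrite latticeM_even; apply: has_gram_Hpow.
have rL : rk L = hdim r.+1 0.
  by case: ext => _ _ [b _ ib]; rewrite hdimE addn0 -dV -(size_basis ib).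
have ext' : is_extension (hdim r.+1 0) (@hl_form p E L) i by rewrite -rL.
have [b [S [bP ib hS uS]]] := integral_gram intL ext'.
have hL : has_gram L S by exists b.
have [d0 hd] := nrep_neq0 p_prime p_odd hL (has_gram_oplusH 0 hM) D0.
have [|Z uZ ZG] := approx_congruence p_prime p_odd (has_gram_skew hM) (has_gram_skew hL) uS.
  move=> N; pose d := maxn d0 N.
  have := hd d (leq_maxl _ _); rewrite /nrep /nreps -lt0n => /card_gt0P[X].
  rewrite inE => /eqP e; exists (map_mx (@lift p E d.*2.+1) X).
  set Y := map_mx _ X.
  have XY : X = map_mx (red d.*2.+1) Y.
    by apply/matrixP => k l; rewrite !mxE liftK.
  move: e; rewrite XY -adj_red -!map_mxM => /red_mx_eq[D ->] k l.
  rewrite !mxE -[toK _]/(vval _) vvalM vvalX.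
  rewrite -[N%:Z]addr0; apply: vgeM (vvalP _).
  rewrite vge_neq0 ?expf_neq0 ?piF_neq0 // vfunX ?piF_neq0 // piF_uniformizer.
  have : (N <= d)%N by apply: leq_maxr.
  by move=> le; lia.
rewrite /split_space dV.
exact: (lattice_in_congr ext ib hS hM uZ ZG).
Qed.

(** The points q^{-2k} are infinite in number. *)
Lemma DenX_unique (M L : hermLattice E) P P' :
  is_DenX R M L P -> is_DenX R M L P' -> P = P'.
Proof.
move=> hP hP'; apply/eqP; rewrite -subr_eq0; apply/eqP.
pose z k : rat := q%:R ^- k.*2; set D := P - P'.
have q1 : 1 < q%:R :> rat by rewrite ltr1n resq_gt1.
have zI : injective z.
  move=> a b /invr_inj; have q0 : 0 < q%:R :> rat by rewrite (lt_trans _ q1).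
  by move/(ieexprIn q0 (negbT (gt_eqF q1)))/double_inj.
apply: (@roots_geq_poly_eq0 _ _ [seq z i | i <- iota 0 (size D)]).
- apply/allP => _ /mapP[k _ ->]; rewrite rootE !hornerE subr_eq0.
  by apply/eqP/(fmorph_inj (@ratr R)); exact: etrans (hP k) (esym (hP' k)).
- by rewrite map_inj_uniq ?iota_uniq.
- by rewrite size_map size_iota.
Qed.

Lemma DenXP (M L : hermLattice E) P : is_DenX R M L P -> DenX R M L = P.
Proof. by move=> hP; apply: xget_subset1 => // P1 P2; apply: DenX_unique. Qed.

Lemma DenX_nonintegral (M L : hermLattice E) : ~ integral_lattice L -> DenX R M L = 0.
Proof.
move=> nL; apply: DenXP => k; rewrite horner0 rmorph0 /Den.
by case: asboolP.
Qed.

Lemma dDen_nonintegral (L : hermLattice E) : ~ integral_lattice L -> dDen R L = 0.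
Proof. by move=> nL; rewrite /dDen /Den' DenX_nonintegral // deriv0 horner0 rmorph0 mulr0 mul0r. Qed.

Lemma integral_summand (Ls L : hermLattice E) :
  isometric Ls (oplus L (I1 (unitN1 E))) -> integral_lattice Ls -> integral_lattice L.
Proof.
move=> [f [[g fK gK] hf]] intLs y z.
have h0 : hl_form (0 : I1 (unitN1 E)) 0 = 0.
  by have := hl_formZl 0 (0 : I1 (unitN1 E)) 0; rewrite scale0r mul0r.
have e : hl_form (g (y, 0)) (g (z, 0)) = hl_form y z.
  by rewrite -hf !gK; exact: etrans (congr1 (+%R _) h0) (addr0 _).
by rewrite -e.
Qed.

(** The product rule for (1 - c X) P at X = 1, where P vanishes there. *)
Lemma dDen_cancel_integral (V : hermSpace E) (Ls L : hermLattice E) r :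
  \dim {:V} = r.+1.*2 -> ~ split_space V -> lattice_in Ls V ->
  isometric Ls (oplus L (I1 (unitN1 E))) -> integral_lattice L ->
  dDen R L = 2^-1 * dDen R Ls.
Proof.
move=> dV nsp inV iso intL; have [S hL _] := integral_has_gram intL.
have hLs := has_gram_adjoin_N1 iso hL.
have rLs : rk Ls = r.+1.*2.
  by case: inV => i [_ _ [b _ ib]]; rewrite -dV -(size_basis ib).
have rL : rk L = r.*2.+1 by have := free_basis_rk hLs; rewrite rLs => -[].
have [P hP] := DenX_exists R p_prime p_odd intL (has_gram_odd E r).
pose c : rat := q%:R ^- r.+1.*2; pose Ps := (1 - c *: 'X) * P.
have hPs : is_DenX R (latticeM E r.+1.*2) Ls Ps.
  move=> k; rewrite (Den_cancel R p_prime p_odd r k iso intL) -hP /Ps hornerM rmorphM /= !hornerE.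
  rewrite /c -invfM -exprD -doubleD addSn.
  by rewrite rmorphB rmorph1 fmorphV rmorphXn /= ratr_nat.
have q1 : 1 < q%:R :> rat by rewrite ltr1n resq_gt1.
have c1 : 1 - c != 0.
  rewrite subr_eq0 eq_sym lt_eqF // invf_lt1 ?exprn_gt0 ?(lt_trans _ q1) //.
  by rewrite exprn_egt1.
have P1 : P.[1] = 0.
  have := hPs 0%N; rewrite (Den_nonsplit dV nsp inV) expr0 invr1 => /eqP.
  rewrite fmorph_eq0 /Ps hornerM !hornerE mulf_eq0 (negPf c1) => /eqP //.
have dPs : Ps^`()%R.[1] = (1 - c) * P^`()%R.[1].
  by rewrite /Ps derivM hornerD !hornerM P1 mulr0 add0r !hornerE.
have rc1 : ratr (1 - c) = 1 - x ^- r.+1.*2.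
  by rewrite /c rmorphB rmorph1 fmorphV rmorphXn /= ratr_nat.
have rc0 : 1 - x ^- r.+1.*2 != 0 by rewrite -rc1 fmorph_eq0.
rewrite /dDen /Den' rLs rL (DenXP hPs) (DenXP hP) Den_even Den_odd big_ord_recr.
rewrite dPs (rmorphM (@ratr R)) [in RHS]/= rc1; move: (ratr _) => t.
move: (1 - x ^- _) rc0 (\prod_(i < r) _) => y y0 z.
transitivity (2^-1 * (- 2 * t / z) * (y / y)).
  by rewrite mulfV // mulr1 invfM; ring.
by rewrite !invfM; ring.
Qed.

Lemma dDen_cancel (V : hermSpace E) (Ls L : hermLattice E) r :
  \dim {:V} = r.+1.*2 -> ~ split_space V -> lattice_in Ls V ->
  isometric Ls (oplus L (I1 (unitN1 E))) -> dDen R L = 2^-1 * dDen R Ls.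
Proof.
move=> dV nsp inV iso; have [intL|nL] := pselect (integral_lattice L).
  exact: dDen_cancel_integral dV nsp inV iso intL.
rewrite !dDen_nonintegral ?mulr0 //.
by move=> intLs; apply/nL/(integral_summand iso).
Qed.

End Derivatives.

Theorem proposition4p5 (R : realType) (p : nat) (E : ramQuadExt p)
    (r : nat) (V : hermSpace E) (Ls L : hermLattice E) :
  prime p -> odd p ->
  \dim {:V} = (2 * r + 2)%N -> ~ split_space V ->
  lattice_in Ls V ->
  isometric Ls (oplus L (I1 (unitN1 E))) ->
  dDen R L = 2^-1 * dDen R Ls.
Proof.
move=> p_prime p_odd dV nsp inV iso; apply: (dDen_cancel R p_prime p_odd _ nsp inV iso).
by rewrite dV addn2 mul2n.
Qed.
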